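(* Let $d=1$, $H=\frac12$, $T>0$, let $B$ be a standard one-dimensional Brownian motion on a complete filtered probability space $(\Omega,\mathcal F,\{\mathcal F_t\},\mathbb P)$, and let $\mathbf B$ be either its Itô lift $\mathbf B^{Ito}$ or its Stratonovich lift $\mathbf B^{Strat}$. Let $\alpha\in(\frac13,\frac12)$. Assume: (F1) $f:\mathbb{R}\to\mathbb{R}$ is bounded and continuous; (S1) $\sigma:\mathbb{R}\to\mathbb{R}$ is twice continuously differentiable with $\|\sigma\|_\infty+\|D\sigma\|_\infty+\|D^2\sigma\|_\infty<\infty$; (S2) there is $\lambda>0$ such that $|\sigma(x)|\ge\lambda$ for all $x\in\mathbb{R}$; and that $f$ is $\theta$-Hölder for some $0<\theta<1$, i.e. $\sup_{x\ne y}|f(x)-f(y)|/|x-y|^\theta<\infty$. Then the equation $$X_t=x_0+\int_0^tf(X_s)\,ds+\int_0^t\sigma(X_s)\,d\mathbf B_s,\qquad t\in[0,T],$$ has a path-by-path unique solution with a null set independent of $x_0$: there exists $\mathcal N\subset\Omega$ with $\mathbb P(\mathcal N)=0$, not depending on $x_0$, such that for all $\omega\notin\mathcal N$ and all $x_0\in\mathbb{R}$ the equation driven by $\mathbf B(\omega)$ has exactly one solution $(X,X')\in C^\alpha_{B(\omega)}(\mathbb{R})$.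
   Context: Write $W_{s,t}=W_t-W_s$. An $\alpha$-rough path over an $\alpha$-Hölder path $W$ on $[0,T]$ is $\mathbf W=(W,\mathbb W)$ with $\mathbb W_{s,t}-\mathbb W_{s,u}-\mathbb W_{u,t}=W_{s,u}\otimes W_{u,t}$, $\sup_{s\neq t}|W_{s,t}|/|t-s|^\alpha<\infty$, $\sup_{s\neq t}|\mathbb W_{s,t}|/|t-s|^{2\alpha}<\infty$. Lifts of Brownian motion: $\mathbf B^{Ito}=(B,\mathbb B^{Ito})$ with $\mathbb B^{Ito}_{s,t}=\int_s^t(B_r-B_s)\otimes dB_r$ (Itô integral), $\mathbf B^{Strat}=(B,\mathbb B^{Strat})$ with $\mathbb B^{Strat}_{s,t}=\int_s^t(B_r-B_s)\otimes\circ dB_r$ (Stratonovich integral); almost surely both are $\alpha$-rough paths. $C^\alpha_{B}(\mathbb{R})$ is the space of $B$-controlled rough paths: pairs $(Y,Y')$ of $\alpha$-Hölder paths on $[0,T]$ with $\sup_{s\neq t}|Y_{s,t}-Y'_sB_{s,t}|/|t-s|^{2\alpha}<\infty$. The rough integral of such a pair is $\int_0^tY_rd\mathbf B_r=\lim_{|\mathcal P|\to0}\sum_{[u,v]\in\mathcal P}(Y_uB_{u,v}+Y'_u\mathbb B_{u,v})$, over partitions $\mathcal P$ of $[0,t]$. Solution: $(X,X')\in C^\alpha_B(\mathbb{R})$ is a solution if it is a fixed point of $\Psi(Y,Y')(t)=\big(x_0+\int_0^tf(Y_r)dr+\int_0^t\sigma(Y_r)d\mathbf B_r,\ \sigma(Y_t)\big)$,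 $t\in[0,T]$, where the second integral is the rough integral of $(\sigma(Y),\sigma'(Y)Y')$. In particular $X'=\sigma(X)$. *)

(* Defs.v *)
From HB Require Import structures.
From mathcomp Require Import all_boot all_order all_algebra.
From mathcomp Require Import all_classical all_reals all_analysis.

Set Implicit Arguments.
Unset Strict Implicit.
Unset Printing Implicit Defensive.
Import Order.TTheory GRing.Theory Num.Theory.
Import numFieldNormedType.Exports.

Local Open Scope ring_scope.
Local Open Scope classical_set_scope.

Section partitions.
Context {R : realType}.

(* As in [itv_partition a b p], the partition points are those of [a :: p]. *)
Definition cells (a : R) (p : seq R) : seq (R * R) := zip (a :: p) p.

Definition mesh (a : R) (p : seq R) : R :=
  \big[Num.max/0]_(c <- cells a p) (c.2 - c.1).

Definition partition_sum (a : R) (p : seq R) (F : R -> R -> R) : R :=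
  \sum_(c <- cells a p) F c.1 c.2.

End partitions.

Section rough_paths.
Context {R : realType}.
Implicit Types (T alpha : R) (W : R -> R) (WW : R -> R -> R).

Definition holder_on (D : set R) (alpha : R) (g : R -> R) : Prop :=
  exists C : R, forall s t, D s -> D t -> `|g t - g s| <= C * `|t - s| `^ alpha.

(* The second-order component is indexed by ordered times, as iterated
   integrals over [s, t] are. *)
Definition rough_path T alpha W WW : Prop :=
  [/\ holder_on `[0, T] alpha W,
      exists C : R, forall s t, 0 <= s -> s < t -> t <= T ->
        `|WW s t| <= C * `|t - s| `^ (2 * alpha) &
      forall s u t, 0 <= s -> s <= u -> u <= t -> t <= T ->
        WW s t - WW s u - WW u t = (W u - W s) * (W t - W u)].

Definition controlled_path T alpha W (Y Y' : R -> R) : Prop :=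
  [/\ holder_on `[0, T] alpha Y,
      holder_on `[0, T] alpha Y' &
      exists C : R, forall s t, `[0, T]%classic s -> `[0, T]%classic t ->
        `|Y t - Y s - Y' s * (W t - W s)| <= C * `|t - s| `^ (2 * alpha)].

Definition is_rough_integral W WW (Y Y' : R -> R) (t I : R) : Prop :=
  forall eps : R, 0 < eps -> exists2 delta : R, 0 < delta &
    forall p, itv_partition 0 t p -> mesh 0 p < delta ->
      `|partition_sum 0 p (fun u v => Y u * (W v - W u) + Y' u * WW u v) - I|
        < eps.

(* [(X, X')] is a fixed point of the solution map [Psi] of the equation driven
   by the rough path [(W, WW)] and started from [x0]. *)
Definition rde_solution T alpha (f sigma : R -> R) W WW (x0 : R)
    (X X' : R -> R) : Prop :=
  [/\ rough_path T alpha W WW,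
      controlled_path T alpha W X X' &
      forall t, 0 <= t -> t <= T ->
        (exists2 I : R,
           is_rough_integral W WW (sigma \o X)
             (fun r => derive1 sigma (X r) * X' r) t I &
           X t = x0 + (\int[lebesgue_measure]_(r in `[0, t]) f (X r)) + I)
        /\ X' t = sigma (X t)].

(* Paths live on [0, T], so uniqueness disregards values outside [0, T]. *)
Definition has_unique_rde_solution T alpha (f sigma : R -> R) W WW (x0 : R)
    : Prop :=
  exists X X' : R -> R,
    rde_solution T alpha f sigma W WW x0 X X' /\
    forall Y Y' : R -> R, rde_solution T alpha f sigma W WW x0 Y Y' ->
      forall t, 0 <= t -> t <= T -> Y t = X t /\ Y' t = X' t.

End rough_paths.

Section stochastic.
Context {R : realType} {d : measure_display} {Omega : measurableType d}.
Variable P : probability Omega R.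
Implicit Types (T s t : R) (F : R -> set (set Omega)) (B H X Y : R -> Omega -> R).

Definition measurable_wrt (G : set (set Omega)) (xi : Omega -> R) : Prop :=
  forall A : set R, measurable A -> G (xi @^-1` A).

Definition complete_filtration T F : Prop :=
  [/\ forall t, 0 <= t -> t <= T ->
        sigma_algebra [set: Omega] (F t) /\ F t `<=` measurable,
      forall s t, 0 <= s -> s <= t -> t <= T -> F s `<=` F t,
      measure_is_complete P &
      forall A, P.-negligible A -> F 0 A].

Definition independent_of (G : set (set Omega)) (xi : Omega -> R) : Prop :=
  forall (E : set Omega) (A : set R), G E -> measurable A ->
    P (E `&` xi @^-1` A) = (P E * P (xi @^-1` A))%E.

(* The second parameter of [normal_prob] is the standard deviation. *)
Definition brownian_motion T F B : Prop :=
  [/\ forall t, 0 <= t -> t <= T -> measurable_wrt (F t) (B t),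
      {ae P, forall w, B 0 w = 0},
      {ae P, forall w, {within `[0, T], continuous (fun t => B t w)}} &
      forall s t, 0 <= s -> s < t -> t <= T ->
        independent_of (F s) (fun w => B t w - B s w) /\
        forall A : set R, measurable A ->
          P ((fun w => B t w - B s w) @^-1` A)
          = normal_prob 0 (Num.sqrt (t - s)) A].

(* The simple process with value [xi i] on the [i]-th cell ]u_i, u_{i+1}]
   of the partition [s :: p] of [s, t]. *)
Definition simple_integrand F s t (p : seq R) (xi : nat -> Omega -> R) : Prop :=
  itv_partition s t p /\
  forall i, (i < size p)%N ->
    measurable_wrt (F (s :: p)`_i) (xi i) /\
    exists C : R, forall w, `|xi i w| <= C.

Definition simple_process s (p : seq R) (xi : nat -> Omega -> R) : R -> Omega -> R :=
  fun r w => \sum_(i < size p) xi i w * \1_(`](s :: p)`_i, p`_i]) r.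

Definition simple_ito_integral B s (p : seq R) (xi : nat -> Omega -> R)
    : Omega -> R :=
  fun w => \sum_(i < size p) xi i w * (B p`_i w - B (s :: p)`_i w).

(* [J] is (a version of) the Itô integral of [H] against [B] over [s, t]: the
   L^2(P) limit of the integrals of simple processes that converge to [H] in
   L^2(dt * P). [H] is meant to be adapted with a.s. continuous paths. *)
Definition is_ito_integral F B s t H (J : Omega -> R) : Prop :=
  measurable_fun [set: Omega] J /\
  exists (p : nat -> seq R) (xi : nat -> nat -> Omega -> R),
    [/\ forall n, simple_integrand F s t (p n) (xi n),
        (fun n => \int[P]_w \int[lebesgue_measure]_(r in `[s, t])
            ((simple_process s (p n) (xi n) r w - H r w) ^+ 2)%:E)%E
          @ \oo --> 0%E &
        (fun n => \int[P]_w
            ((simple_ito_integral B s (p n) (xi n) w - J w) ^+ 2)%:E)%E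
          @ \oo --> 0%E].

(* Limit in probability, as the mesh tends to 0, of the sums of products of
   increments of [X] and [Y] over [s, t]. *)
Definition is_quadratic_covariation s t X Y (Q : Omega -> R) : Prop :=
  measurable_fun [set: Omega] Q /\
  forall eps eta : R, 0 < eps -> 0 < eta -> exists2 delta : R, 0 < delta &
    forall p, itv_partition s t p -> mesh s p < delta ->
      (P [set w | (eps <= `|partition_sum s p (fun u v =>
            (X v w - X u w) * (Y v w - Y u w)) - Q w|)%R] <= eta%:E)%E.

Definition is_stratonovich_integral F B s t H (J : Omega -> R) : Prop :=
  exists I Q : Omega -> R,
    [/\ is_ito_integral F B s t H I,
        is_quadratic_covariation s t H B Q &
        forall w, J w = I w + Q w / 2].

(* Stochastic integrals over each [s, t] are determined up to a null set only;
   a lift is a version that is jointly continuous in (s, t). *)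
Definition continuous_version T (BB : R -> R -> Omega -> R) : Prop :=
  {ae P, forall w,
    {within [set z : R * R | 0 <= z.1 /\ z.1 <= z.2 /\ z.2 <= T],
      continuous (fun z : R * R => BB z.1 z.2 w)}}.

Definition ito_lift T F B (BB : R -> R -> Omega -> R) : Prop :=
  continuous_version T BB /\
  forall s t, 0 <= s -> s <= t -> t <= T ->
    is_ito_integral F B s t (fun r w => B r w - B s w) (BB s t).

Definition stratonovich_lift T F B (BB : R -> R -> Omega -> R) : Prop :=
  continuous_version T BB /\
  forall s t, 0 <= s -> s <= t -> t <= T ->
    is_stratonovich_integral F B s t (fun r w => B r w - B s w) (BB s t).

End stochastic.

(* Main.v *)
(** Almost surely [BB s t = (B t - B s) ^ 2 / 2 + c (t - s)] for all [s <= t],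
    with [c = - 1 / 2] (Itô) or [c = 0] (Stratonovich).  For such a path the
    Lamperti transform [g], [g' = 1 / sigma], turns the rough equation into the
    equation with additive noise [dZ = b(Z) dt + dB], where
    [b = (f / sigma + c sigma') o g^-1] is bounded and uniformly continuous;
    solutions exist by Peano's argument.

    Uniqueness simultaneously for all starting points comes from comparison:
    the Euler schemes driven by Lipschitz drifts slightly above and slightly
    below [b], started from the two neighbouring points of a grid, enclose all
    solutions that start between these points.  In the scale [s] of [b], with
    [s' b + s'' / 2 = 0], the two schemes stay close in mean square, at a
    distance proportional to the width of the grid; a grid with [n] cells of
    width [1 / n] thus contributes [n * O(1 / n ^ 2)] to the probability that
    some cell contains two solutions which are apart at a given time. *)

From HB Require Import structures.
Require Import Defs.
From mathcomp Require Import all_boot all_order all_algebra.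
From mathcomp Require Import all_classical all_reals all_analysis measurable_realfun.
From mathcomp Require Import ring lra.
Set Implicit Arguments.
Unset Strict Implicit.
Unset Printing Implicit Defensive.
Import Order.TTheory GRing.Theory Num.Theory.
Import numFieldNormedType.Exports.
Local Open Scope ring_scope.
Local Open Scope classical_set_scope.

(** * Real calculus and the Lamperti transform *)

(** A path-by-path solution is a bare function for one fixed outcome: it need not be adapted, nor
    even measurable in the outcome, so no stochastic calculus applies to it. All probability is
    therefore done on Euler schemes, which are adapted functions of the noise, and a solution meets
    them only through deterministic inequalities. Lipschitz drifts make one small Euler step
    monotone, which is what comparison rests on. A Hölder drift rules out a Gronwall estimate for
    the schemes themselves. In the scale of the drift one step is a martingale increment up to a
    small error, with a Lipschitz diffusion coefficient, so the mean square grows by a factor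
    [1 + C h] per step. This asks for [s'] between two positive constants; the drift is cut off
    outside a bounded interval for that, which is harmless because each solution is bounded on
    [[0, T]]. The distance of the perturbed drifts to [b] is chosen after the grid, so that its
    contribution is again of the order of the squared width. *)

Section calculus.
Context {R : realType}.
Implicit Types (x y z m : R) (phi : R -> R).

(** The derivative is bounded only at points no farther from [x] than [y] is, so that [m] may depend
    on [x] and [y]; the Taylor estimates below rely on this. *)
Lemma lipschitz_from phi phi' x y m :
  (forall z, is_derive z 1 phi (phi' z)) ->
  (forall z, `|z - x| <= `|y - x| -> `|phi' z| <= m) ->
  `|phi y - phi x| <= m * `|y - x|.
Proof.
move=> dphi bd.
have cphi : continuous phi.
  move=> z; apply: differentiable_continuous; apply/derivable1_diffP.
  by have := dphi z; case.
have [xy|yx] := leP x y.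
- have [|c cxy ->] := MVT_segment xy (fun z _ => dphi z).
    exact: continuous_subspaceT.
  rewrite normrM ler_wpM2r// bd//.
  move: cxy; rewrite in_itv/= => /andP[xc cy].
  by rewrite !ger0_norm ?subr_ge0// lerD2r.
- have [|c cxy e] := MVT_segment (ltW yx) (fun z _ => dphi z).
    exact: continuous_subspaceT.
  rewrite distrC e normrM distrC ler_wpM2r// bd//.
  move: cxy; rewrite in_itv/= => /andP[xc cy].
  by rewrite !ler0_norm ?subr_le0 ?(ltW yx)// lerN2 lerD2r.
Qed.

Lemma derivable_continuous phi phi' :
  (forall z, is_derive z 1 phi (phi' z)) -> continuous phi.
Proof.
move=> dphi z; apply: differentiable_continuous; apply/derivable1_diffP.
by have := dphi z; case.
Qed.

(** The mean value inequality applied twice, to [phi] minus its tangent and then to [phi1]. This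
    loses a factor 2, which is immaterial. *)
Lemma taylor1 phi phi1 phi2 x y m :
  (forall z, is_derive z 1 phi (phi1 z)) ->
  (forall z, is_derive z 1 phi1 (phi2 z)) ->
  (forall z, `|z - x| <= `|y - x| -> `|phi2 z| <= m) ->
  `|phi y - phi x - phi1 x * (y - x)| <= m * (y - x) ^+ 2.
Proof.
move=> d0 d1 bd.
have := @lipschitz_from (fun z => phi z - phi1 x * z)
  (fun z => phi1 z - phi1 x) x y (m * `|y - x|).
have -> : m * `|y - x| * `|y - x| = m * (y - x) ^+ 2.
  by rewrite -mulrA -normrM -expr2 ger0_norm ?sqr_ge0.
have -> : phi y - phi1 x * y - (phi x - phi1 x * x) =
          phi y - phi x - phi1 x * (y - x) by ring.
apply.
- move=> z; apply: is_derive_eq.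
  by rewrite /GRing.scale/=; ring.
- move=> z zx; have m0 : 0 <= m by rewrite (le_trans _ (bd _ zx)).
  apply: (le_trans (@lipschitz_from phi1 phi2 x z m d1 _)).
    by move=> w wz; apply/bd/(le_trans wz).
  by rewrite ler_wpM2l.
Qed.

(** The remainder is measured by the oscillation of [phi2], so no third derivative appears:
    [taylor1] is applied after subtracting the quadratic term at [x]. *)
Lemma taylor2 phi phi1 phi2 x y m :
  (forall z, is_derive z 1 phi (phi1 z)) ->
  (forall z, is_derive z 1 phi1 (phi2 z)) ->
  (forall z, `|z - x| <= `|y - x| -> `|phi2 z - phi2 x| <= m) ->
  `|phi y - phi x - phi1 x * (y - x) - phi2 x * (y - x) ^+ 2 / 2|
    <= m * (y - x) ^+ 2.
Proof.
move=> d0 d1 bd.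
have := @taylor1 (fun z => phi z - phi2 x * (z - x) ^+ 2 / 2)
  (fun z => phi1 z - phi2 x * (z - x)) (fun z => phi2 z - phi2 x) x y m.
have -> : phi y - phi2 x * (y - x) ^+ 2 / 2 - (phi x - phi2 x * (x - x) ^+ 2 / 2)
  - (phi1 x - phi2 x * (x - x)) * (y - x) =
  phi y - phi x - phi1 x * (y - x) - phi2 x * (y - x) ^+ 2 / 2 by ring.
apply => //.
- move=> z; apply: is_derive_eq.
  by rewrite /GRing.scale/=; field.
- move=> z; apply: is_derive_eq.
  by rewrite /GRing.scale/=; ring.
Qed.

End calculus.

(** * Primitives of continuous functions on the whole line *)

Section primitives.
Context {R : realType}.
Implicit Types (x y z m : R) (phi : R -> R).

Lemma continuous_integrable_itv phi (a b : R) : continuous phi ->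
  lebesgue_measure.-integrable `[a, b] (EFin \o phi).
Proof.
move=> cphi; apply: continuous_compact_integrable; first exact: segment_compact.
exact: continuous_subspaceT.
Qed.

Lemma primitive_right phi (a : R) : continuous phi ->
  exists Phi : R -> R, forall x, a < x -> is_derive x 1 Phi (phi x).
Proof.
move=> cphi; exists (fun x => \int[lebesgue_measure]_(t in `[a, x]) phi t)%R => x ax.
have [|d <-] := @continuous_FTC1_closed R phi a x (x + 1) _
  (continuous_integrable_itv _ _ cphi) ax (cphi x); first by rewrite ltrDl.
by rewrite derive1E; exact/derivableP.
Qed.

Lemma eq_primitive (F G phi : R -> R) (a : R) x y :
  (forall z, a < z -> is_derive z 1 F (phi z)) ->
  (forall z, a < z -> is_derive z 1 G (phi z)) ->
  a < x -> a < y -> F y - F x = G y - G x.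
Proof.
move=> dF dG.
have dH z : a < z -> is_derive z 1 (fun z => F z - G z) ((fun=> 0) z).
  move=> az; have ? := dF _ az; have ? := dG _ az.
  by apply: is_derive_eq; rewrite subrr.
have cH u v : a < u -> {within `[u, v], continuous (fun z => F z - G z)}.
  move=> au; apply: derivable_within_continuous => z.
  rewrite in_itv/= => /andP[uz _].
  by have := dH _ (lt_le_trans au uz); case.
wlog: x y / x <= y.
  move=> hw ax ay; have [xy|/ltW yx] := leP x y; first exact: hw.
  by have := hw _ _ yx ay ax; lra.
move=> xy ax _.
have dHxy z : z \in `]x, y[%R ->
    is_derive z 1 (fun z => F z - G z) ((fun=> 0) z).
  by rewrite in_itv/= => /andP[xz _]; apply/dH/(lt_trans ax).
have [c _] := MVT_segment xy dHxy (cH x y ax).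
by rewrite mul0r; lra.
Qed.

(** An integral from [a] is a primitive only to the right of [a]. The primitives on the half-lines
    from [-(n + 1)], normalised to vanish at 0, agree wherever two of them are defined, so they can
    be glued. *)
Lemma primitive_exists phi : continuous phi ->
  exists2 Phi : R -> R, Phi 0 = 0 & forall x, is_derive x 1 Phi (phi x).
Proof.
move=> cphi.
have /choice[F dF] : forall n : nat, exists F : R -> R,
    forall x, - (n%:R + 1) < x -> is_derive x 1 F (phi x).
  by move=> n; exact: primitive_right.
pose k x := Num.truncn `|x|.
have kx x : - ((k x)%:R + 1) < x.
  rewrite ltrNl (le_lt_trans (ler_norm _))// normrN natr1.
  exact: truncnS_gt.
pose Phi x := F (k x) x - F (k x) 0.
have PhiE n x : - (n%:R + 1) < x -> Phi x = F n x - F n 0.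
  move=> nx; rewrite /Phi.
  have [nk|kn] := leqP n (k x).
    apply: (@eq_primitive _ _ phi (- (n%:R + 1))) => //.
    by move=> z nz; apply: dF; apply: le_lt_trans nz; rewrite lerN2 lerD2r ler_nat.
  apply: (@eq_primitive _ _ phi (- ((k x)%:R + 1))) => //.
  by move=> z nz; apply: dF; apply: le_lt_trans nz; rewrite lerN2 lerD2r ler_nat ltnW.
exists Phi => [|x]; first by rewrite /Phi subrr.
have dFx : is_derive x 1 (fun z => F (k x) z - F (k x) 0) (phi x).
  have ? := dF (k x) x (kx x).
  by apply: is_derive_eq; rewrite subr0.
apply: near_eq_is_derive dFx.
have := lt_nbhsr (kx x).
by apply: filterS => z /PhiE ->.
Qed.

End primitives.

Section lamperti.
Context {R : realType}.
Implicit Types (x y z m : R) (phi sigma : R -> R).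

(** Since [sigma <= M], the primitive [g] of [1 / sigma] grows at rate at least [1 / M]. Hence it is
    injective and, by the intermediate value theorem, onto; [h] is its inverse. *)
Let lamperti_pos sigma (l M : R) : 0 < l -> continuous sigma ->
  (forall x, l <= sigma x) -> (forall x, sigma x <= M) ->
  exists g h : R -> R, [/\ forall x, is_derive x 1 g (sigma x)^-1,
    forall z, is_derive z 1 h (sigma (h z)), cancel g h & cancel h g].
Proof.
move=> l0 csigma ls sM.
have s0 x : 0 < sigma x by exact: lt_le_trans (ls x).
have M0 : 0 < M by exact: lt_le_trans (sM 0).
have [g g0 dg] : exists2 g : R -> R, g 0 = 0 &
    forall x, is_derive x 1 g (sigma x)^-1.
  apply: primitive_exists => x; apply: continuousV; first by rewrite gt_eqF.
  exact: csigma.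
have cg : continuous g by exact: derivable_continuous dg.
have gmono x y : x < y -> (y - x) / M <= g y - g x.
  move=> xy; have [|c _ ->] := MVT xy (fun z _ => dg z).
    exact: continuous_subspaceT.
  by rewrite mulrC ler_wpM2r ?subr_ge0 ?(ltW xy)// lef_pV2 ?posrE.
have ginj : injective g.
  move=> x y gxy; apply/eqP; rewrite eq_le !leNgt.
  apply/andP; split; apply/negP => /[dup] xy /gmono; rewrite gxy subrr leNgt.
    by rewrite divr_gt0// subr_gt0.
  by rewrite divr_gt0// subr_gt0.
have gsurj z : exists x, g x = z.
  pose L := M * (`|z| + 1).
  have L0 : 0 < L by rewrite mulr_gt0// ltr_wpDl.
  have hL : `|z| + 1 <= g L.
    have := gmono _ _ L0; rewrite g0 !subr0; apply: le_trans.
    by rewrite /L mulrC mulKf// gt_eqF.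
  have hNL : g (- L) <= - (`|z| + 1).
    have := gmono (- L) 0; rewrite oppr_lt0 => /(_ L0); rewrite g0 sub0r.
    rewrite sub0r opprK => hL'; rewrite lerNr; apply: le_trans hL'.
    by rewrite /L mulrC mulKf// gt_eqF.
  have [|||c _ <-] := @IVT R g (- L) L z; last by exists c.
  - by rewrite ge0_cp// ltW.
  - exact: continuous_subspaceT.
  - rewrite min_l ?max_r; last 2 first.
    + by rewrite (le_trans hNL)// (le_trans _ hL)// ge0_cp// addr_ge0.
    + by rewrite (le_trans hNL)// (le_trans _ hL)// ge0_cp// addr_ge0.
    apply/andP; split.
      rewrite (le_trans hNL)// lerNl (le_trans (ler_norm _))// normrN.
      by rewrite lerDl.
    by rewrite (le_trans _ hL)// (le_trans (ler_norm _))// lerDl.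
have [h hK] := choice gsurj.
have gK : cancel g h by move=> x; apply: ginj; rewrite hK.
exists g, h; split => // z.
have := @is_derive_inverse R g h (sigma (h z))^-1 (h z).
rewrite hK invrK; apply => //.
- by near=> x; exact: gK.
- by near=> x; exact: cg.
- by rewrite invr_eq0 gt_eqF.
Unshelve. all: by end_near. Qed.

(** A continuous [sigma] bounded away from 0 has constant sign; a negative one is replaced by
    [- sigma] and [g] is reflected. *)
Lemma lamperti sigma (l M : R) : 0 < l -> continuous sigma ->
  (forall x, l <= `|sigma x|) -> (forall x, `|sigma x| <= M) ->
  exists g h : R -> R, [/\ forall x, is_derive x 1 g (sigma x)^-1,
    forall z, is_derive z 1 h (sigma (h z)), cancel g h & cancel h g].
Proof.
move=> l0 csigma ls sM.
have nz x : sigma x != 0 by rewrite -normr_gt0 (lt_le_trans l0).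
have sgn x y : 0 < sigma x -> 0 < sigma y.
  move=> sx; rewrite ltNge; apply/negP => sy.
  have same (u v : R) : u <= v -> Num.min (sigma u) (sigma v) <= 0 ->
      0 <= Num.max (sigma u) (sigma v) -> False.
    move=> uv h1 h2; have [||c _ /eqP] := @IVT R sigma u v 0 uv.
    - exact: continuous_subspaceT.
    - by rewrite h1.
    - by rewrite (negbTE (nz c)).
  have [/same|/ltW/same] := leP x y; apply.
  - by rewrite ge_min sy orbT.
  - by rewrite le_max (ltW sx).
  - by rewrite ge_min sy.
  - by rewrite le_max (ltW sx) orbT.
have [s0|s0] := ltP 0 (sigma 0).
  apply: (@lamperti_pos _ l M) => // x.
    by rewrite -(@ger0_norm _ (sigma x))//; apply/ltW/(sgn 0).
  by rewrite (le_trans _ (sM x))// ler_norm.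
have s0' x : sigma x < 0.
  rewrite lt_neqAle nz/= leNgt; apply/negP => /(sgn x 0).
  by rewrite ltNge s0.
have [||x|x|g [h [dg dh gK hK]]] := @lamperti_pos (fun x => - sigma x) l M.
- by [].
- by move=> x; apply: continuousN; exact: csigma.
- by rewrite -ltr0_norm.
- by rewrite -ltr0_norm.
exists (fun x => - g x), (fun z => h (- z)); split.
- move=> x; have ? := dg x; apply: is_derive_eq.
  by rewrite invrN opprK.
- move=> z; have ? := dh (- z).
  apply: (@is_derive_eq _ _ _ _ _ _ _ _ (is_derive1_comp (f := h) (g := -%R) _ _)).
  by rewrite mulrN1 opprK.
- by move=> x; rewrite opprK gK.
- by move=> x; rewrite hK opprK.
Qed.

End lamperti.

(** * Partitions and sewing *)

Section partitions.
Context {R : realType}.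
Implicit Types (a b s t u v eps delta : R) (p q : seq R) (F G : R -> R -> R).

Lemma cells_cons a x p : cells a (x :: p) = (a, x) :: cells x p.
Proof. by []. Qed.

Lemma cells_cat a p q : cells a (p ++ q) = cells a p ++ cells (last a p) q.
Proof. by elim: p a => [//|x p ih] a; rewrite cat_cons !cells_cons ih. Qed.

Lemma partition_sum_cat a p q F :
  partition_sum a (p ++ q) F = partition_sum a p F + partition_sum (last a p) q F.
Proof. by rewrite /partition_sum cells_cat big_cat. Qed.

Lemma partition_sum_cons a x p F :
  partition_sum a (x :: p) F = F a x + partition_sum x p F.
Proof. by rewrite /partition_sum cells_cons big_cons. Qed.

Lemma partition_sum_nil a F : partition_sum a [::] F = 0.
Proof. by rewrite /partition_sum /cells/= big_nil. Qed.

Lemma partition_sum1 a b F : partition_sum a [:: b] F = F a b.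
Proof. by rewrite partition_sum_cons partition_sum_nil addr0. Qed.

Lemma partition_sum_telescope a p (H : R -> R) :
  partition_sum a p (fun u v => H v - H u) = H (last a p) - H a.
Proof.
elim: p a => [|x p ih] a; first by rewrite partition_sum_nil subrr.
by rewrite partition_sum_cons ih/=; ring.
Qed.

Lemma mesh_lt a p delta : 0 < delta ->
  (mesh a p < delta) = all (fun c => c.2 - c.1 < delta) (cells a p).
Proof.
move=> d0; rewrite /mesh; elim: (cells a p) => [|c l ih].
  by rewrite big_nil/= d0.
by rewrite big_cons gt_max ih.
Qed.

(** Errors of size [eps] times the cell length add up to [eps * (b - a)]. With [G = 0] this turns
    local increment bounds into global ones. *)
Lemma partition_sum_close a b p F G eps delta :
  itv_partition a b p -> mesh a p < delta -> 0 < delta ->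
  (forall u v, a <= u -> u < v -> v <= b -> v - u < delta ->
    `|F u v - G u v| <= eps * (v - u)) ->
  `|partition_sum a p F - partition_sum a p G| <= eps * (b - a).
Proof.
move=> + + d0; rewrite mesh_lt//.
elim: p a => [|x p ih] a.
  by move=> /itv_partition_nil <- _ _; rewrite !partition_sum_nil !subrr normr0 mulr0.
move=> pab; rewrite cells_cons/= => /andP[xa al] FG.
have xb := itv_partition_le (itv_partition_cons pab).
have ax : a < x by case: pab => /= /andP[].
rewrite !partition_sum_cons.
have -> : F a x + partition_sum x p F - (G a x + partition_sum x p G) =
  (F a x - G a x) + (partition_sum x p F - partition_sum x p G) by ring.
rewrite (le_trans (ler_normD _ _))//.
have -> : eps * (b - a) = eps * (x - a) + eps * (b - x) by ring.
apply: lerD; first exact: FG.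
apply: ih => //; first exact: itv_partition_cons pab.
by move=> u v xu; apply: FG; rewrite (le_trans (ltW ax)).
Qed.

Fixpoint dyadic_partition n s t : seq R :=
  if n is n'.+1 then
    dyadic_partition n' s ((s + t) / 2) ++ dyadic_partition n' ((s + t) / 2) t
  else [:: t].

Lemma last_dyadic n s t x : last x (dyadic_partition n s t) = t.
Proof. by elim: n s t x => [//|n ih] s t x /=; rewrite last_cat !ih. Qed.

Lemma dyadic_itv_partition n s t : s < t ->
  itv_partition s t (dyadic_partition n s t).
Proof.
elim: n s t => [|n ih] s t st /=; first exact: itv_partition1.
by apply: (itv_partition_cat (ih _ _ _) (ih _ _ _)); lra.
Qed.

Lemma dyadic_cells n s t : all (fun c => c.2 - c.1 == (t - s) / 2 ^+ n)
  (cells s (dyadic_partition n s t)).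
Proof.
elim: n s t => [|n ih] s t /=; first by rewrite divr1 eqxx.
have e : (t - s) / 2 ^+ n.+1 = ((s + t) / 2 - s) / 2 ^+ n.
  by rewrite exprS; field; rewrite expf_neq0.
have e' : (t - s) / 2 ^+ n.+1 = (t - (s + t) / 2) / 2 ^+ n.
  by rewrite exprS; field; rewrite expf_neq0.
by rewrite cells_cat all_cat last_dyadic {1}e e' !ih.
Qed.

Lemma dyadic_mesh s t delta : 0 < delta ->
  \forall n \near \oo, mesh s (dyadic_partition n s t) < delta.
Proof.
move=> d0; have : (t - s) / 2 ^+ n @[n --> \oo] --> (0 : R).
  rewrite -[X in _ --> X](mulr0 (t - s)).
  apply: cvgM; first exact: cvg_cst.
  have : geometric 1 (2^-1 : R) @ \oo --> (0 : R).
    by apply: cvg_geometric; rewrite gtr0_norm ?invr_gt0// invf_lt1// ltr1n.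
  apply: cvg_trans; apply: near_eq_cvg; apply: nearW => n.
  by rewrite /geometric/= mul1r exprVn.
move=> /cvgrPdist_lt/(_ _ d0); apply: filterS => n /=.
rewrite sub0r normrN => lt; rewrite mesh_lt//.
apply: sub_all (dyadic_cells n s t) => c /eqP ->.
by rewrite (le_lt_trans (ler_norm _)).
Qed.

Lemma fine_partition s t delta : s <= t -> 0 < delta ->
  exists2 p, itv_partition s t p & mesh s p < delta.
Proof.
move=> + d0; rewrite le_eqVlt => /predU1P[<-|st].
  by exists [::]; [split => //=|rewrite mesh_lt].
have [n _ /(_ n (leqnn n)) hn] := dyadic_mesh s t d0.
by exists (dyadic_partition n s t) => //; exact: dyadic_itv_partition.
Qed.

(** Only midpoint defects occur along dyadic partitions. The two halves of an interval contribute
    the fraction [2 * (1 / 2) ^ (1 + kappa) = r < 1] of the bound for the whole, and [K] is the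
    fixed point of [K = K * r + |C|], uniformly in the depth [n]. *)
Lemma sewing (Xi : R -> R -> R) a b C kappa : 0 < kappa ->
  (forall s t, a <= s -> s < t -> t <= b ->
    `|Xi s t - Xi s ((s + t) / 2) - Xi ((s + t) / 2) t|
      <= C * (t - s) `^ (1 + kappa)) ->
  exists K : R, forall n s t, a <= s -> s < t -> t <= b ->
    `|partition_sum s (dyadic_partition n s t) Xi - Xi s t|
      <= K * (t - s) `^ (1 + kappa).
Proof.
move=> k0 dXi; pose r : R := 2^-1 `^ kappa.
have r0 : 0 <= r by exact: powR_ge0.
have r1 : r < 1.
  have -> : (1 : R) = 1 `^ kappa by rewrite powR1.
  by rewrite /r gt0_ltr_powR// ?nnegrE ?invr_ge0//; lra.
pose K := `|C| / (1 - r).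
have KE : K * r + `|C| = K by rewrite /K; field; lra.
have K0 : 0 <= K by rewrite divr_ge0//; lra.
exists K; elim=> [|n ih] s t sa st tb.
  by rewrite /= partition_sum1 subrr normr0 mulr_ge0// powR_ge0.
rewrite /= partition_sum_cat last_dyadic.
set m := (s + t) / 2.
have sm : s < m by rewrite /m; lra.
have mt : m < t by rewrite /m; lra.
have h1 := ih s m sa sm (ltW (lt_le_trans mt tb)).
have h2 := ih m t (ltW (le_lt_trans sa sm)) mt tb.
have half x : x = (t - s) / 2 ->
    K * x `^ (1 + kappa) = K * r * (t - s) `^ (1 + kappa) / 2.
  move=> ->; rewrite powRM ?invr_ge0//; last by lra.
  rewrite [2^-1 `^ _]powRD ?powRr1; last 2 first.
  - by rewrite invr_ge0.
  - by rewrite invr_eq0 pnatr_eq0 implybT.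
  by rewrite /r; field.
rewrite half in h1; last by rewrite /m; field.
rewrite half in h2; last by rewrite /m; field.
have h3 := dXi s t sa st tb.
have h4 : C * (t - s) `^ (1 + kappa) <= `|C| * (t - s) `^ (1 + kappa).
  by rewrite ler_wpM2r ?powR_ge0 ?ler_norm.
have -> : K * (t - s) `^ (1 + kappa) = K * r * (t - s) `^ (1 + kappa)
   + `|C| * (t - s) `^ (1 + kappa) by rewrite -{1}KE; ring.
rewrite -/m in h3.
set S1 := partition_sum s _ _ in h1 *; set S2 := partition_sum m _ _ in h2 *.
have -> : S1 + S2 - Xi s t = (S1 - Xi s m) + (S2 - Xi m t)
  - (Xi s t - Xi s m - Xi m t) by ring.
rewrite (le_trans (ler_normB _ _))//.
have := ler_normD (S1 - Xi s m) (S2 - Xi m t).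
by lra.
Qed.

End partitions.

(** * Uniform continuity and paths on [[0, T]] *)

Section moduli.
Context {R : realType}.
Implicit Types (T alpha x y d s t u v eps delta : R) (q W X : R -> R).

Definition unif_cont q := forall eps, 0 < eps -> exists2 delta, 0 < delta &
  forall x y, `|x - y| < delta -> `|q x - q y| <= eps.

Lemma unif_cont_continuous q : unif_cont q -> continuous q.
Proof.
move=> uq x; apply/cvgrPdist_le => eps e0.
have [delta d0 dq] := uq _ e0.
near=> y; apply: dq; near: y.
exact: cvgr_dist_lt.
Unshelve. all: by end_near. Qed.

Lemma unif_cont_comp q X : unif_cont q -> unif_cont X -> unif_cont (q \o X).
Proof.
move=> uq uX eps e0; have [d d0 dq] := uq _ e0.
have [d' d'0 dX] := uX (d / 2) (divr_gt0 d0 (ltr0n _ 2)).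
exists d' => // x y /dX xy; apply: dq; apply: (le_lt_trans xy); lra.
Qed.

Lemma unif_contD q X : unif_cont q -> unif_cont X ->
  unif_cont (fun x => q x + X x).
Proof.
move=> uq uX eps e0; have e2 : 0 < eps / 2 by rewrite divr_gt0.
have [d d0 dq] := uq _ e2; have [d' d'0 dX] := uX _ e2.
exists (Num.min d d') => [|x y]; first by rewrite lt_min d0.
rewrite lt_min => /andP[/dq h1 /dX h2].
have -> : q x + X x - (q y + X y) = (q x - q y) + (X x - X y) by ring.
by rewrite (le_trans (ler_normD _ _))//; lra.
Qed.

Lemma unif_contM q X (M : R) : (forall x, `|q x| <= M) ->
  (forall x, `|X x| <= M) -> unif_cont q -> unif_cont X ->
  unif_cont (fun x => q x * X x).
Proof.
move=> bq bX uq uX eps e0.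
have M0 : 0 <= M by exact: le_trans (bq 0).
have M1 : 0 < M + 1 by lra.
have e2 : 0 < eps / 2 / (M + 1) by rewrite !divr_gt0.
have [d d0 dq] := uq _ e2; have [d' d'0 dX] := uX _ e2.
exists (Num.min d d') => [|x y]; first by rewrite lt_min d0.
rewrite lt_min => /andP[/dq h1 /dX h2].
have -> : q x * X x - q y * X y = (q x - q y) * X x + q y * (X x - X y) by ring.
rewrite (le_trans (ler_normD _ _))// !normrM.
have -> : eps = eps / 2 / (M + 1) * (M + 1) + (M + 1) * (eps / 2 / (M + 1)).
  by field; lra.
apply: lerD; apply: ler_pM => //.
- by rewrite (le_trans (bX _))//; lra.
- by rewrite (le_trans (bq _))//; lra.
Qed.

Lemma lipschitz_unif_cont q (M : R) : (forall x y, `|q x - q y| <= M * `|x - y|) ->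
  unif_cont q.
Proof.
move=> lq eps e0.
have M1 : 0 < `|M| + 1 by rewrite ltr_wpDl.
exists (eps / (`|M| + 1)) => [|x y xy]; first by rewrite divr_gt0.
rewrite (le_trans (lq _ _))//.
rewrite (@le_trans _ _ ((`|M| + 1) * `|x - y|))//.
  by rewrite ler_wpM2r// (le_trans (ler_norm _))// lerDl.
by rewrite -ler_pdivlMl// mulrC ltW.
Qed.

Lemma powR_small alpha eps : 0 < alpha -> 0 < eps ->
  exists2 delta, 0 < delta & forall d, 0 <= d -> d < delta -> d `^ alpha <= eps.
Proof.
move=> a0 e0; exists (eps `^ alpha^-1); first by rewrite powR_gt0.
move=> d d0 dd.
rewrite -(@powRr1 _ eps (ltW e0)) -(@mulVf _ alpha) ?gt_eqF// powRrM.
by rewrite ge0_ler_powR ?nnegrE ?powR_ge0// ltW.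
Qed.

Lemma holder_unif_cont alpha q : 0 < alpha -> holder_on [set: R] alpha q ->
  unif_cont q.
Proof.
move=> a0 [C hC] eps e0.
have M1 : 0 < `|C| + 1 by rewrite ltr_wpDl.
have e1 : 0 < eps / (`|C| + 1) by rewrite divr_gt0.
have [delta d0 dd] := powR_small a0 e1.
exists delta => // x y xy; rewrite distrC.
rewrite (le_trans (hC x y I I))//.
rewrite (@le_trans _ _ ((`|C| + 1) * `|y - x| `^ alpha))//.
  by rewrite ler_wpM2r ?powR_ge0// (le_trans (ler_norm _))// lerDl.
by rewrite -ler_pdivlMl// mulrC dd// distrC.
Qed.

(** Composing a path with [clamp T] extends it by constants outside [[0, T]], so that continuity on
    the interval becomes continuity on the line. *)
Definition clamp T t := Num.max 0 (Num.min t T).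

Lemma clamp_id T t : 0 <= t -> t <= T -> clamp T t = t.
Proof. by move=> t0 tT; rewrite /clamp min_l// max_r. Qed.

Lemma clamp_itv T t : 0 <= T -> 0 <= clamp T t /\ clamp T t <= T.
Proof. by move=> T0; rewrite /clamp le_max lexx ge_max T0 ge_min lexx orbT. Qed.

Lemma clamp_lip T s t : `|clamp T t - clamp T s| <= `|t - s|.
Proof.
have h1 := ler_norm (t - s); have h2 := ler_norm (s - t).
rewrite distrC in h2; rewrite ler_norml /clamp.
by case: (leP t T) => ?; case: (leP s T) => ?; do 2?case: (leP 0) => ?;
  apply/andP; split; lra.
Qed.

Lemma holder_clamp T alpha X : 0 <= T -> 0 < alpha ->
  holder_on `[0, T] alpha X -> unif_cont (X \o clamp T).
Proof.
move=> T0 a0 [C hC]; apply: (@holder_unif_cont alpha) => //.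
exists `|C| => s t _ _ /=.
have cl r : `[0, T]%classic (clamp T r).
  by rewrite /= in_itv/=; have [-> ->] := clamp_itv r T0.
rewrite (le_trans (hC _ _ (cl s) (cl t)))//.
rewrite (@le_trans _ _ (`|C| * `|clamp T t - clamp T s| `^ alpha))//.
  by rewrite ler_wpM2r ?powR_ge0// ler_norm.
by rewrite ler_wpM2l// ge0_ler_powR ?nnegrE// ?clamp_lip// ltW.
Qed.

(** The integral is a primitive [Q] of [q], and the mean value inequality is applied to
    [Q r - q u * r], whose derivative is small near [u]. *)
Lemma integral_increments T q : 0 < T -> unif_cont q ->
  forall eps, 0 < eps -> exists2 delta, 0 < delta & forall u v,
    0 <= u -> u <= v -> v <= T -> v - u < delta ->
    `|(\int[lebesgue_measure]_(r in `[0%R, v]) q r)%R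
      - (\int[lebesgue_measure]_(r in `[0%R, u]) q r)%R - q u * (v - u)|
    <= eps * (v - u).
Proof.
move=> T0 uq eps e0.
have cq := unif_cont_continuous uq.
have [Q Q0 dQ] := primitive_exists cq.
have cQ := derivable_continuous dQ.
have intE t : 0 <= t -> (\int[lebesgue_measure]_(r in `[0%R, t]) q r)%R = Q t.
  rewrite le_eqVlt => /predU1P[<-|t0].
    by rewrite set_itv1 /Rintegral integral_set1/= Q0.
  rewrite /Rintegral (@continuous_FTC2 _ q Q 0 t)//= ?Q0 ?subr0//.
  - exact: continuous_subspaceT.
  - split.
    + by move=> x _; have := dQ x; case.
    + exact/cvg_at_right_filter/cQ.
    + exact/cvg_at_left_filter/cQ.
  - by move=> x _; rewrite derive1E; have [_] := dQ x.
have [delta d0 dq] := uq _ e0; exists delta => // u v u0 uv vT vu.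
rewrite !intE//; last exact: le_trans uv.
have := @lipschitz_from R (fun r => Q r - q u * r) (fun r => q r - q u) u v eps.
have -> : Q v - q u * v - (Q u - q u * u) = Q v - Q u - q u * (v - u) by ring.
rewrite [`|v - u|]ger0_norm ?subr_ge0//; apply.
- move=> z; have ? := dQ z; apply: is_derive_eq.
  by rewrite /GRing.scale/=; ring.
- by move=> z zu; apply: dq; apply: le_lt_trans vu.
Qed.

End moduli.

(** * Rough equations and equations with additive noise *)

Section bounds.
Context {R : realType}.
Implicit Types x y a b A B : R.

Lemma normZ_le x y A B : `|x| <= A -> `|y| <= B -> `|x * y| <= A * B.
Proof. by move=> hx hy; rewrite normrM ler_pM. Qed.

Lemma sqr_ler_norm x y : `|x| <= y -> x ^+ 2 <= y ^+ 2.
Proof.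
move=> xy; rewrite -(@real_normK _ x) ?num_real// ler_pXn2r// nnegrE//.
exact: le_trans xy.
Qed.

End bounds.

(* The Lamperti transform of a solution solves this equation; it is stated
   through local increments so that no integral occurs in it. *)
Definition additive_solution {R : realType} (T : R) (b W Z : R -> R) : Prop :=
  forall eps, 0 < eps -> exists2 delta, 0 < delta & forall u v,
    0 <= u -> u <= v -> v <= T -> v - u < delta ->
    `|Z v - Z u - (W v - W u) - b (Z u) * (v - u)| <= eps * (v - u).

Section lamperti_correspondence.
Context {R : realType} (T alpha c lam M : R)
  (f sigma sigma1 sigma2 g h W : R -> R) (WW : R -> R -> R).
Implicit Types (x y z d s t u v eps delta K C m : R) (X Z : R -> R).
Hypotheses (T0 : 0 < T) (alpha3 : (1 : R) / 3 < alpha) (alpha2 : alpha < (1 : R) / 2).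
Hypothesis dsigma : forall x : R, is_derive x 1 sigma (sigma1 x).
Hypothesis dsigma1 : forall x : R, is_derive x 1 sigma1 (sigma2 x).
Hypotheses (sigmaM : forall x, `|sigma x| <= M)
  (sigma1M : forall x, `|sigma1 x| <= M) (sigma2M : forall x, `|sigma2 x| <= M).
Hypotheses (lam0 : 0 < lam) (lamsigma : forall x, lam <= `|sigma x|).
Hypotheses (fM : forall x, `|f x| <= M) (ucf : unif_cont f).
Hypothesis WWE : forall s t, 0 <= s -> s <= t -> t <= T ->
  WW s t = (W t - W s) ^+ 2 / 2 + c * (t - s).
Hypotheses (dg : forall x : R, is_derive x 1 g (sigma x)^-1)
  (dh : forall z : R, is_derive z 1 h (sigma (h z))) (gK : cancel g h)
  (hK : cancel h g).

Definition lamperti_drift z := f (h z) / sigma (h z) + c * sigma1 (h z).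

Local Notation om d := (d `^ alpha).

Let M0 : 0 <= M. Proof. exact: le_trans (sigmaM 0). Qed.
Let a0 : 0 < alpha. Proof. by move: alpha3; lra. Qed.
Let sigma_neq0 x : sigma x != 0.
Proof. by rewrite -normr_gt0 (lt_le_trans lam0). Qed.

Let om0 d : 0 <= om d. Proof. exact: powR_ge0. Qed.

Let om2 d : d `^ (2 * alpha) = om d ^+ 2.
Proof. by rewrite mulrC powRrM powR_mulrn. Qed.

Let om3 d : 0 <= d -> d `^ (1 + (3 * alpha - 1)) = om d ^+ 3.
Proof.
by move=> d0; rewrite -powR_mulrn// -powRrM; congr (_ `^ _); ring.
Qed.

Let om_le d : 0 <= d -> d <= T -> om d <= om T.
Proof. by move=> d0 dT; rewrite ge0_ler_powR ?nnegrE// ltW. Qed.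

(** Because [2 * alpha < 1], terms linear in time are absorbed into the second-order remainders. *)
Let le_om2 d : 0 <= d -> d <= T -> d <= T `^ (1 - 2 * alpha) * om d ^+ 2.
Proof.
move=> d0 dT; have [->|dn0] := eqVneq d 0.
  by rewrite mulr_ge0 ?powR_ge0 ?sqr_ge0.
have {1}-> : d = d `^ (1 - 2 * alpha) * om d ^+ 2.
  rewrite -om2 -powRD ?dn0 ?implybT//.
  by rewrite -[LHS](powRr1 d0); congr (_ `^ _); ring.
rewrite ler_wpM2r ?sqr_ge0// ge0_ler_powR ?nnegrE//; last exact: ltW.
by move: alpha2; lra.
Qed.

(** Because [3 * alpha > 1], a third-order error is negligible against the length of the
    interval. *)
Let om3_small K eps : 0 < eps -> exists2 delta, 0 < delta &
  forall d, 0 <= d -> d < delta -> K * om d ^+ 3 <= eps * d.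
Proof.
move=> e0; have K1 : 0 < `|K| + 1 by rewrite ltr_wpDl.
have k0 : 0 < 3 * alpha - 1 by move: alpha3; lra.
have [delta d0 hd] := powR_small k0 (divr_gt0 e0 K1).
exists delta => // d d1 dd; rewrite -om3//.
have [->|dn0] := eqVneq d 0.
  by rewrite powR0 ?mulr0//; move: alpha3; lra.
rewrite powRD ?dn0 ?implybT// powRr1// mulrCA [leRHS]mulrC ler_wpM2l//.
rewrite (@le_trans _ _ ((`|K| + 1) * d `^ (3 * alpha - 1)))//.
  by rewrite ler_wpM2r ?powR_ge0// (le_trans (ler_norm _))// lerDl.
by rewrite -ler_pdivlMl// [leRHS]mulrC hd.
Qed.

Let holder_om (X : R -> R) : holder_on `[0, T] alpha X ->
  exists2 C, 0 <= C & forall s t, 0 <= s -> s <= t -> t <= T ->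
    `|X t - X s| <= C * om (t - s).
Proof.
move=> [C hC]; exists `|C| => // s t s0 st tT.
have := hC s t; rewrite /= !in_itv/= s0 tT (le_trans st tT) (le_trans s0 st).
move=> /(_ isT isT); rewrite [`|t - s|]ger0_norm ?subr_ge0// => /le_trans; apply.
by rewrite ler_wpM2r// ler_norm.
Qed.

Let drift_increments X : holder_on `[0, T] alpha X ->
  forall eps, 0 < eps -> exists2 delta, 0 < delta & forall u v,
    0 <= u -> u <= v -> v <= T -> v - u < delta ->
    `|(\int[lebesgue_measure]_(r in `[0%R, v]) f (X r))%R
      - (\int[lebesgue_measure]_(r in `[0%R, u]) f (X r))%R - f (X u) * (v - u)|
    <= eps * (v - u).
Proof.
move=> hhX.
have uc : unif_cont (f \o (X \o clamp T)).
  exact: unif_cont_comp ucf (holder_clamp (ltW T0) a0 hhX).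
move=> eps e0; have [delta d0 hd] := integral_increments T0 uc e0.
exists delta => // u v u0 uv vT vu.
have drE t : 0 <= t -> t <= T ->
    (\int[lebesgue_measure]_(r in `[0%R, t]) f (X r))%R =
    (\int[lebesgue_measure]_(r in `[0%R, t]) (f \o (X \o clamp T)) r)%R.
  move=> t0 tT; apply: eq_Rintegral => r; rewrite inE/= in_itv/= => /andP[r0 rt].
  by rewrite clamp_id// (le_trans rt).
have := hd u v u0 uv vT vu; rewrite -!drE//; last 2 first.
- exact: le_trans uv vT.
- exact: le_trans uv.
by rewrite /= clamp_id// (le_trans uv).
Qed.

(** * From the rough equation to additive noise *)

Section from_rough.
Variables (x0 : R) (X X' : R -> R).
Hypothesis solX : rde_solution T alpha f sigma W WW x0 X X'.

Let hX : exists2 C, 0 <= C & forall s t, 0 <= s -> s <= t -> t <= T ->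
   [/\ `|W t - W s| <= C * om (t - s), `|X t - X s| <= C * om (t - s) &
      `|X t - X s - sigma (X s) * (W t - W s)| <= C * om (t - s) ^+ 2].
Proof.
have [[hW _ _] [hX _ [C2 hXX]] X'E] := solX.
have [C0 C00 {}hW] := holder_om hW; have [C1 C10 {}hX] := holder_om hX.
exists (C0 + C1 + `|C2|) => [|s t s0 st tT]; first by rewrite !addr_ge0.
have sT := le_trans st tT; have t0 := le_trans s0 st.
split.
- rewrite (le_trans (hW _ _ s0 st tT))// ler_wpM2r//.
  by rewrite -addrA lerDl addr_ge0.
- rewrite (le_trans (hX _ _ s0 st tT))// ler_wpM2r//.
  by rewrite addrAC lerDr addr_ge0.
- have := hXX s t; rewrite /= !in_itv/= s0 tT sT t0 => /(_ isT isT).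
  have [_ ->] := X'E s s0 sT.
  rewrite [`|t - s|]ger0_norm ?subr_ge0// om2 => /le_trans; apply.
  rewrite ler_wpM2r ?sqr_ge0// (le_trans (ler_norm _))// lerDr.
  by rewrite addr_ge0.
Qed.

(** The compensated summand of the rough integral of [sigma (X)], that is, the germ to be sewn. *)
Let Xi u v := sigma (X u) * (W v - W u) + sigma1 (X u) * sigma (X u) * WW u v.

(** By the additivity defect of [WW], the defect of [Xi] is the controlled remainder of [sigma (X)]
    times an increment of [W], plus an increment of [sigma1 (X) * sigma (X)] times [WW]. The orders
    in [om] are 2 + 1 and 1 + 2. *)
Let Xi_delta : exists C, forall s t, 0 <= s -> s < t -> t <= T ->
  `|Xi s t - Xi s ((s + t) / 2) - Xi ((s + t) / 2) t|
    <= C * (t - s) `^ (1 + (3 * alpha - 1)).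
Proof.
have [C C0 hC] := hX.
pose A := (M * C + M * C ^+ 2) * C.
pose B := (M * M + M * M) * C * (C ^+ 2 + `|c| * T `^ (1 - 2 * alpha)).
exists (A + B) => s t s0 st tT.
rewrite om3; last by rewrite subr_ge0 ltW.
set m := (s + t) / 2; set w := om (t - s).
have sm : s <= m by rewrite /m; lra.
have mt : m <= t by rewrite /m; lra.
have m0 : 0 <= m by exact: le_trans sm.
have mT : m <= T by exact: le_trans tT.
have [W1 X1 R1] := hC s m s0 sm mT.
have [W2 _ _] := hC m t m0 mt tT.
have lew d : 0 <= d -> d <= t - s -> om d <= w.
  by move=> d0 dts; rewrite ge0_ler_powR ?nnegrE ?subr_ge0 ?(ltW st) ?(ltW a0)//; lra.
have w1 : om (m - s) <= w by apply: lew; lra.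
have w2 : om (t - m) <= w by apply: lew; lra.
have w0 : 0 <= w by exact: om0.
have {}W1 : `|W m - W s| <= C * w by rewrite (le_trans W1)// ler_wpM2l.
have {}X1 : `|X m - X s| <= C * w by rewrite (le_trans X1)// ler_wpM2l.
have {}W2 : `|W t - W m| <= C * w by rewrite (le_trans W2)// ler_wpM2l.
have {}R1 : `|X m - X s - sigma (X s) * (W m - W s)| <= C * w ^+ 2.
  by rewrite (le_trans R1)// ler_wpM2l// ler_pXn2r// nnegrE.
have WW2 : `|WW m t| <= (C ^+ 2 + `|c| * T `^ (1 - 2 * alpha)) * w ^+ 2.
  rewrite WWE// mulrDl (le_trans (ler_normD _ _))// lerD//.
    rewrite normrM (@ger0_norm _ (2^-1)) ?invr_ge0// normrX -exprMn.
    rewrite (@le_trans _ _ (`|W t - W m| ^+ 2))//.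
      by rewrite ler_piMr ?sqr_ge0// invf_le1// ler1n.
    by rewrite ler_pXn2r// nnegrE// mulr_ge0.
  rewrite normrM -mulrA ler_wpM2l// ger0_norm ?subr_ge0//.
  have tm1 : 0 <= t - m by rewrite subr_ge0.
  have tm2 : t - m <= T by lra.
  rewrite (le_trans (le_om2 tm1 tm2))// ler_wpM2l ?powR_ge0//.
  by rewrite ler_pXn2r// nnegrE.
have S1 : `|sigma (X m) - sigma (X s) - sigma1 (X s) * (X m - X s)|
    <= M * C ^+ 2 * w ^+ 2.
  rewrite (le_trans (@taylor1 _ _ _ _ _ _ M dsigma dsigma1 _))//.
  by rewrite -mulrA ler_wpM2l// -exprMn sqr_ler_norm.
have S2 : `|sigma1 (X s) * (X m - X s - sigma (X s) * (W m - W s))|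
    <= M * C * w ^+ 2.
  by rewrite -mulrA; apply: normZ_le.
have lip1 : `|sigma1 (X m) - sigma1 (X s)| <= M * (C * w).
  rewrite (le_trans (@lipschitz_from _ _ _ _ _ M dsigma1 _))//.
  by rewrite ler_wpM2l.
have lip0 : `|sigma (X m) - sigma (X s)| <= M * (C * w).
  rewrite (le_trans (@lipschitz_from _ _ _ _ _ M dsigma _))//.
  by rewrite ler_wpM2l.
have S3 : `|sigma1 (X m) * sigma (X m) - sigma1 (X s) * sigma (X s)|
    <= (M * M + M * M) * C * w.
  have -> : sigma1 (X m) * sigma (X m) - sigma1 (X s) * sigma (X s) =
    (sigma1 (X m) - sigma1 (X s)) * sigma (X m) +
    sigma1 (X s) * (sigma (X m) - sigma (X s)) by ring.
  rewrite (le_trans (ler_normD _ _))//.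
  have -> : (M * M + M * M) * C * w = M * (C * w) * M + M * (M * (C * w)) by ring.
  by apply: lerD; exact: normZ_le.
have -> : Xi s t - Xi s m - Xi m t =
  - ((sigma (X m) - sigma (X s) - sigma1 (X s) * (X m - X s)
      + sigma1 (X s) * (X m - X s - sigma (X s) * (W m - W s)))
     * (W t - W m))
  - (sigma1 (X m) * sigma (X m) - sigma1 (X s) * sigma (X s)) * WW m t.
  rewrite /Xi !WWE//; last exact: ltW.
  by field.
rewrite (le_trans (ler_normB _ _))// [leRHS]mulrDl normrN lerD//.
- have -> : A * w ^+ 3 = (M * C * w ^+ 2 + M * C ^+ 2 * w ^+ 2) * (C * w).
    by rewrite /A; ring.
  apply: normZ_le => //; rewrite (le_trans (ler_normD _ _))// addrC lerD//.
- have -> : B * w ^+ 3 = (M * M + M * M) * C * w *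
     ((C ^+ 2 + `|c| * T `^ (1 - 2 * alpha)) * w ^+ 2).
    by rewrite /B; ring.
  exact: normZ_le.
Qed.

Let dr t := (\int[lebesgue_measure]_(r in `[0%R, t]) f (X r))%R.

Let dsigma1E x : derive1 sigma x = sigma1 x.
Proof. by rewrite derive1E; have [_] := dsigma x. Qed.

Let roughXi t p : 0 <= t -> t <= T -> itv_partition 0 t p ->
  partition_sum 0 p (fun u v => (sigma \o X) u * (W v - W u)
     + (derive1 sigma (X u) * X' u) * WW u v) = partition_sum 0 p Xi.
Proof.
move=> t0 tT pt; apply/eqP; rewrite -subr_eq0 -normr_le0.
(* The summands agree on every cell, so [eps = 0] works and any strict bound on the mesh serves. *)
have md : mesh 0 p < `|mesh 0 p| + 1 by rewrite (le_lt_trans (ler_norm _))// ltrDl.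
rewrite (le_trans (partition_sum_close (eps := 0) pt md _ _))//.
- move=> u v u0 uv vt _; rewrite mul0r normr_le0 subr_eq0 dsigma1E/= /Xi.
  have [_ _ /(_ u u0)] := solX.
  by move=> /(_ (ltW (lt_le_trans uv (le_trans vt tT))))[_ ->].
- by rewrite mul0r.
Qed.

(** A fine partition of [[0, s]] followed by a fine dyadic one of [[s, t]] approximates the integral
    up to [t]. The difference of the two integrals is therefore close to the dyadic sum alone, which
    sewing compares with [Xi s t]. *)
Let expansion : exists2 K, 0 <= K & forall s t, 0 <= s -> s < t -> t <= T ->
  `|X t - X s - (dr t - dr s) - Xi s t| <= K * om (t - s) ^+ 3.
Proof.
have [C hXi] := Xi_delta.
have k0 : 0 < 3 * alpha - 1 by move: alpha3; lra.
have [K hK'] := sewing k0 hXi.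
exists `|K| => // s t s0 st tT.
apply/ler_addgt0Pr => eps e0.
have [_ _ hI] := solX.
have t0 : 0 <= t by apply: le_trans (ltW st).
have sT : s <= T by apply: le_trans tT; exact: ltW.
have [[Is rIs Xs] _] := hI s s0 sT.
have [[It rIt Xt] _] := hI t t0 tT.
have e2 : 0 < eps / 2 by rewrite divr_gt0.
have [ds ds0 {}rIs] := rIs _ e2; have [dt dt0 {}rIt] := rIt _ e2.
pose delta := Num.min ds dt.
have delta0 : 0 < delta by rewrite lt_min ds0.
have [p pt pm] := fine_partition s0 delta0.
have [n _ /(_ n (leqnn n)) /= qm] := dyadic_mesh s t delta0.
have qt := dyadic_itv_partition n st.
set q := dyadic_partition n s t in qm qt.
have pqt := itv_partition_cat pt qt.
have lp : last 0 p = s by case: pt => _ /eqP.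
have pqm : mesh 0 (p ++ q) < delta.
  by move: pm qm; rewrite !mesh_lt// cells_cat all_cat lp => -> ->.
have := rIs p pt (lt_le_trans pm _); rewrite ge_min lexx => /(_ isT).
have := rIt _ pqt (lt_le_trans pqm _); rewrite ge_min lexx orbT => /(_ isT).
rewrite (roughXi s0 sT pt) (roughXi t0 tT pqt) partition_sum_cat lp.
have := hK' n s t s0 st tT; rewrite -/q om3 ?subr_ge0 ?(ltW st)//.
have := ler_norm K; rewrite -subr_ge0 => /mulr_ge0/(_ (exprn_ge0 3 (om0 (t - s)))).
set p1 := partition_sum 0 p Xi; set p2 := partition_sum s q Xi.
rewrite -/(dr s) in Xs; rewrite -/(dr t) in Xt; rewrite Xt Xs.
set w3 := om _ ^+ 3; set xi := Xi s t; rewrite mulrBl.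
have -> : x0 + dr t + It - (x0 + dr s + Is) - (dr t - dr s) - xi =
  - (p1 + p2 - It) + (p1 - Is) + (p2 - xi) by ring.
have := ler_normD (- (p1 + p2 - It) + (p1 - Is)) (p2 - xi).
have := ler_normD (- (p1 + p2 - It)) (p1 - Is).
by rewrite normrN; lra.
Qed.

Let dr_increments : forall eps, 0 < eps -> exists2 delta, 0 < delta & forall u v,
    0 <= u -> u <= v -> v <= T -> v - u < delta ->
    `|dr v - dr u - f (X u) * (v - u)| <= eps * (v - u).
Proof. by have [_ [hhX _ _] _] := solX; exact: drift_increments. Qed.

(** The second derivative of the Lamperti transform [g]. *)
Let g2 x := - sigma1 x * ((sigma x)^-1 ^+ 2).

Let dg2 (x : R) : is_derive x 1 (fun x => (sigma x)^-1) (g2 x).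
Proof.
apply: (is_derive_eq (is_deriveV (sigma_neq0 x) (dsigma x))).
by rewrite /g2 /GRing.scale/= exprVn; ring.
Qed.

Let sigmaV x : `|(sigma x)^-1| <= lam^-1.
Proof. by rewrite normfV lef_pV2 ?posrE ?normr_gt0. Qed.

Let g2_lip : exists2 m, 0 <= m & forall x y, `|g2 y - g2 x| <= m * `|y - x|.
Proof.
exists (M * (lam^-1 ^+ 2) + M * (2 * lam^-1 * (M * lam^-1 ^+ 2))).
  have l0 : 0 <= lam^-1 by rewrite invr_ge0 ltW.
  by rewrite addr_ge0// !mulr_ge0// exprn_ge0.
move=> x y; apply: (@lipschitz_from _ _ (fun z => - sigma2 z * ((sigma z)^-1 ^+ 2)
   + (- sigma1 z) * (2 * (sigma z)^-1 * g2 z))).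
  move=> z; have ? := dg2 z; apply: is_derive_eq.
  by rewrite /GRing.scale/=; ring.
move=> z _; rewrite (le_trans (ler_normD _ _))// lerD//.
  by apply: normZ_le; rewrite ?normrN// normrX ler_pXn2r// nnegrE ?invr_ge0 ltW.
apply: normZ_le; rewrite ?normrN//; apply: normZ_le.
  by rewrite normrM normr_nat ler_wpM2l.
by apply: normZ_le; rewrite ?normrN// normrX ler_pXn2r// nnegrE ?invr_ge0 ltW.
Qed.

(** The rough chain rule: the quadratic Taylor term of [g] cancels the part [(W v - W u) ^ 2 / 2] of
    [WW] up to third order, while the part [c * (v - u)] survives and becomes the drift term
    [c * sigma1]. *)
Lemma rde_additive : additive_solution T lamperti_drift W (g \o X).
Proof.
have [C C0 hC] := hX; have [K K0 hK'] := expansion.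
have [m m0 hm] := g2_lip.
have l0 : 0 <= lam^-1 by rewrite invr_ge0 ltW.
(* One summand for each of the third-order errors [T1], [T2] and [T3] below. *)
pose A := m * C ^+ 3 + 2^-1 * M * lam^-1 ^+ 2 * C * (M * C + C) + lam^-1 * K.
move=> eps e0; have e1 : 0 < eps / 2 by rewrite divr_gt0.
have [d1 d10 hd1] := om3_small A e1.
have e2 : 0 < eps / 2 * lam by rewrite mulr_gt0.
have [d2 d20 hd2] := dr_increments e2.
exists (Num.min d1 d2) => [|u v u0]; first by rewrite lt_min d10.
rewrite le_eqVlt => /predU1P[<- uT _|uv vT].
  by rewrite !subrr !mulr0 subrr normr0.
rewrite lt_min => /andP[vd1 vd2]; have uv' := ltW uv.
have [W1 X1 R1] := hC u v u0 uv' vT.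
have E1 := hK' u v u0 uv vT.
have D1 := hd2 u v u0 uv' vT vd2.
have vu0 : 0 <= v - u by rewrite subr_ge0.
have O1 := hd1 _ vu0 vd1.
rewrite /= /lamperti_drift gK.
set w := om (v - u) in W1 X1 R1 E1 O1; have w0 : 0 <= w by exact: om0.
have T1 : `|g (X v) - g (X u) - (sigma (X u))^-1 * (X v - X u)
    - g2 (X u) * (X v - X u) ^+ 2 / 2| <= m * C ^+ 3 * w ^+ 3.
  rewrite (le_trans (@taylor2 _ g (fun x => (sigma x)^-1) g2 _ _
     (m * `|X v - X u|) dg dg2 _))//.
    by move=> z zx; rewrite (le_trans (hm _ _))// ler_wpM2l.
  have -> : m * C ^+ 3 * w ^+ 3 = m * (C * w) * (C * w) ^+ 2 by ring.
  by rewrite ler_pM ?sqr_ge0 ?mulr_ge0// ?ler_wpM2l// sqr_ler_norm.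
have T2 : `|2^-1 * sigma1 (X u) * (sigma (X u))^-1 ^+ 2
    * (sigma (X u) * (W v - W u) - (X v - X u))
    * (sigma (X u) * (W v - W u) + (X v - X u))|
    <= 2^-1 * M * lam^-1 ^+ 2 * C * (M * C + C) * w ^+ 3.
  have -> : 2^-1 * M * lam^-1 ^+ 2 * C * (M * C + C) * w ^+ 3 =
     2^-1 * M * lam^-1 ^+ 2 * (C * w ^+ 2) * (M * (C * w) + C * w) by ring.
  apply: normZ_le; first apply: normZ_le; first apply: normZ_le.
  - by apply: normZ_le; rewrite // ger0_norm ?invr_ge0.
  - by rewrite normrX ler_pXn2r// nnegrE.
  - by rewrite distrC.
  - by rewrite (le_trans (ler_normD _ _))// lerD//; exact: normZ_le.
have T3 : `|(sigma (X u))^-1 * (X v - X u - (dr v - dr u) - Xi u v)|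
    <= lam^-1 * K * w ^+ 3.
  by rewrite -mulrA; exact: normZ_le.
have T4 : `|(sigma (X u))^-1 * (dr v - dr u - f (X u) * (v - u))|
    <= eps / 2 * (v - u).
  have -> : eps / 2 * (v - u) = lam^-1 * (eps / 2 * lam * (v - u)).
    by field; rewrite gt_eqF.
  exact: normZ_le.
have -> : g (X v) - g (X u) - (W v - W u)
    - (f (X u) / sigma (X u) + c * sigma1 (X u)) * (v - u) =
  (g (X v) - g (X u) - (sigma (X u))^-1 * (X v - X u)
    - g2 (X u) * (X v - X u) ^+ 2 / 2) +
  2^-1 * sigma1 (X u) * (sigma (X u))^-1 ^+ 2
    * (sigma (X u) * (W v - W u) - (X v - X u))
    * (sigma (X u) * (W v - W u) + (X v - X u)) +
  (sigma (X u))^-1 * (X v - X u - (dr v - dr u) - Xi u v) +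
  (sigma (X u))^-1 * (dr v - dr u - f (X u) * (v - u)).
  by rewrite /Xi WWE// /g2; field.
rewrite (le_trans (ler_normD _ _))//.
have -> : eps * (v - u) = eps / 2 * (v - u) + eps / 2 * (v - u) by field.
apply: lerD => //; rewrite (le_trans _ O1)// /A !mulrDl.
by rewrite (le_trans (ler_normD _ _))// lerD// (le_trans (ler_normD _ _))// lerD.
Qed.

Lemma rde_init : X 0 = x0.
Proof.
have [_ _ /(_ 0 (lexx 0) (ltW T0))[[I rI ->] _]] := solX.
suff -> : I = 0.
  by rewrite addr0 set_itv1 /Rintegral integral_set1/= addr0.
apply/eqP; rewrite -normr_le0; apply/ler_addgt0Pr => eps e0; rewrite add0r.
(* The empty list partitions [[0, 0]], and its sum is 0. *)
have [d d0 /(_ [::])] := rI eps e0.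
rewrite partition_sum_nil sub0r normrN mesh_lt//= => Ie.
by apply/ltW/Ie.
Qed.

Lemma rde_derivative t : 0 <= t -> t <= T -> X' t = sigma (X t).
Proof. by move=> t0 tT; have [_ _ /(_ t t0 tT)[]] := solX. Qed.

End from_rough.

(** * From additive noise back to the rough equation *)

Section to_rough.
Variables (x0 : R) (Z : R -> R).
Hypotheses (solZ : additive_solution T lamperti_drift W Z) (Z0 : Z 0 = g x0)
  (holderW : holder_on `[0, T] alpha W).

Local Notation X := (h \o Z).
Local Notation X' := (fun t => sigma (h (Z t))).

Let sigmaV x : `|(sigma x)^-1| <= lam^-1.
Proof. by rewrite normfV lef_pV2 ?posrE ?normr_gt0. Qed.

Let Mb := M * lam^-1 + `|c| * M.

Let driftM z : `|lamperti_drift z| <= Mb.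
Proof.
by rewrite (le_trans (ler_normD _ _))// lerD//; apply: normZ_le.
Qed.

(** The defining estimate with [eps = 1] holds on short intervals only; summed over a fine dyadic
    partition it gives the bound on [[u, v]], where [Mb] bounds the drift. *)
Let lipZ u v : 0 <= u -> u <= v -> v <= T ->
  `|Z v - Z u - (W v - W u)| <= (Mb + 1) * (v - u).
Proof.
move=> u0; rewrite le_eqVlt => /predU1P[<- _|uv vT].
  by rewrite !subrr mulr0 normr0.
have [delta d0 hd] := solZ (ltr01 : 0 < (1 : R)).
have [n _ /(_ n (leqnn n)) /= qm] := dyadic_mesh u v d0.
have := partition_sum_close (eps := Mb + 1) (F := fun u v => (Z v - W v) - (Z u - W u))
  (G := fun _ _ => 0) (dyadic_itv_partition n uv) qm d0.
rewrite partition_sum_telescope last_dyadic /partition_sum big1// subr0.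
have -> : Z v - W v - (Z u - W u) = Z v - Z u - (W v - W u) by ring.
apply=> s t us st tv ts; rewrite subr0.
have s0 := le_trans u0 us; have tT := le_trans tv vT.
have h1 : `|Z t - Z s - (W t - W s) - lamperti_drift (Z s) * (t - s)| <= t - s.
  by have := hd s t s0 (ltW st) tT ts; lra.
have -> : Z t - W t - (Z s - W s) =
  (Z t - Z s - (W t - W s) - lamperti_drift (Z s) * (t - s)) +
  lamperti_drift (Z s) * (t - s) by ring.
rewrite (le_trans (ler_normD _ _))// [leRHS]mulrDl mul1r addrC lerD//.
by apply: normZ_le => //; rewrite ger0_norm// subr_ge0 ltW.
Qed.

(** Stated for [s] and [t] in either order, as [controlled_path] demands. *)
Let hZ : exists2 C, 0 <= C & forall s t, 0 <= s -> s <= T -> 0 <= t -> t <= T ->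
  [/\ `|W t - W s| <= C * om `|t - s|, `|Z t - Z s| <= C * om `|t - s| &
      `|Z t - Z s - (W t - W s)| <= C * om `|t - s| ^+ 2].
Proof.
have [C C0 hW] := holder_om holderW.
have Mb0 : 0 <= Mb by exact: le_trans (driftM 0).
pose B := (Mb + 1) * T `^ (1 - 2 * alpha).
have B0 : 0 <= B by rewrite mulr_ge0 ?powR_ge0// addr_ge0.
exists (C + B * (1 + om T)).
  by rewrite addr_ge0// mulr_ge0// addr_ge0.
move=> s t; wlog st : s t / s <= t => [hw s0 sT t0 tT|].
  have [st|/ltW ts] := leP s t; first exact: hw.
  have [h1 h2 h3] := hw t s ts t0 tT s0 sT.
  rewrite distrC in h1; rewrite distrC in h2.
  rewrite (distrC t s); split => //.
  by rewrite (_ : Z t - _ - _ = - (Z s - Z t - (W s - W t))) ?normrN//; ring.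
move=> s0 sT t0 tT; rewrite (ger0_norm (_ : 0 <= t - s)) ?subr_ge0//.
have ts0 : 0 <= t - s by rewrite subr_ge0.
have tsT : t - s <= T by lra.
have h1 := hW s t s0 st tT.
have w0 := om0 (t - s); have w1 := om_le ts0 tsT; have wT := om0 T.
have h3 : `|Z t - Z s - (W t - W s)| <= B * om (t - s) ^+ 2.
  rewrite (le_trans (lipZ s0 st tT))// -mulrA ler_wpM2l ?le_om2//.
  by rewrite addr_ge0.
have h4 : `|Z t - Z s - (W t - W s)| <= B * om T * om (t - s).
  rewrite (le_trans h3)// expr2 mulrA ler_wpM2r// ler_wpM2l//.
split.
- rewrite (le_trans h1)// ler_wpM2r// lerDl mulr_ge0//; lra.
- have -> : Z t - Z s = (W t - W s) + (Z t - Z s - (W t - W s)) by ring.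
  rewrite (le_trans (ler_normD _ _))// mulrDl lerD// (le_trans h4)//.
  by rewrite ler_wpM2r// ler_wpM2l// lerDr.
- rewrite (le_trans h3)// ler_wpM2r ?sqr_ge0// mulrDr mulr1 addrA.
  by rewrite -addrA addrC -addrA lerDl addr_ge0// mulr_ge0.
Qed.

Let dh2 (z : R) : is_derive z 1 (fun z => sigma (h z)) (sigma1 (h z) * sigma (h z)).
Proof. exact: is_derive1_comp. Qed.

Let h_lip x y : `|h y - h x| <= M * `|y - x|.
Proof. by apply: (lipschitz_from dh) => z _. Qed.

Let sigmah_lip x y : `|sigma (h y) - sigma (h x)| <= M * M * `|y - x|.
Proof. by apply: (lipschitz_from dh2) => z _; exact: normZ_le. Qed.

Let h2_lip x y : `|sigma1 (h y) * sigma (h y) - sigma1 (h x) * sigma (h x)|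
  <= (M * M * M + M * (M * M)) * `|y - x|.
Proof.
apply: (@lipschitz_from _ (fun z => sigma1 (h z) * sigma (h z))
  (fun z => sigma2 (h z) * sigma (h z) * sigma (h z) +
     sigma1 (h z) * (sigma1 (h z) * sigma (h z)))) => [z|z _].
  have ? := dh2 z; have ? : is_derive z 1 (fun z => sigma1 (h z)) (sigma2 (h z) * sigma (h z)).
    exact: is_derive1_comp.
  by apply: is_derive_eq; rewrite /GRing.scale/=; ring.
rewrite (le_trans (ler_normD _ _))// lerD//.
  by do 2! apply: normZ_le => //.
by do 2! apply: normZ_le => //.
Qed.

Let holderX : holder_on `[0, T] alpha X.
Proof.
have [C C0 hC] := hZ; exists (M * C) => s t.
rewrite /= !in_itv/= => /andP[s0 sT] /andP[t0 tT].
have [_ hZst _] := hC s t s0 sT t0 tT.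
by rewrite (le_trans (h_lip _ _))// -mulrA ler_wpM2l.
Qed.

Let drZ t := (\int[lebesgue_measure]_(r in `[0%R, t]) f (X r))%R.

Let drZ_increments : forall eps, 0 < eps -> exists2 delta, 0 < delta & forall u v,
    0 <= u -> u <= v -> v <= T -> v - u < delta ->
    `|drZ v - drZ u - f (X u) * (v - u)| <= eps * (v - u).
Proof. exact: drift_increments. Qed.

Lemma additive_rde : rde_solution T alpha f sigma W WW x0 X X'.
Proof.
have [C C0 hC] := hZ.
split.
- split => //.
    exists (C ^+ 2 + `|c| * T `^ (1 - 2 * alpha)) => s t s0 st tT.
    have t0 := ltW (le_lt_trans s0 st); have sT := ltW (lt_le_trans st tT).
    have [h1 _ _] := hC s t s0 sT t0 tT.
    have ts0 : 0 <= t - s by rewrite subr_ge0 ltW.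
    rewrite (ger0_norm ts0) om2 in h1 *.
    have tsT : t - s <= T by lra.
    rewrite WWE ?(ltW st)// mulrDl (le_trans (ler_normD _ _))// lerD//.
      rewrite ger0_norm ?divr_ge0 ?sqr_ge0//.
      rewrite (@le_trans _ _ ((W t - W s) ^+ 2))//.
        by rewrite ler_piMr ?sqr_ge0// invf_le1// ler1n.
      by rewrite -exprMn sqr_ler_norm.
    by rewrite normrM (ger0_norm ts0) -mulrA ler_wpM2l// le_om2.
  move=> s u t s0 su ut tT; rewrite !WWE//.
  + by field.
  + exact: le_trans su.
  + exact: le_trans ut tT.
  + exact: le_trans ut.
- split => //.
    exists (M * M * C) => s t.
    rewrite /= !in_itv/= => /andP[s0 sT] /andP[t0 tT].
    have [_ hZst _] := hC s t s0 sT t0 tT.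
    by rewrite (le_trans (sigmah_lip _ _))// -[leRHS]mulrA ler_wpM2l// mulr_ge0.
  exists (M * M * C ^+ 2 + M * C) => s t.
  rewrite /= !in_itv/= => /andP[s0 sT] /andP[t0 tT].
  have [_ h2 h3] := hC s t s0 sT t0 tT; rewrite om2.
  have -> : h (Z t) - h (Z s) - sigma (h (Z s)) * (W t - W s) =
    (h (Z t) - h (Z s) - sigma (h (Z s)) * (Z t - Z s)) +
    sigma (h (Z s)) * (Z t - Z s - (W t - W s)) by ring.
  rewrite (le_trans (ler_normD _ _))// mulrDl lerD//.
    rewrite (le_trans (@taylor1 _ h (fun z => sigma (h z)) _ _ _ (M * M) dh dh2 _))//.
      by move=> z _; exact: normZ_le.
    by rewrite -[leRHS]mulrA -exprMn ler_wpM2l ?mulr_ge0// sqr_ler_norm.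
  by rewrite -mulrA; exact: normZ_le.
move=> t t0 tT; split => //.
(* The equation dictates the value of the integral. Written as a telescoping sum, it is compared
   with the Riemann sums cell by cell. *)
exists (X t - x0 - drZ t); last by rewrite -/(drZ t); ring.
move=> eps e0.
(* Each cell has three errors: from the drift integral, from the additive equation and from the
   Taylor remainders of [h]. Dividing by [T + 1] rather than [T] makes the final bound strict. *)
have e1 : 0 < eps / (T + 1) / 3 by rewrite !divr_gt0// addr_gt0.
have M1 : 0 < M + 1 by have := M0; lra.
have [d1 d10 hd1] := om3_small ((M * M * M + M * (M * M)) * C ^+ 3 +
   M * M * C * (C + C)) e1.
have [d2 d20 hd2] := drZ_increments e1.
have e2 : 0 < eps / (T + 1) / 3 / (M + 1) by rewrite divr_gt0.
have [d3 d30 hd3] := solZ e2.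
pose delta := Num.min d1 (Num.min d2 d3).
have delta0 : 0 < delta by rewrite !lt_min d10 d20.
exists delta => // p pt pm.
have -> : X t - x0 - drZ t = partition_sum 0 p (fun u v =>
    (X v - drZ v) - (X u - drZ u)).
  rewrite (partition_sum_telescope 0 p (fun u => X u - drZ u)).
  have -> : last 0 p = t by case: pt => _ /eqP.
  have -> : drZ 0 = 0 by rewrite /drZ set_itv1 /Rintegral integral_set1.
  by rewrite /= Z0 gK subr0; ring.
rewrite (@le_lt_trans _ _ (eps / (T + 1) * (t - 0)))//; last first.
  by rewrite subr0 mulrAC ltr_pdivrMr ?ltr_pM2l//; lra.
apply: partition_sum_close pt pm delta0 _ => u v u0 uv vt.
rewrite /delta !lt_min => /and3P[vd1 vd2 vd3].
have vT := le_trans vt tT; have uT := ltW (lt_le_trans uv vT).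
have v0 := ltW (le_lt_trans u0 uv); have uv' := ltW uv.
have vu0 : 0 <= v - u by rewrite subr_ge0.
have O1 := hd1 _ vu0 vd1.
have D1 := hd2 u v u0 uv' vT vd2.
have Z1 := hd3 u v u0 uv' vT vd3.
have [] := hC u v u0 uT v0 vT; rewrite (ger0_norm vu0).
set w := om (v - u) in O1 *; have w0 : 0 <= w by exact: om0.
move=> h1 h2 h3.
have T1 : `|h (Z v) - h (Z u) - sigma (h (Z u)) * (Z v - Z u)
    - sigma1 (h (Z u)) * sigma (h (Z u)) * (Z v - Z u) ^+ 2 / 2|
    <= (M * M * M + M * (M * M)) * C ^+ 3 * w ^+ 3.
  have m0 : 0 <= M * M * M + M * (M * M) by rewrite addr_ge0// !mulr_ge0.
  rewrite (le_trans (@taylor2 _ h _ _ _ _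
     ((M * M * M + M * (M * M)) * `|Z v - Z u|) dh dh2 _))//.
    by move=> z zx; rewrite (le_trans (h2_lip _ _))// ler_wpM2l.
  rewrite -[leRHS]mulrA -exprMn.
  have -> : (C * w) ^+ 3 = (C * w) * (C * w) ^+ 2 by ring.
  set m := M * M * M + _ in m0 *.
  rewrite (mulrA m); apply: ler_pM.
  - by rewrite mulr_ge0.
  - exact: sqr_ge0.
  - by rewrite ler_wpM2l.
  - exact: sqr_ler_norm.
have T2 : `|2^-1 * (sigma1 (h (Z u)) * sigma (h (Z u)))
    * (Z v - Z u - (W v - W u)) * (Z v - Z u + (W v - W u))|
    <= M * M * C * (C + C) * w ^+ 3.
  have -> : M * M * C * (C + C) * w ^+ 3 =
     1 * (M * M) * (C * w ^+ 2) * (C * w + C * w) by ring.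
  apply: normZ_le; first apply: normZ_le; first apply: normZ_le => //.
  - by rewrite ger0_norm ?invr_ge0// invf_le1// ler1n.
  - exact: normZ_le.
  - exact: h3.
  - by rewrite (le_trans (ler_normD _ _))// lerD.
have T3 : `|sigma (h (Z u)) * (Z v - Z u - (W v - W u)
    - lamperti_drift (Z u) * (v - u))| <= eps / (T + 1) / 3 * (v - u).
  have -> : eps / (T + 1) / 3 * (v - u) =
     (M + 1) * (eps / (T + 1) / 3 / (M + 1) * (v - u)).
    by field; rewrite !gt_eqF// ltr_wpDl// ltW.
  by apply: normZ_le => //; apply: le_trans (sigmaM _) _; rewrite lerDl.
have -> : (sigma \o X) u * (W v - W u) +
    derive1 sigma (X u) * sigma (h (Z u)) * WW u v - (X v - drZ v - (X u - drZ u)) =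
  (drZ v - drZ u - f (X u) * (v - u)) -
  (sigma (h (Z u)) * (Z v - Z u - (W v - W u) - lamperti_drift (Z u) * (v - u))) -
  (h (Z v) - h (Z u) - sigma (h (Z u)) * (Z v - Z u)
    - sigma1 (h (Z u)) * sigma (h (Z u)) * (Z v - Z u) ^+ 2 / 2 +
   2^-1 * (sigma1 (h (Z u)) * sigma (h (Z u)))
    * (Z v - Z u - (W v - W u)) * (Z v - Z u + (W v - W u))).
  rewrite derive1E; have [_ ->] := dsigma (X u).
  by rewrite /= WWE// /lamperti_drift; field.
have -> : eps / (T + 1) * (v - u) = eps / (T + 1) / 3 * (v - u) +
  eps / (T + 1) / 3 * (v - u) + eps / (T + 1) / 3 * (v - u).
  by field; rewrite gt_eqF// ltr_wpDl// ltW.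
rewrite (le_trans (ler_normB _ _))// lerD//.
  by rewrite (le_trans (ler_normB _ _))// lerD.
by rewrite (le_trans _ O1)// mulrDl (le_trans (ler_normD _ _))// lerD.
Qed.

End to_rough.

End lamperti_correspondence.

(** * Euler schemes *)

Lemma ultra_fmap {T U : Type} (f : T -> U) (F : set_system T) :
  UltraFilter F -> UltraFilter (f @ F).
Proof.
move=> FU; split; first exact: fmap_proper_filter.
move=> G PG FG; apply/seteqP; split=> // A GA.
have [//|FnA] := in_ultra_setVsetC (f @^-1` A) FU.
have GnA : G (~` A) by apply: FG.
have : G (A `&` ~` A) by apply: filterI.
by rewrite setICr => /(@filter_not_empty _ G PG).
Qed.

Section euler_scheme.
Context {R : realType}.
Implicit Types (T x y z h u v eps delta L M : R) (b W Z : R -> R).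

Fixpoint euler b W h y k : R :=
  if k is k'.+1 then
    euler b W h y k' + h * b (euler b W h y k') + (W (k%:R * h) - W (k'%:R * h))
  else y.

(** For [h * L <= 1] the step [x + h * b' x] is monotone in [x], so domination survives each step,
    and the margin [eps] between the drifts pays for the local error of [Z]. The threshold depends
    on [Z] but not on [N] or [y]. *)
Lemma euler_dominates T b b' W Z eps L : additive_solution T b W Z ->
  0 < eps -> (forall x, b x + eps <= b' x) ->
  (forall x y, `|b' x - b' y| <= L * `|x - y|) ->
  exists2 delta, 0 < delta & forall h N y, 0 < h -> h < delta ->
    N%:R * h <= T -> Z 0 <= y -> Z (N%:R * h) <= euler b' W h y N.
Proof.
move=> solZ e0 bb' lip; have [delta d0 hd] := solZ _ e0.
have L1 : 0 < `|L| + 1 by rewrite ltr_wpDl.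
exists (Num.min delta (`|L| + 1)^-1); first by rewrite lt_min d0 invr_gt0.
move=> h + y h0; rewrite lt_min => + /andP[hdelta hL].
elim=> [|k ih] kT Zy; first by rewrite mul0r.
have kh : k%:R * h <= k.+1%:R * h by rewrite ler_wpM2r ?ler_nat// ltW.
have {}ih := ih (le_trans kh kT) Zy.
have kS : k.+1%:R * h - k%:R * h = h by rewrite -natr1; ring.
have := hd (k%:R * h) (k.+1%:R * h) _ kh kT.
rewrite kS => /(_ _ hdelta); rewrite mulr_ge0 ?(ltW h0)// => /(_ isT) Zk.
rewrite /=; set V := euler _ _ _ _ _ in ih *.
set zk := Z (k%:R * h) in ih Zk; set zS := Z (k.+1%:R * h) in Zk *.
set wk := W (k%:R * h) in Zk *; set wS := W (k.+1%:R * h) in Zk *.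
have hLh : h * L * (V - zk) <= V - zk.
  have Vz : 0 <= V - zk by rewrite subr_ge0.
  have hL1 : h * (`|L| + 1) < 1 by rewrite -ltr_pdivlMr// div1r.
  rewrite ler_piMl// (le_trans _ (ltW hL1))// ler_wpM2l ?(ltW h0)//.
  by rewrite (le_trans (ler_norm _))// lerDl.
have lipV : b' zk - b' V <= L * (V - zk).
  have := lip zk V; rewrite distrC (distrC zk) (ger0_norm (_ : 0 <= V - zk)) ?subr_ge0//.
  by apply: le_trans; rewrite distrC ler_norm.
have := bb' zk; have := ler_norm (zS - zk - (wS - wk) - b zk * h).
have lipV' : h * (b' zk - b' V) <= h * (L * (V - zk)) by rewrite ler_wpM2l// ltW.
move=> h1 h2.
have h3 : h * (b zk + eps) <= h * b' zk by rewrite ler_wpM2l// ltW.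
by lra.
Qed.

Lemma eulerN b W h y k :
  euler (fun x => - b (- x)) (fun t => - W t) h (- y) k = - euler b W h y k.
Proof. by elim: k => [//|k /= ->]; rewrite opprK; ring. Qed.

Lemma additive_solutionN T b W Z : additive_solution T b W Z ->
  additive_solution T (fun x => - b (- x)) (fun t => - W t) (fun t => - Z t).
Proof.
move=> solZ eps e0; have [delta d0 hd] := solZ _ e0.
exists delta => // u v u0 uv vT vu; rewrite !opprK.
have -> : - Z v + Z u - (- W v + W u) - - b (Z u) * (v - u) =
  - (Z v - Z u - (W v - W u) - b (Z u) * (v - u)) by ring.
by rewrite normrN hd.
Qed.

(** This is [euler_dominates] for the equation reflected through 0. *)
Lemma euler_dominated T b b' W Z eps L : additive_solution T b W Z ->
  0 < eps -> (forall x, b' x + eps <= b x) ->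
  (forall x y, `|b' x - b' y| <= L * `|x - y|) ->
  exists2 delta, 0 < delta & forall h N y, 0 < h -> h < delta ->
    N%:R * h <= T -> y <= Z 0 -> euler b' W h y N <= Z (N%:R * h).
Proof.
move=> solZ e0 bb' lip.
have [||delta d0 hd] := euler_dominates (additive_solutionN solZ)
    (b' := fun x => - b' (- x)) (L := L) e0.
- by move=> x; have := bb' (- x); lra.
- move=> x y; rewrite -opprD normrN (le_trans (lip _ _))//.
  by rewrite -opprD normrN.
exists delta => // h N y h0 hde NT yZ.
by have := hd h N (- y) h0 hde NT; rewrite eulerN !lerN2; exact.
Qed.

End euler_scheme.

(** * Existence for additive noise *)

Section peano.
Context {R : realType}.
Variables (T M z0 : R) (b W : R -> R).
Implicit Types (x y z h u v eps delta : R).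
Hypotheses (T0 : 0 < T) (bM : forall x, `|b x| <= M) (ucb : unif_cont b)
  (ucW : unif_cont (W \o clamp T)).

Let Wc := W \o clamp T.
Let mh n : R := T / n.+1%:R.

(* Euler steps for y = Z - W, which solves y' = b (y + W). *)
Let Y n : nat -> R := fix Y k := if k is k'.+1 then
  Y k' + mh n * b (Y k' + Wc (k'%:R * mh n)) else z0 - W 0.

Let mh0 n : 0 < mh n. Proof. by rewrite divr_gt0. Qed.

Let M0 : 0 <= M. Proof. exact: le_trans (bM 0). Qed.

Let YS n k : Y n k.+1 = Y n k + mh n * b (Y n k + Wc (k%:R * mh n)).
Proof. by []. Qed.

Let Y_lip n j m : `|Y n (j + m) - Y n j| <= M * (m%:R * mh n).
Proof.
elim: m => [|m ih]; first by rewrite addn0 subrr normr0 mul0r mulr0.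
rewrite addnS YS.
have -> : forall a c d : R, a + c - d = c + (a - d) by move=> a c d; ring.
rewrite (le_trans (ler_normD _ _))//.
have -> : M * (m.+1%:R * mh n) = mh n * M + M * (m%:R * mh n).
  by rewrite -natr1; ring.
rewrite lerD//.
by rewrite normrM (ger0_norm (ltW (mh0 n))) ler_wpM2l// ltW.
Qed.

(** Over a short stretch neither the scheme nor the noise moves by more than [d / 4], so the drift
    stays within [eps] of its value at the start. *)
Let Y_local eps : 0 < eps -> exists2 delta, 0 < delta & forall n j m,
  m%:R * mh n < delta ->
  `|Y n (j + m) - Y n j - m%:R * mh n * b (Y n j + Wc (j%:R * mh n))|
    <= m%:R * mh n * eps.
Proof.
move=> e0; have [d d0 hd] := ucb e0.
have d4 : 0 < d / 4 by rewrite divr_gt0.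
have [d' d'0 hW] := ucW d4.
have M1 : 0 < 4 * (M + 1) by have := M0; lra.
exists (Num.min d' (d / (4 * (M + 1)))); first by rewrite lt_min d'0 divr_gt0.
move=> n j; elim=> [|m ih]; first by rewrite addn0 !mul0r subrr subr0 normr0.
have mm : m%:R * mh n <= m.+1%:R * mh n.
  by rewrite ler_wpM2r ?ler_nat// ltW.
rewrite lt_min => /andP[md' mdM].
have {}ih : `|Y n (j + m) - Y n j - m%:R * mh n * b (Y n j + Wc (j%:R * mh n))|
    <= m%:R * mh n * eps.
  by apply: ih; rewrite lt_min !(le_lt_trans mm).
have mdM' : m%:R * mh n < d / (4 * (M + 1)) by rewrite (le_lt_trans mm).
rewrite addnS YS; set V := Y n (j + m) in ih *; set V0 := Y n j in ih *.
set w := Wc (j%:R * mh n) in ih *; set w' := Wc ((j + m)%:R * mh n).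
have bb : `|b (V + w') - b (V0 + w)| <= eps.
  apply: hd; have -> : V + w' - (V0 + w) = (V - V0) + (w' - w) by ring.
  apply: (le_lt_trans (ler_normD _ _)).
  have h1 : `|V - V0| <= d / 4.
    rewrite (le_trans (Y_lip n j m))//.
    rewrite (@le_trans _ _ ((M + 1) * (d / (4 * (M + 1)))))//.
      apply: ler_pM; rewrite ?lerDl ?ler01 ?(ltW mdM')//.
      by rewrite mulr_ge0 ?ler0n// ltW.
    by rewrite le_eqVlt; apply/orP; left; apply/eqP; field; have := M0; lra.
  have h2 : `|w' - w| <= d / 4.
    apply: hW; rewrite natrD mulrDl addrAC subrr add0r.
    by rewrite (ger0_norm (mulr_ge0 (ler0n _ m) (ltW (mh0 n)))) (le_lt_trans mm).
  by rewrite (le_lt_trans (lerD h1 h2))//; lra.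
have -> : V + mh n * b (V + w') - V0 - m.+1%:R * mh n * b (V0 + w) =
  (V - V0 - m%:R * mh n * b (V0 + w)) + mh n * (b (V + w') - b (V0 + w)).
  by rewrite -natr1; ring.
rewrite (le_trans (ler_normD _ _))//.
have -> : m.+1%:R * mh n * eps = m%:R * mh n * eps + mh n * eps.
  by rewrite -natr1; ring.
rewrite lerD// normrM (ger0_norm (ltW (mh0 n))) ler_wpM2l//.
exact: ltW.
Qed.

Let step n u := Num.truncn (u / mh n).
Let y n u := Y n (step n u).

Let step_itv n u : 0 <= u ->
  (step n u)%:R * mh n <= u /\ u < (step n u)%:R * mh n + mh n.
Proof.
move=> u0; have /truncn_itv/andP[h1 h2] : 0 <= u / mh n.
  by rewrite divr_ge0// ltW.
split; first by rewrite -ler_pdivlMr.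
by move: h2; rewrite ltr_pdivrMr// -natr1 mulrDl mul1r.
Qed.

Let mh_cvg : mh n @[n --> \oo] --> (0 : R).
Proof.
rewrite -(mulr0 T); apply: cvgM; first exact: cvg_cst.
exact: cvg_harmonic.
Qed.

(** Instead of extracting a subsequence, the schemes are followed along an ultrafilter finer than
    [\oo]. Their values lie in a compact interval, so they converge at all times at once, and the
    local estimate passes to the limit. *)
Lemma additive_exists : exists2 Z : R -> R, Z 0 = z0 & additive_solution T b W Z.
Proof.
have [U [UU ooU]] := @ultraFilterLemma nat \oo _.
have bdy n u : 0 <= u -> u <= T ->
    `[z0 - W 0 - M * T, z0 - W 0 + M * T]%classic (y n u).
  move=> u0 uT; rewrite /= in_itv/= -ler_distlC distrC /y.
  have := Y_lip n 0 (step n u); rewrite add0n => /le_trans; apply.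
  rewrite ler_wpM2l//; have [h1 _] := step_itv n u0; exact: le_trans uT.
have cv u : exists p : R, 0 <= u -> u <= T -> y n u @[n --> U] --> p.
  have [/andP[u0 uT]|nu] := boolP (0 <= u <= T); last first.
    by exists 0 => u0 uT; rewrite u0 uT in nu.
  have := @segment_compact R (z0 - W 0 - M * T) (z0 - W 0 + M * T).
  rewrite compact_ultra => /(_ (y ^~ u @ U) (ultra_fmap _ UU)).
  have hU : \forall n \near U,
      `[z0 - W 0 - M * T, z0 - W 0 + M * T]%classic (y n u).
    by apply: filterS filterT => n _; exact: bdy.
  by move=> /(_ hU)[p [_ hp]]; exists p.
have [p hp] := choice cv.
have mhU : mh n @[n --> U] --> (0 : R) by apply: cvg_trans mh_cvg => A; exact: ooU.
exists (fun t => p t + W t).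
  have : y n 0 @[n --> U] --> z0 - W 0.
    have -> : (fun n => y n 0) = fun=> z0 - W 0.
      by apply/funext => n; rewrite /y /step mul0r truncn0.
    exact: cvg_cst.
  move=> /(cvg_unique (@Rhausdorff R) (hp 0 (lexx 0) (ltW T0))) ->.
  by rewrite subrK.
move=> eps e0; have e3 : 0 < eps / 3 by rewrite divr_gt0.
have [d d0 hd] := Y_local e3.
have [db db0 hb] := ucb e3.
have db2 : 0 < db / 2 by rewrite divr_gt0.
have [dW dW0 hW] := ucW db2.
exists (d / 2) => [|u v u0 uv vT vu]; first by rewrite divr_gt0.
have uT := le_trans uv vT; have v0 := le_trans u0 uv.
have -> : p v + W v - (p u + W u) - (W v - W u) - b (p u + W u) * (v - u)
   = p v - p u - (v - u) * b (p u + W u) by ring.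
have cb : continuous b by exact: unif_cont_continuous.
(* The term [mh n * (eps + M)] accounts for [u] and [v] lying up to one step above their grid
   points; it vanishes in the limit. *)
have lim1 : `|y n v - y n u - (v - u) * b (y n u + W u)|
     - mh n * (eps + M) @[n --> U] -->
   `|p v - p u - (v - u) * b (p u + W u)| - 0 * (eps + M).
  apply: cvgB; last by apply: cvgM => //; exact: cvg_cst.
  apply: cvg_norm; apply: cvgB; first exact: cvgB (hp v v0 vT) (hp u u0 uT).
  apply: cvgM; first exact: cvg_cst.
  apply: (@continuous_cvg _ _ _ U _ (fun n => y n u + W u) b (p u + W u) (cb _)).
  by apply: cvgD; [exact: hp|exact: cvg_cst].
rewrite -[leLHS](subr0) -[X in _ - X](mul0r (eps + M)).
apply: (cvgr_to_le lim1); apply: ooU.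
have : \forall n \near \oo, mh n < Num.min (d / 2) dW.
  have m0 : 0 < Num.min (d / 2) dW by rewrite lt_min divr_gt0.
  have /cvgrPdist_lt/(_ _ m0) := mh_cvg; apply: filterS => n.
  by rewrite sub0r normrN ger0_norm// ltW.
apply: filterS => n; rewrite lt_min => /andP[nd nW].
have [u1 u2] := step_itv n u0; have [v1 v2] := step_itv n v0.
have suv : (step n u <= step n v)%N.
  by rewrite le_truncn// ler_pM2r ?invr_gt0.
have := hd n (step n u) (step n v - step n u)%N; rewrite subnKC// natrB// mulrBl.
set j := (step n u)%:R * mh n in u1 u2 *; set k := (step n v)%:R * mh n in v1 v2 *.
have jk : j <= k by rewrite ler_wpM2r ?ler_nat// ltW.
have kj : k - j < d by lra.
have e30 : 0 <= eps / 3 by rewrite divr_ge0// ltW.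
have le_step : (k - j) * (eps / 3) <= (v - u + mh n) * (eps / 3).
  by rewrite ler_wpM2r//; lra.
have ge_step : 0 <= (v - u) * (eps / 3) by rewrite mulr_ge0// subr_ge0.
move=> /(_ kj); rewrite -/(y n u) -/(y n v) => h1.
have h2 : `|b (y n u + Wc j) - b (y n u + W u)| <= eps / 3.
  apply: hb; have -> : y n u + Wc j - (y n u + W u) = Wc j - W u by ring.
  have -> : W u = Wc u by rewrite /Wc/= clamp_id.
  rewrite (@le_lt_trans _ _ (db / 2))//; last by lra.
  by apply: hW; rewrite distrC ger0_norm; lra.
have -> : y n v - y n u - (v - u) * b (y n u + W u) =
   (y n v - y n u - (k - j) * b (y n u + Wc j)) +
   (k - j) * (b (y n u + Wc j) - b (y n u + W u)) +
   ((k - j) - (v - u)) * b (y n u + W u) by ring.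
have h3 : `|(k - j) * (b (y n u + Wc j) - b (y n u + W u))| <= (k - j) * (eps / 3).
  by apply: normZ_le => //; rewrite ger0_norm// subr_ge0.
have h4 : `|((k - j) - (v - u)) * b (y n u + W u)| <= mh n * M.
  by apply: normZ_le => //; rewrite ler_norml; lra.
set A := _ - (k - j) * b _ in h1 *; set B := (k - j) * _ in h3 *.
set C := _ * _ in h4 *.
have := ler_normD (A + B) C; have := ler_normD A B.
have := mulr_gt0 (mh0 n) e0.
by lra.
Qed.

End peano.

(** * Gaussian moments and independence *)

Section normal_moments.
Context {R : realType}.
Implicit Types (m s q x l v : R).
Local Notation mu := (@lebesgue_measure R).

(** The Radon-Nikodym derivative is identified with the Gaussian density almost everywhere, by
    comparing integrals over measurable sets. *)
Lemma ge0_integral_normal m s (f : R -> \bar R) : measurable_fun [set: R] f ->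
  (forall x, 0 <= f x)%E ->
  (\int[normal_prob m s]_x f x = \int[mu]_x (f x * (normal_pdf m s x)%:E))%E.
Proof.
move=> mf f0; pose N := normal_prob m s.
have dom : N `<< mu := @normal_prob_dominates R m s.
rewrite -(Radon_Nikodym_SigmaFinite.change_of_variables dom)//.
have mRN : measurable_fun [set: R] (Radon_Nikodym_SigmaFinite.f N mu).
  exact: (measurable_int _ (Radon_Nikodym_SigmaFinite.f_integrable dom)).
have mpdf : measurable_fun [set: R] (fun x => (normal_pdf m s x)%:E).
  by apply/measurable_EFinP; exact: measurable_normal_pdf.
have : ae_eq mu [set: R] (Radon_Nikodym_SigmaFinite.f N mu)
      (fun x => (normal_pdf m s x)%:E).
  apply: integral_ae_eq.
  - exact: measurableT.
  - exact: (Radon_Nikodym_SigmaFinite.f_integrable dom).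
  - exact: mpdf.
  - by move=> A _ mA; rewrite -(Radon_Nikodym_SigmaFinite.f_integral dom mA).
move=> ae.
apply: ae_eq_integral.
- exact: measurableT.
- by apply: emeasurable_funM.
- by apply: emeasurable_funM.
- by apply: filterS ae => x /= h /h ->.
Qed.
Let mulrn2 (x : R) : x *+ 2 = 2 * x. Proof. by rewrite mulr_natl. Qed.

(** The integrand times the density of deviation [s] is [q^-1] times the density of deviation
    [s / q]. *)
Lemma normal_square_exp s q : 0 < s -> 0 < q ->
  (\int[normal_prob 0 s]_x (expR ((1 - q ^+ 2) * x ^+ 2 / (2 * s ^+ 2)))%:E
   = q^-1%:E)%E.
Proof.
move=> s0 q0; have sq0 : s / q != 0 by rewrite gt_eqF// divr_gt0.
have sn0 : s != 0 by rewrite gt_eqF.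
rewrite ge0_integral_normal; last 2 first.
- apply/measurable_EFinP; apply: measurableT_comp => //.
  by do 2 apply: measurable_funM => //; exact: measurable_funX.
- by move=> x; rewrite lee_fin expR_ge0.
transitivity (\int[mu]_x (q^-1%:E * (normal_pdf 0 (s / q) x)%:E))%E.
  apply: eq_integral => x _; rewrite -!EFinM; congr EFin.
  have peakE : normal_peak (s / q) = q * normal_peak s.
    rewrite /normal_peak.
    have -> : (s / q) ^+ 2 * pi *+ 2 = q^-1 ^+ 2 * (s ^+ 2 * pi *+ 2).
      move: (pi : R) => p; rewrite mulrnAr; congr (_ *+ 2); field.
      by rewrite gt_eqF.
    rewrite sqrtrM ?sqr_ge0// sqrtr_sqr ger0_norm ?invr_ge0 ?(ltW q0)//.
    by rewrite invfM invrK.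
  rewrite !normal_pdfE// /normal_fun subr0 !(mulrn2 (_ ^+ 2)) peakE.
  rewrite mulrCA [RHS]mulrA mulKf ?gt_eqF//; congr (_ * _).
  rewrite -expRD; congr expR; field.
  by rewrite sn0 gt_eqF.
rewrite ge0_integralZl//.
- by rewrite integral_normal_pdf mule1.
- by apply/measurable_EFinP; exact: measurable_normal_pdf.
- by move=> x _; rewrite lee_fin normal_pdf_ge0.
- by rewrite lee_fin invr_ge0 ltW.
Qed.

(** Completing the square: the exponential shifts the mean to [l * s ^+ 2]. *)
Lemma normal_exp s l : 0 < s ->
  (\int[normal_prob 0 s]_x (expR (l * x))%:E = (expR (l ^+ 2 * s ^+ 2 / 2))%:E)%E.
Proof.
move=> s0; have sn0 : s != 0 by rewrite gt_eqF.
rewrite ge0_integral_normal; last 2 first.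
- by apply/measurable_EFinP; apply: measurableT_comp.
- by move=> x; rewrite lee_fin expR_ge0.
transitivity (\int[mu]_x ((expR (l ^+ 2 * s ^+ 2 / 2))%:E *
    (normal_pdf (l * s ^+ 2) s x)%:E))%E.
  apply: eq_integral => x _; rewrite -!EFinM; congr EFin.
  rewrite !normal_pdfE// /normal_fun subr0 !(mulrn2 (_ ^+ 2)) mulrCA [RHS]mulrCA.
  congr (_ * _); rewrite -!expRD; congr expR; field.
  exact: sn0.
rewrite ge0_integralZl//.
- by rewrite integral_normal_pdf mule1.
- by apply/measurable_EFinP; exact: measurable_normal_pdf.
- by move=> x _; rewrite lee_fin normal_pdf_ge0.
Qed.

(** With [y = x ^ 2 / (4 s ^ 2)] one has [y ^ (m + 1) <= (m + 1)! * exp y]. The exponential is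
    [normal_square_exp] at [q = sqrt (1 / 2)], and the final factor 2 bounds [q^-1]. *)
Lemma normal_even_moment s (m : nat) : 0 < s ->
  (\int[normal_prob 0 s]_x ((x ^+ 2) ^+ m.+1)%:E
    <= ((m.+1)`!%:R * (4 * s ^+ 2) ^+ m.+1 * 2)%:E)%E.
Proof.
move=> s0; set A := _ * _ ^+ _.
have s2 : 0 < 4 * s ^+ 2 by rewrite mulr_gt0// exprn_gt0.
have A0 : 0 < A by rewrite mulr_gt0 ?ltr0n ?fact_gt0// exprn_gt0.
pose q : R := Num.sqrt (1 / 2).
have q0 : 0 < q by rewrite sqrtr_gt0.
have q2 : q ^+ 2 = 1 / 2 by rewrite sqr_sqrtr.
have qle : q^-1 <= 2.
  have h : 1 / 2 <= q.
    by rewrite -(ler_pXn2r (n := 2)) ?nnegrE ?(ltW q0)// q2 expr2; lra.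
  by rewrite -[leRHS]invrK lef_pV2 ?posrE ?invr_gt0//; move: h; rewrite div1r.
apply: (@le_trans _ _ (\int[normal_prob 0 s]_x
    (A%:E * (expR ((1 - q ^+ 2) * x ^+ 2 / (2 * s ^+ 2)))%:E))%E).
  have mq : measurable_fun [set: R]
      (fun x => (expR ((1 - q ^+ 2) * x ^+ 2 / (2 * s ^+ 2)))%:E).
    apply/measurable_EFinP; apply: measurableT_comp => //.
    by apply: measurable_funM => //; apply: measurable_funM => //; exact: measurable_funX.
  apply: ge0_le_integral => //.
  - by move=> x _; rewrite lee_fin; apply: exprn_ge0; exact: sqr_ge0.
  - by apply/measurable_EFinP; apply: measurable_funX; exact: measurable_funX.
  - exact: measurable_funeM.
  move=> x _; rewrite -EFinM lee_fin q2.
  have y0 : 0 <= x ^+ 2 / (4 * s ^+ 2) by rewrite divr_ge0 ?sqr_ge0// ltW.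
  have -> : (1 - 1 / 2) * x ^+ 2 / (2 * s ^+ 2) = x ^+ 2 / (4 * s ^+ 2).
    by field; rewrite gt_eqF.
  have {1}-> : x ^+ 2 = (4 * s ^+ 2) * (x ^+ 2 / (4 * s ^+ 2)).
    by field; rewrite gt_eqF.
  have := expR_ge1Dxn m y0; set y := x ^+ 2 / _ => h.
  rewrite exprMn /A; have f0 : 0 < (m.+1)`!%:R :> R by rewrite ltr0n fact_gt0.
  have {}h : y ^+ m.+1 <= (m.+1)`!%:R * expR y.
    by rewrite -ler_pdivrMl// [leLHS]mulrC; apply: le_trans h; exact: ler_wpDl.
  rewrite (mulrC (m.+1)`!%:R) -mulrA ler_wpM2l//.
  by rewrite ltW// exprn_gt0.
rewrite ge0_integralZl//; last 2 first.
- by apply/measurable_EFinP; apply: measurableT_comp => //;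
    apply: measurable_funM => //; apply: measurable_funM => //; exact: measurable_funX.
- exact: ltW.
by rewrite normal_square_exp// -EFinM lee_fin ler_pM2l.
Qed.

Lemma normal_fourth s : 0 < s ->
  (\int[normal_prob 0 s]_x (x ^+ 4)%:E <= (64 * s ^+ 4)%:E)%E.
Proof.
move=> s0; have -> : 64 * s ^+ 4 = 2`!%:R * (4 * s ^+ 2) ^+ 2 * 2.
  by rewrite (_ : 2`! = 2)//; ring.
have e x : x ^+ 4 = (x ^+ 2) ^+ 2 by rewrite -exprM.
under eq_integral do rewrite e.
exact: normal_even_moment.
Qed.

Section polynomial_moments.
Variable s : R.
Hypothesis s0 : 0 < s.
Let N : probability _ R := normal_prob 0 s.
Let int (f : R -> R) := N.-integrable [set: R] (EFin \o f).

Let intD (f g : R -> R) : int f -> int g -> int (fun x => f x + g x).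
Proof. exact: integrableD. Qed.

Let intZ (k : R) (f : R -> R) : int f -> int (fun x => k * f x).
Proof. exact: integrableZl. Qed.

Let int_cst (k : R) : int (fun=> k).
Proof. exact: finite_measure_integrable_cst. Qed.

Let int4 : int (fun x => x ^+ 4).
Proof.
apply/integrableP; split; first by apply/measurable_EFinP; exact: measurable_funX.
apply: le_lt_trans (ltry (64 * s ^+ 4)).
rewrite (le_trans _ (normal_fourth s0))// le_eqVlt; apply/orP; left; apply/eqP.
by apply: eq_integral => x _; rewrite /= ger0_norm// exprn_even_ge0.
Qed.

Let int_le4 (f : R -> R) : measurable_fun [set: R] f ->
  (forall x, `|f x| <= 1 + x ^+ 4) -> int f.
Proof.
move=> mf f4; have i4 := intD (int_cst 1) int4.
apply: (le_integrable measurableT _ _ i4); first exact/measurable_EFinP.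
by move=> x _ /=; rewrite lee_fin (le_trans (f4 x))// ler_norm.
Qed.

Let int1 : int (fun x => x).
Proof.
apply: int_le4 => // x; rewrite ler_norml.
have := sqr_ge0 (x ^+ 2 - 2^-1); have := sqr_ge0 (x - 1); have := sqr_ge0 (x + 1).
by nra.
Qed.

Let int2 : int (fun x => x ^+ 2).
Proof.
apply: int_le4 => [|x]; first exact: measurable_funX.
rewrite ger0_norm ?sqr_ge0//; have := sqr_ge0 (x ^+ 2 - 1); have := sqr_ge0 x.
by nra.
Qed.

Let Icst (k : R) : (\int[N]_x k)%R = k.
Proof.
by rewrite Rintegral_cst//= (@probability_setT _ _ _ (normal_prob 0 s)) mulr1.
Qed.

Let m1_0 : (\int[N]_x x)%R = 0.
Proof.
set m1 := Rintegral _ _ _.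
(* Integrate [1 + l x <= expR (l x)], for small [l] of both signs. *)
have key l : 1 + l * m1 <= expR (l ^+ 2 * s ^+ 2 / 2).
  have e := normal_exp l s0.
  have ie : int (fun x => expR (l * x)).
    apply/integrableP; split.
      by apply/measurable_EFinP; apply: measurableT_comp.
    under eq_integral do rewrite /= ger0_norm ?expR_ge0//.
    by rewrite /= e ltry.
  have -> : expR (l ^+ 2 * s ^+ 2 / 2) = (\int[N]_x expR (l * x))%R.
    by rewrite /Rintegral e.
  rewrite /m1 -RintegralZl// -{1}(Icst 1) -RintegralD//; [|exact: int_cst|exact: intZ].
  apply: le_Rintegral => //; first exact: intD (int_cst 1) (intZ _ int1).
  by move=> x _; exact: expR_ge1Dx.
have small : forall l, 0 < l -> l ^+ 2 * s ^+ 2 <= 1 -> `|m1| <= l * s ^+ 2.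
  move=> l l0 l1; set y := l ^+ 2 * s ^+ 2 / 2.
  have y1 : y <= 1 / 2 by rewrite /y; lra.
  have y0 : 0 <= y by rewrite /y -exprMn divr_ge0 ?sqr_ge0.
  have ey : expR y <= 1 + 2 * y.
    have h := @expR_ge1Dx R (- y); rewrite expRN in h.
    have e0 := expR_gt0 y.
    have : (1 - y) * expR y <= 1.
      by rewrite -ler_pdivlMr// div1r.
    have : (1 - y) * (1 + 2 * y) >= 1 by nra.
    move=> h1 h2; have : (1 - y) * expR y <= (1 - y) * (1 + 2 * y) by lra.
    by rewrite ler_pM2l//; lra.
  have := key l; have := key (- l); rewrite sqrrN -/y => k1 k2.
  have ly : 2 * y = l * (l * s ^+ 2) by rewrite /y; field.
  rewrite ler_norml; apply/andP; split; rewrite -(ler_pM2l l0); lra.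
apply/eqP; rewrite -normr_le0; apply/ler_addgt0Pr => eps e0; rewrite add0r.
have s2 : 0 < s ^+ 2 by rewrite exprn_gt0.
pose l := Num.min (eps / s ^+ 2) s^-1.
have l0 : 0 < l by rewrite lt_min divr_gt0// invr_gt0.
rewrite (le_trans (small l l0 _))//.
  rewrite -exprMn exprn_ile1 ?mulr_ge0 ?(ltW l0) ?(ltW s0)//.
  by rewrite -ler_pdivlMr// div1r ge_min lexx orbT.
by rewrite -ler_pdivlMr// ge_min lexx.
Qed.

Let m2_s : (\int[N]_x (x ^+ 2))%R = s ^+ 2.
Proof.
set m2 := Rintegral _ _ _; set v := s ^+ 2.
(* Integrate [1 + y <= expR y] with [y = (1 - q ^ 2) x ^ 2 / (2 v)]; taking
   [q < 1] and [q > 1] bounds [m2] from both sides. *)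
have v0 : 0 < v by rewrite exprn_gt0.
have key q : 0 < q -> 1 + (1 - q ^+ 2) / (2 * v) * m2 <= q^-1.
  move=> q0; have e := normal_square_exp s0 q0; rewrite -/v in e.
  have ie : int (fun x => expR ((1 - q ^+ 2) * x ^+ 2 / (2 * v))).
    apply/integrableP; split.
      apply/measurable_EFinP; apply: measurableT_comp => //.
      by do 2 apply: measurable_funM => //; exact: measurable_funX.
    under eq_integral do rewrite /= ger0_norm ?expR_ge0//.
    by rewrite /= e ltry.
  have -> : q^-1 = (\int[N]_x expR ((1 - q ^+ 2) * x ^+ 2 / (2 * v)))%R.
    by rewrite /Rintegral e.
  rewrite /m2 -RintegralZl// -{1}(Icst 1) -RintegralD//; [|exact: int_cst|exact: intZ].
  apply: le_Rintegral => //; first exact: intD (int_cst 1) (intZ _ int2).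
  by move=> x _; rewrite mulrAC; exact: expR_ge1Dx.
have m20 : 0 <= m2 by apply: Rintegral_ge0 => x _; exact: sqr_ge0.
have key2 q : 0 < q -> (1 - q) * (q * (1 + q) * m2 - 2 * v) <= 0.
  move=> q0; have := key q q0; rewrite -(ler_pM2l (_ : 0 < 2 * v * q)); last first.
    by rewrite !mulr_gt0.
  have -> : 2 * v * q * (1 + (1 - q ^+ 2) / (2 * v) * m2) =
    2 * v * q + q * (1 - q) * (1 + q) * m2 by field; rewrite gt_eqF.
  by rewrite mulfK ?gt_eqF//; lra.
apply/eqP; rewrite eq_le !leNgt; apply/andP; split; apply/negP => lt.
- have m2p : 0 < m2 by exact: lt_trans lt.
  (* Here [q * m2] is the arithmetic mean of [m2] and [v], whereas [key2] yields
     [(q * m2) ^ 2 <= v * m2], against the strict inequality of means. *)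
  pose q := (m2 + v) / (2 * m2).
  have q0 : 0 < q by rewrite divr_gt0 ?addr_gt0 ?mulr_gt0.
  have qE : q * m2 = (m2 + v) / 2 by rewrite /q; field; rewrite gt_eqF.
  have q1 : q < 1 by rewrite /q ltr_pdivrMr ?mulr_gt0//; lra.
  have h : q * (1 + q) * m2 <= 2 * v.
    by have := key2 q q0; rewrite pmulr_rle0 ?subr_gt0// subr_le0.
  have h1 : q * q * m2 <= v by have := mulr_gt0 q0 m2p; nra.
  have h2 : (q * m2) * (q * m2) <= v * m2.
    have -> : q * m2 * (q * m2) = q * q * m2 * m2 by ring.
    by rewrite ler_wpM2r.
  have h3 : 0 < (m2 - v) ^+ 2 by rewrite exprn_gt0// subr_gt0.
  by rewrite qE in h2; lra.
- have vm : 0 < m2 + v by rewrite ltr_wpDl.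
  (* Now [v / q] is the arithmetic mean, and [key2] yields [(v / q) ^ 2 <= v * m2]. *)
  pose q := 2 * v / (m2 + v).
  have q0 : 0 < q by rewrite divr_gt0 ?mulr_gt0.
  have qE : q * (m2 + v) = 2 * v by rewrite /q; field; rewrite gt_eqF.
  have q1 : 1 < q by rewrite /q ltr_pdivlMr ?mulr_gt0//; lra.
  have h : 2 * v <= q * (1 + q) * m2.
    by have := key2 q q0; rewrite nmulr_rle0 ?subr_lt0// subr_ge0.
  have h1 : v <= q * q * m2 by have := mulr_ge0 (ltW q0) m20; nra.
  have h2 : v * (m2 + v) ^+ 2 <= (2 * v) * (2 * v) * m2.
    have -> : (2 * v) * (2 * v) * m2 = q * q * m2 * (m2 + v) ^+ 2.
      by rewrite -qE; ring.
    by rewrite ler_wpM2r// sqr_ge0.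
  have h3 : 0 < v * (v - m2) ^+ 2 by rewrite mulr_gt0// exprn_gt0// subr_gt0.
  by lra.
Qed.

(** One [m4] serves all coefficients. Only its bound is exported, which is enough because polynomial
    majorants will have [a4 >= 0]. *)
Lemma normal_polynomial : exists2 m4, 0 <= m4 <= 64 * s ^+ 4 &
  forall a0 a1 a2 a4,
    (\int[normal_prob 0 s]_x
      (a0 + a1 * x + a2 * (x ^+ 2 - s ^+ 2) + a4 * x ^+ 4)%:E)%E
    = (a0 + a4 * m4)%:E.
Proof.
exists (\int[N]_x (x ^+ 4))%R.
  apply/andP; split; first by apply: Rintegral_ge0 => x _; exact: exprn_even_ge0.
  rewrite -lee_fin fineK; first exact: normal_fourth.
  exact: integrable_fin_num int4.
move=> a0 a1 a2 a4.
have i1 := intZ a1 int1; have i2 := intD int2 (int_cst (- s ^+ 2)).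
have i2' := intZ a2 i2; have i4 := intZ a4 int4.
have i01 := intD (int_cst a0) i1; have i012 := intD i01 i2'.
rewrite -[LHS]fineK; last exact: integrable_fin_num (intD i012 i4).
congr EFin; rewrite -/(Rintegral _ _ _) RintegralD// RintegralD// RintegralD//.
rewrite !RintegralZl// RintegralD//.
have h1 : (\int[normal_prob 0 s]_x x)%R = 0 := m1_0.
have h2 : (\int[normal_prob 0 s]_x (x ^+ 2))%R = s ^+ 2 := m2_s.
have hk k : (\int[normal_prob 0 s]_x k)%R = k := Icst k.
rewrite h1 h2 !hk.
  by ring.
all: exact: int_cst.
Qed.

End polynomial_moments.
End normal_moments.

Section freezing.
Context {R : realType} {d : measure_display} {Omega : measurableType d}.
Variable P : probability Omega R.

(** The joint law of [X] and [xi] agrees with the product of the marginals on rectangles, hence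
    everywhere, and Tonelli integrates out [xi]. This takes the place of conditioning on [G]. *)
Lemma freezing d2 (T2 : measurableType d2) (G : set (set Omega)) (s : R)
    (xi : Omega -> R) (X : Omega -> T2) (Phi : T2 * R -> \bar R) :
  measurable_fun [set: Omega] xi -> measurable_fun [set: Omega] X ->
  independent_of P G xi ->
  (forall A : set R, measurable A -> P (xi @^-1` A) = normal_prob 0 s A) ->
  (forall A, measurable A -> G (X @^-1` A)) ->
  measurable_fun [set: T2 * R] Phi -> (forall z, 0 <= Phi z)%E ->
  (\int[P]_w Phi (X w, xi w) =
   \int[P]_w \int[normal_prob 0 s]_x Phi (X w, x))%E.
Proof.
move=> mxi mX ind law GX mPhi Phi0.
pose Xm : {mfun Omega >-> T2} := HB.pack X (isMeasurableFun.Build _ _ _ _ _ mX).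
have mXxi : measurable_fun [set: Omega]
    (fun w => (X w, xi w) : T2 * measurableTypeR R).
  exact: measurable_fun_pair.
pose XX : {mfun Omega >-> (T2 * measurableTypeR R)%type} :=
  HB.pack (fun w => (X w, xi w)) (isMeasurableFun.Build _ _ _ _ _ mXxi).
pose m1 : probability _ R := distribution P Xm.
pose m' : probability _ R := distribution P XX.
pose N : probability _ R := normal_prob 0 s.
have rect A C : measurable A -> measurable C ->
    m' (A `*` C) = (m1 A * N C)%E.
  move=> mA mC.
  transitivity (P (X @^-1` A `&` xi @^-1` C)); first by [].
  by rewrite ind ?law//; exact: GX.
have prodE := @product_measure_unique _ _ _ _ R m1 N m' rect.
transitivity (\int[m']_z Phi z)%E.
  by rewrite (ge0_integral_pushforward mXxi)//.
transitivity (\int[(m1 \x N)%E]_z Phi z)%E.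
  by apply: eq_measure_integral => A mA _; exact: (esym (prodE A mA)).
rewrite fubini_tonelli1//.
rewrite (ge0_integral_pushforward mX)//.
- exact: measurable_fun_fubini_tonelli_F.
- by move=> x _; apply: integral_ge0 => y _; exact: Phi0.
Qed.

End freezing.

Section adapted.
Context {R : realType} {d : measure_display} {Omega : measurableType d}.
Variable P : probability Omega R.
Implicit Types (G : set (set Omega)).

(* Going through [g_sigma_algebraType G] makes the library's closure properties
   of measurable functions available for measurability with respect to [G]. *)
Definition adapted_to d2 (T2 : measurableType d2) G (X : Omega -> T2) :=
  measurable_fun [set: g_sigma_algebraType G] (X : g_sigma_algebraType G -> T2).

Lemma adapted_toP d2 (T2 : measurableType d2) G (X : Omega -> T2) :
  sigma_algebra [set: Omega] G ->
  (forall A, measurable A -> G (X @^-1` A)) <-> adapted_to G X.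
Proof.
move=> sG; split=> [GX _ A mA|mX A mA].
  by rewrite setTI; apply: sub_sigma_algebra; exact: GX.
by have := mX measurableT A mA; rewrite setTI /measurable/= sigma_algebra_id.
Qed.

Lemma adapted_to_measurable d2 (T2 : measurableType d2) G (X : Omega -> T2) :
  sigma_algebra [set: Omega] G -> G `<=` measurable ->
  adapted_to G X -> measurable_fun [set: Omega] X.
Proof.
move=> sG Gm /(adapted_toP _ sG) GX _ A mA.
by rewrite setTI; apply/Gm/GX.
Qed.

Lemma adapted_toS d2 (T2 : measurableType d2) G G' (X : Omega -> T2) :
  sigma_algebra [set: Omega] G -> sigma_algebra [set: Omega] G' ->
  G `<=` G' -> adapted_to G X -> adapted_to G' X.
Proof.
by move=> sG sG' GG' /(adapted_toP _ sG) GX; apply/(adapted_toP _ sG') => A /GX/GG'.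
Qed.

(** The terms with [a1] and [a2] have mean zero, so a majorant may carry them with coefficients of
    any size and sign. *)
Lemma normal_integral_le s (Phi : R -> R) (a0 a1 a2 a4 : R) : 0 < s ->
  measurable_fun [set: R] Phi -> (forall x, 0 <= Phi x) -> 0 <= a4 ->
  (forall x, Phi x <= a0 + a1 * x + a2 * (x ^+ 2 - s ^+ 2) + a4 * x ^+ 4) ->
  (\int[normal_prob 0 s]_x (Phi x)%:E <= (a0 + 64 * a4 * s ^+ 4)%:E)%E.
Proof.
move=> s0 mPhi Phi0 a40 Phile.
have [m4 /andP[m40 m4s] mE] := normal_polynomial s0.
apply: (@le_trans _ _ (\int[normal_prob 0 s]_x
   (a0 + a1 * x + a2 * (x ^+ 2 - s ^+ 2) + a4 * x ^+ 4)%:E)%E).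
  apply: ge0_le_integral => //.
  - by move=> x _; rewrite lee_fin.
  - exact/measurable_EFinP.
  - apply/measurable_EFinP.
    by do ![apply: measurable_funD => //|apply: measurable_funM => //
           |apply: measurable_funB => //|exact: measurable_funX].
  - by move=> x _; rewrite lee_fin.
rewrite mE lee_fin lerD2l [64 * a4]mulrC -mulrA.
by rewrite ler_wpM2l.
Qed.

Section step.
Variables (G : set (set Omega)) (s : R) (xi : Omega -> R).
Hypotheses (sG : sigma_algebra [set: Omega] G) (Gm : G `<=` measurable)
  (s0 : 0 < s) (mxi : measurable_fun [set: Omega] xi)
  (ind : independent_of P G xi)
  (law : forall A : set R, measurable A -> P (xi @^-1` A) = normal_prob 0 s A).

(** The cross terms of [X] with the noise are centred. The polynomial majorant exceeds the square by
    the two squares displayed at the end, and [130 = 2 + 64 * 2] collects its constant term and the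
    bound on its quartic term. *)
Lemma martingale_step (X a : Omega -> R) (q : R) :
  adapted_to G X -> adapted_to G a ->
  (\int[P]_w ((X w + a w * xi w + q * (xi w ^+ 2 - s ^+ 2)) ^+ 2)%:E <=
   \int[P]_w (X w ^+ 2)%:E + (2 * s ^+ 2)%:E * \int[P]_w (a w ^+ 2)%:E
   + (130 * q ^+ 2 * s ^+ 4)%:E)%E.
Proof.
move=> aX aa.
have mX := adapted_to_measurable sG Gm aX.
have ma := adapted_to_measurable sG Gm aa.
pose Phi (z : (R * R) * R) :=
  ((z.1.1 + z.1.2 * z.2 + q * (z.2 ^+ 2 - s ^+ 2)) ^+ 2)%:E.
have mPhi : measurable_fun [set: (R * R) * R] Phi.
  apply/measurable_EFinP/measurable_funX.
  have m11 : measurable_fun [set: (R * R) * R] (fun z => z.1.1).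
    exact: (measurableT_comp measurable_fst measurable_fst).
  have m12 : measurable_fun [set: (R * R) * R] (fun z => z.1.2).
    exact: (measurableT_comp measurable_snd measurable_fst).
  have m2 : measurable_fun [set: (R * R) * R] (fun z => z.2) by exact: measurable_snd.
  by do ![apply: measurable_funD => //|apply: measurable_funM => //
         |apply: measurable_funB => //|exact: measurable_funX].
have aXa : adapted_to G (fun w => (X w, a w)) by exact: measurable_fun_pair.
have -> : (\int[P]_w ((X w + a w * xi w + q * (xi w ^+ 2 - s ^+ 2)) ^+ 2)%:E
   = \int[P]_w Phi ((X w, a w), xi w))%E by [].
rewrite (freezing mxi _ ind law _ mPhi)//; first last.
- by move=> z; rewrite lee_fin sqr_ge0.
- exact/(adapted_toP _ sG).
- exact: measurable_fun_pair.
have mX2 : measurable_fun [set: Omega] (fun w => (X w ^+ 2)%:E).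
  exact/measurable_EFinP/measurable_funX.
have ma2 : measurable_fun [set: Omega] (fun w => (a w ^+ 2)%:E).
  exact/measurable_EFinP/measurable_funX.
have s2 : 0 <= 2 * s ^+ 2 by rewrite mulr_ge0// sqr_ge0.
have c0 : 0 <= 130 * q ^+ 2 * s ^+ 4.
  by apply: mulr_ge0; [apply: mulr_ge0 => //; exact: sqr_ge0|exact: exprn_even_ge0].
rewrite (_ : (130 * q ^+ 2 * s ^+ 4)%:E =
  \int[P]_w (cst (130 * q ^+ 2 * s ^+ 4)%:E) w)%E; last first.
  by rewrite integral_cst//= (@probability_setT _ _ _ P) mule1.
rewrite -ge0_integralZl//; last by move=> w _; rewrite lee_fin sqr_ge0.
have ma2' : measurable_fun [set: Omega] (fun w => (2 * s ^+ 2)%:E * (a w ^+ 2)%:E)%E.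
  exact: measurable_funeM.
have ge1 w : [set: Omega] w -> (0 <= (X w ^+ 2)%:E)%E by rewrite lee_fin sqr_ge0.
have ge2 w : [set: Omega] w -> (0 <= (2 * s ^+ 2)%:E * (a w ^+ 2)%:E)%E.
  by move=> _; rewrite -EFinM lee_fin mulr_ge0// sqr_ge0.
rewrite -(ge0_integralD _ measurableT ge1 mX2 ge2 ma2').
rewrite -(ge0_integralD _ measurableT _ _ _ _)//; first last.
- by apply: emeasurable_funD.
- by move=> w ?; rewrite adde_ge0// ?ge1// ge2.
apply: ge0_le_integral => //.
- by move=> w _; apply: integral_ge0 => x _; rewrite lee_fin sqr_ge0.
- have mF : measurable_fun [set: R * R]
      (fun z => \int[normal_prob 0 s]_x Phi (z, x))%E.
    apply: measurable_fun_fubini_tonelli_F => //.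
    by move=> z; rewrite lee_fin sqr_ge0.
  exact: (measurableT_comp mF (measurable_fun_pair mX ma)).
- by apply: emeasurable_funD => //; apply: emeasurable_funD.
move=> w _; rewrite -EFinM -!EFinD; set x := X w; set b := a w.
have -> : x ^+ 2 + 2 * s ^+ 2 * b ^+ 2 + 130 * q ^+ 2 * s ^+ 4 =
  (x ^+ 2 + 2 * s ^+ 2 * b ^+ 2 + 2 * q ^+ 2 * s ^+ 4)
   + 64 * (2 * q ^+ 2) * s ^+ 4 by ring.
apply: (@normal_integral_le s (fun y => (x + b * y + q * (y ^+ 2 - s ^+ 2)) ^+ 2)
  _ (2 * x * b) (2 * x * q + 2 * b ^+ 2)) => //.
- apply: measurable_funX.
  by do ![apply: measurable_funD => //|apply: measurable_funM => //
         |apply: measurable_funB => //|exact: measurable_funX].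
- by move=> y; exact: sqr_ge0.
- by rewrite mulr_ge0// sqr_ge0.
move=> y; rewrite -subr_ge0.
set u := y ^+ 2 - s ^+ 2.
have -> : y ^+ 4 = (u + s ^+ 2) ^+ 2 by rewrite /u; ring.
have -> : x ^+ 2 + 2 * s ^+ 2 * b ^+ 2 + 2 * q ^+ 2 * s ^+ 4 + 2 * x * b * y +
    (2 * x * q + 2 * b ^+ 2) * u + 2 * q ^+ 2 * (u + s ^+ 2) ^+ 2 -
    (x + b * y + q * u) ^+ 2 =
  (b * y - q * u) ^+ 2 + (2 * q * s * y) ^+ 2.
  by rewrite /u; ring.
by rewrite addr_ge0 ?sqr_ge0.
Qed.

End step.

End adapted.

(** * Brownian motion *)

Lemma itv_partition_rconsP {R : realType} (s t v : R) (p : seq R) :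
  itv_partition s t (rcons p v) ->
  [/\ v = t, itv_partition s (last s p) p & last s p < t].
Proof.
rewrite /itv_partition rcons_path last_rcons => -[/andP[sp pv] /eqP <-].
by split => //; split.
Qed.

Section brownian.
Context {R : realType} {d : measure_display} {Omega : measurableType d}.
Variables (P : probability Omega R) (T : R) (F : R -> set (set Omega))
  (B : R -> Omega -> R).
Hypotheses (T0 : 0 < T) (hF : complete_filtration P T F)
  (hB : brownian_motion P T F B).
Implicit Types (s t u v eps delta : R) (p : seq R).

Lemma filtration_sigma t : 0 <= t -> t <= T -> sigma_algebra [set: Omega] (F t).
Proof. by move=> t0 tT; have [/(_ t t0 tT)[]] := hF. Qed.

Lemma filtration_measurable t : 0 <= t -> t <= T -> F t `<=` measurable.
Proof. by move=> t0 tT; have [/(_ t t0 tT)[]] := hF. Qed.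

Lemma filtration_adapted d2 (T2 : measurableType d2) s t (X : Omega -> T2) :
  0 <= s -> s <= t -> t <= T -> adapted_to (F s) X -> adapted_to (F t) X.
Proof.
move=> s0 st tT; apply: adapted_toS.
- by apply: filtration_sigma => //; exact: le_trans tT.
- by apply: filtration_sigma => //; exact: le_trans st.
- by have [_ mono _ _] := hF; exact: mono.
Qed.

Lemma brownian_adapted s t : 0 <= s -> s <= t -> t <= T -> adapted_to (F t) (B s).
Proof.
move=> s0 st tT; apply: (filtration_adapted s0 st tT).
have sT := le_trans st tT.
apply/(adapted_toP _ (filtration_sigma s0 sT)).
by have [/(_ s s0 sT)] := hB.
Qed.

Lemma brownian_measurable t : 0 <= t -> t <= T -> measurable_fun [set: Omega] (B t).
Proof.
move=> t0 tT; apply: (adapted_to_measurable (filtration_sigma t0 tT)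
  (filtration_measurable t0 tT)).
exact: brownian_adapted.
Qed.

Lemma brownian_increment_measurable s t : 0 <= s -> s <= t -> t <= T ->
  measurable_fun [set: Omega] (fun w => B t w - B s w).
Proof.
move=> s0 st tT; apply: measurable_funB; apply: brownian_measurable => //.
- exact: le_trans st.
- exact: le_trans tT.
Qed.

Lemma brownian_step s t (X a : Omega -> R) (q : R) :
  0 <= s -> s < t -> t <= T -> adapted_to (F s) X -> adapted_to (F s) a ->
  (\int[P]_w ((X w + a w * (B t w - B s w)
      + q * ((B t w - B s w) ^+ 2 - (t - s))) ^+ 2)%:E <=
   \int[P]_w (X w ^+ 2)%:E + (2 * (t - s))%:E * \int[P]_w (a w ^+ 2)%:E
   + (130 * q ^+ 2 * (t - s) ^+ 2)%:E)%E.
Proof.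
move=> s0 st tT aX aa; have sT := ltW (lt_le_trans st tT).
have ts : 0 < t - s by rewrite subr_gt0.
have sq0 : 0 < Num.sqrt (t - s) by rewrite sqrtr_gt0.
have [_ _ _ /(_ s t s0 st tT)[ind law]] := hB.
have := martingale_step (filtration_sigma s0 sT) (filtration_measurable s0 sT)
  sq0 (brownian_increment_measurable s0 (ltW st) tT) ind law q aX aa.
have -> : Num.sqrt (t - s) ^+ 4 = (t - s) ^+ 2.
  by rewrite -[4%N]/(2 * 2)%N exprM sqr_sqrtr// ltW.
by rewrite sqr_sqrtr ?(ltW ts).
Qed.

Lemma quadratic_sum_adapted s t p : 0 <= s -> t <= T -> itv_partition s t p ->
  adapted_to (F t) (fun w => partition_sum s p
    (fun u v => (B v w - B u w) ^+ 2 - (v - u))).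
Proof.
elim/last_ind: p t => [|p v ih] t s0 tT.
  move=> _; rewrite (_ : (fun w => _) = cst 0); last first.
    by apply/funext => w; rewrite partition_sum_nil.
  exact: measurable_cst.
move=> /itv_partition_rconsP[-> sp pt].
have su := itv_partition_le sp; have u0 := le_trans s0 su.
rewrite (_ : (fun w => _) = fun w => partition_sum s p
    (fun u v => (B v w - B u w) ^+ 2 - (v - u)) +
   ((B t w - B (last s p) w) ^+ 2 - (t - last s p))); last first.
  by apply/funext => w; rewrite -cats1 partition_sum_cat partition_sum1.
apply: measurable_funD.
  apply: (filtration_adapted u0 (ltW pt) tT); apply: ih => //.
  exact: le_trans (ltW pt) tT.
apply: measurable_funB => //; apply: measurable_funX; apply: measurable_funB.
  by apply: brownian_adapted => //; exact: le_trans (ltW pt).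
by apply: brownian_adapted => //; exact: ltW.
Qed.

(** Induction on the last cell: the sum over the earlier cells is known at its left end, so
    [brownian_step] with [a = 0] and [q = 1] adds just one new term. *)
Lemma quadratic_sum_moment s t p : 0 <= s -> t <= T -> itv_partition s t p ->
  (\int[P]_w ((partition_sum s p
    (fun u v => (B v w - B u w) ^+ 2 - (v - u))) ^+ 2)%:E
   <= (130 * partition_sum s p (fun u v => (v - u) ^+ 2))%:E)%E.
Proof.
elim/last_ind: p t => [|p v ih] t s0 tT.
  move=> _; rewrite partition_sum_nil mulr0.
  under eq_integral do rewrite partition_sum_nil expr0n/=.
  by rewrite integral0.
move=> /itv_partition_rconsP[-> sp pt].
have su := itv_partition_le sp; have u0 := le_trans s0 su.
set S := fun w => partition_sum s p (fun u v => (B v w - B u w) ^+ 2 - (v - u)).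
have uT : last s p <= T by exact: le_trans (ltW pt) tT.
have aS : adapted_to (F (last s p)) S by exact: quadratic_sum_adapted.
have a0 : adapted_to (F (last s p)) (cst 0 : Omega -> R) by exact: measurable_cst.
rewrite (_ : (fun w => _) = fun w => ((S w + cst 0 w * (B t w - B (last s p) w) +
   1 * ((B t w - B (last s p) w) ^+ 2 - (t - last s p))) ^+ 2)%:E); last first.
  apply/funext => w; rewrite -cats1 partition_sum_cat partition_sum1 /S/=.
  by rewrite mul0r addr0 mul1r.
apply: (le_trans (brownian_step 1 u0 pt tT aS a0)).
rewrite -cats1 partition_sum_cat partition_sum1 (mulrDr 130) (EFinD (130 * _)) expr1n mulr1.
apply: leeD => //.
under [X in (_ + _ * X)%E]eq_integral do rewrite /= expr0n/=.
by rewrite integral0 mule0 adde0; exact: (ih _ s0 uT sp).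
Qed.

End brownian.

(** * From moment bounds to almost sure identities *)

Section markov.
Context {R : realType} {d : measure_display} {Omega : measurableType d}.
Variable P : probability Omega R.
Implicit Types (f D : Omega -> R) (a c eps eta : R).

Lemma measurable_superlevel f a : measurable_fun [set: Omega] f ->
  measurable [set w | a <= f w].
Proof.
move=> mf; have := mf measurableT `[a, +oo[%classic (measurable_itv _).
rewrite setTI; congr (measurable _); apply/seteqP; split => w /=;
  by rewrite in_itv/= andbT.
Qed.

Lemma markov_le f a c : measurable_fun [set: Omega] f -> (forall w, 0 <= f w) ->
  0 < a -> (\int[P]_w (f w)%:E <= c%:E)%E ->
  (P [set w | (a <= f w)%R] <= (c / a)%:E)%E.
Proof.
move=> mf f0 a0 fc.
have mA := measurable_superlevel a mf.
have h : (a%:E * P [set w | (a <= f w)%R] <= c%:E)%E.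
  apply: le_trans fc; rewrite -integral_cst//.
  apply: (@le_trans _ _ (\int[P]_(w in [set w | (a <= f w)%R]) (f w)%:E)%E).
    apply: ge0_le_integral => //.
    - by move=> w _; rewrite lee_fin ltW.
    - by apply/measurable_EFinP; exact: measurable_funTS.
  apply: ge0_subset_integral => //; first exact/measurable_EFinP.
  by move=> w _; rewrite lee_fin.
move: h; have : P [set w | (a <= f w)%R] \is a fin_num by exact: fin_num_measure.
move: (P _) => [r| |]// _; rewrite -EFinM !lee_fin => h.
by rewrite ler_pdivlMr// mulrC.
Qed.

Lemma markov_square D eps c : measurable_fun [set: Omega] D -> 0 < eps ->
  (\int[P]_w (D w ^+ 2)%:E <= c%:E)%E ->
  (P [set w | (eps <= `|D w|)%R] <= (c / eps ^+ 2)%:E)%E.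
Proof.
move=> mD e0 Dc.
have -> : [set w | (eps <= `|D w|)%R] = [set w | (eps ^+ 2 <= D w ^+ 2)%R].
  apply/seteqP; split => w /=; rewrite -(@real_normK _ (D w)) ?num_real//;
    by rewrite ler_pXn2r// nnegrE// ltW.
apply: markov_le => //; first exact: measurable_funX.
  by move=> w; exact: sqr_ge0.
by rewrite exprn_gt0.
Qed.

Lemma ae_zero D : measurable_fun [set: Omega] D ->
  (forall eps eta, 0 < eps -> 0 < eta ->
    (P [set w | (eps <= `|D w|)%R] <= eta%:E)%E) ->
  {ae P, forall w, D w = 0}.
Proof.
move=> mD small.
have mabs : measurable_fun [set: Omega] (fun w => `|D w|).
  exact: measurableT_comp.
apply: (@negligibleS _ _ _ P (\bigcup_k [set w | (k.+1%:R^-1 <= `|D w|)%R])).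
  move=> w /= /eqP Dw; have D0 : 0 < `|D w| by rewrite normr_gt0.
  exists (Num.truncn `|D w|^-1) => //=.
  rewrite -[leRHS]invrK lef_pV2 ?posrE ?invr_gt0 ?ltr0n//.
  by rewrite ltW// truncnS_gt.
apply: negligible_bigcup => k; apply/negligibleP.
  exact: measurable_superlevel.
apply/eqP; rewrite eq_le measure_ge0 andbT.
apply/lee_addgt0Pr => eta eta0; rewrite add0e; exact: small.
Qed.

Lemma ae_zero_of_square D : measurable_fun [set: Omega] D ->
  (forall eta, 0 < eta -> (\int[P]_w (D w ^+ 2)%:E <= eta%:E)%E) ->
  {ae P, forall w, D w = 0}.
Proof.
move=> mD small; apply: ae_zero => // eps eta e0 eta0.
have -> : eta = (eta * eps ^+ 2) / eps ^+ 2 by rewrite mulfK// gt_eqF// exprn_gt0.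
by apply: markov_square => //; apply: small; rewrite mulr_gt0// exprn_gt0.
Qed.

End markov.

Section quadratic_variation.
Context {R : realType} {d : measure_display} {Omega : measurableType d}.
Variables (P : probability Omega R) (T : R) (F : R -> set (set Omega))
  (B : R -> Omega -> R).
Hypotheses (T0 : 0 < T) (hF : complete_filtration P T F)
  (hB : brownian_motion P T F B).
Implicit Types (s t u v eps delta : R) (p : seq R).

(** Along fine partitions the sums are close in probability to [Q] by definition, and to [t - s] by
    the moment bound. Shifting the integrand by [B s] leaves its increments unchanged. *)
Lemma quadratic_covariation_brownian s t (Q : Omega -> R) :
  0 <= s -> s <= t -> t <= T ->
  is_quadratic_covariation P s t (fun r w => B r w - B s w) B Q ->
  {ae P, forall w, Q w = t - s}.
Proof.
move=> s0 st tT [mQ hQ].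
suff : {ae P, forall w, Q w - (t - s) = 0}.
  by apply: filterS => w /eqP; rewrite subr_eq0 => /eqP.
have mD : measurable_fun [set: Omega] (fun w => Q w - (t - s)).
  exact: measurable_funB.
apply: ae_zero => // eps eta e0 eta0.
have e2 : 0 < eps / 2 by rewrite divr_gt0.
have eta2 : 0 < eta / 2 by rewrite divr_gt0.
have [d1 d10 hd1] := hQ _ _ e2 eta2.
(* The squared cell lengths sum to at most [d2 * (t - s)]; this choice makes the Chebyshev bound for
   [S] equal to [eta / 2]. *)
pose d2 := eta / 2 * (eps / 2) ^+ 2 / (130 * (t - s + 1)).
have ts1 : 0 < t - s + 1 by rewrite ltr_wpDl// subr_ge0.
have d20 : 0 < d2 by rewrite divr_gt0 ?mulr_gt0 ?exprn_gt0.
have delta0 : 0 < Num.min d1 d2 by rewrite lt_min d10.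
have [p pt pm] := fine_partition st delta0.
pose S w := partition_sum s p (fun u v => (B v w - B u w) ^+ 2 - (v - u)).
have aS := quadratic_sum_adapted hF hB s0 tT pt.
have t0 := le_trans s0 st.
have mS : measurable_fun [set: Omega] S.
  exact: (adapted_to_measurable (filtration_sigma hF t0 tT)
    (filtration_measurable hF t0 tT)).
have mesh2 : partition_sum s p (fun u v => (v - u) ^+ 2) <= d2 * (t - s).
  have := partition_sum_close (eps := d2) (F := fun u v => (v - u) ^+ 2)
    (G := fun _ _ => 0) pt pm delta0.
  rewrite [partition_sum s p (fun _ _ => 0)]big1// subr0 => h.
  apply: le_trans (ler_norm _) (h _) => u v su uv vt.
  rewrite lt_min => /andP[_ vd].
  by rewrite subr0 ger0_norm ?sqr_ge0// expr2 ler_wpM2r ?subr_ge0 ?(ltW uv) ?(ltW vd).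
have mom : (\int[P]_w (S w ^+ 2)%:E <= (eta / 2 * (eps / 2) ^+ 2)%:E)%E.
  apply: (le_trans (quadratic_sum_moment hF hB s0 tT pt)); rewrite lee_fin.
  rewrite (@le_trans _ _ (130 * (d2 * (t - s))))//; first by rewrite ler_wpM2l.
  have -> : eta / 2 * (eps / 2) ^+ 2 = 130 * (d2 * (t - s + 1)).
    by rewrite /d2; field; rewrite gt_eqF.
  by rewrite ler_wpM2l// ler_wpM2l ?(ltW d20)// lerDl.
have hS := markov_square mS e2 mom.
rewrite mulfK ?gt_eqF ?exprn_gt0// in hS.
have pm1 : mesh s p < d1 by rewrite (lt_le_trans pm)// ge_min lexx.
have {}hd1 := hd1 p pt pm1.
pose D1 w := partition_sum s p (fun u v =>
  (B v w - B s w - (B u w - B s w)) * (B v w - B u w)) - Q w.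
have D1E w : D1 w = S w + (t - s) - Q w.
  rewrite /D1 /S; congr (_ - _).
  have -> : t - s = partition_sum s p (fun u v => v - u).
    rewrite (partition_sum_telescope s p id).
    by have -> : last s p = t by case: pt => _ /eqP.
  rewrite /partition_sum -big_split/=; apply: eq_bigr => c _.
  by ring.
have mD1 : measurable_fun [set: Omega] D1.
  rewrite (_ : D1 = fun w => S w + (t - s) - Q w); last exact/funext.
  by apply: measurable_funB => //; exact: measurable_funD.
rewrite (splitr eta) EFinD.
apply: (@le_trans _ _ (P ([set w | (eps / 2 <= `|S w|)%R] `|`
   [set w | (eps / 2 <= `|D1 w|)%R]))).
  apply: le_measure; rewrite ?inE.
  - by apply: measurable_superlevel; exact: measurableT_comp.
  - by apply: measurableU; apply: measurable_superlevel; exact: measurableT_comp.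
  move=> w /= ew; apply/orP; rewrite -implyNb; apply/implyP; rewrite -ltNge => lt.
  have -> : D1 w = S w - (Q w - (t - s)) by rewrite D1E; ring.
  have := lerB_dist (Q w - (t - s)) (S w); rewrite distrC; lra.
apply: (le_trans (measureU2 _ _ _)).
- by apply: measurable_superlevel; exact: measurableT_comp.
- by apply: measurable_superlevel; exact: measurableT_comp.
exact: leeD.
Qed.

End quadratic_variation.

Lemma clamp_continuous_within {R : realType} (T : R) (f : R -> R) : 0 <= T ->
  {within `[0, T], continuous f} -> continuous (f \o clamp T).
Proof.
move=> T0 /subspace_continuousP cf x.
have inT y : `[0, T]%classic (clamp T y).
  by rewrite /= in_itv/=; have [-> ->] := clamp_itv y T0.
apply/cvgrPdist_lt => eps e0.
have := cf _ (inT x) => /cvgrPdist_lt/(_ _ e0).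
rewrite near_withinE => /nbhs_ballP[delta /= d0 hd].
apply/nbhs_ballP; exists delta => // y xy; apply: hd; last exact: inT.
exact: le_lt_trans (clamp_lip _ _ _) xy.
Qed.

Lemma grid_cvg {R : realType} (T r : R) : 0 < T -> 0 <= r ->
  (Num.truncn (r * m.+1%:R / T))%:R * T / m.+1%:R @[m --> \oo] --> r.
Proof.
move=> T0 r0; apply/cvgrPdist_le => eps e0.
have : (T / m.+1%:R) @[m --> \oo] --> (0 : R).
  by rewrite -(mulr0 T); apply: cvgM; [exact: cvg_cst|exact: cvg_harmonic].
move=> /cvgrPdist_lt/(_ _ e0); apply: filterS => m; rewrite sub0r normrN => hm.
have Tm : 0 < T / m.+1%:R by rewrite divr_gt0.
rewrite (le_trans _ (ltW hm))// (gtr0_norm Tm).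
have q0 : 0 <= r * m.+1%:R / T by rewrite divr_ge0 ?mulr_ge0// ltW.
have /andP[h1 h2] := truncn_itv q0.
set j : R := (Num.truncn (r * m.+1%:R / T))%:R in h1 *.
have e : r = r * m.+1%:R / T * (T / m.+1%:R).
  by rewrite mulrA divfK ?gt_eqF// mulfK// pnatr_eq0.
have h3 : j * (T / m.+1%:R) <= r by rewrite [leRHS]e ler_wpM2r// ltW.
have h4 : r <= (j + 1) * (T / m.+1%:R).
  by rewrite [leLHS]e ler_wpM2r ?(ltW Tm)// natr1 ltW.
rewrite -[j * T / _]mulrA ler_norml; rewrite mulrDl mul1r in h4.
set x := T / _ in h3 h4 Tm *.
move: (j * x) h3 h4 Tm => y h3 h4 Tm {e h1 h2 hm q0 e0}.
by apply/andP; split; lra.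
Qed.

Section joint_measurability.
Context {R : realType} {d : measure_display} {Omega : measurableType d}.

Lemma measurable_fun_indexed (f : nat -> Omega -> R) (k : R -> nat) :
  (forall j, measurable_fun [set: Omega] (f j)) ->
  (forall j, measurable (k @^-1` [set j])) ->
  measurable_fun [set: Omega * R] (fun z => f (k z.2) z.1).
Proof.
move=> mf mk _ A mA; rewrite setTI.
rewrite (_ : _ @^-1` A = \bigcup_j ((f j @^-1` A) `*` (k @^-1` [set j]))).
  apply: bigcup_measurable => j _; apply: measurableX => //.
  by have := mf j measurableT A mA; rewrite setTI.
apply/seteqP; split => [z Az|z [j _ [/= Aj kj]] /=]; last by rewrite kj.
by exists (k z.2).
Qed.

Lemma measurable_truncn_preimage (q : R -> R) j : continuous q ->
  (forall r, 0 <= q r) -> measurable ((fun r => Num.truncn (q r)) @^-1` [set j]).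
Proof.
move=> cq q0; have mq : measurable_fun [set: R] q by exact: continuous_measurable_fun.
have := mq measurableT `[j%:R, j.+1%:R[%classic (measurable_itv _).
rewrite setTI; congr (measurable _); apply/seteqP; split => r /=; rewrite in_itv/=.
  by move=> /andP[h1 h2]; apply/eqP; rewrite eqn_leq truncn_le_nat h2/= truncn_ge_nat.
by move=> <-; exact: truncn_itv.
Qed.

(** On [G] the path is the limit of its values at the grid points just below each time, and these
    step processes are jointly measurable. Killing the process off [G] makes the convergence hold
    everywhere. *)
Lemma jointly_measurable_modification (T : R) (B : R -> Omega -> R) (G : set Omega) :
  0 < T -> measurable G ->
  (forall t, 0 <= t -> t <= T -> measurable_fun [set: Omega] (B t)) ->
  (forall w, G w -> {within `[0, T], continuous (fun t => B t w)}) ->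
  measurable_fun [set: Omega * R] (fun z => B (clamp T z.2) z.1 * \1_G z.1).
Proof.
move=> T0 mG mB cB.
pose k m r := Num.truncn (clamp T r * m.+1%:R / T).
have q0 m r : 0 <= clamp T r * m.+1%:R / T.
  by have [? _] := clamp_itv r (ltW T0); rewrite divr_ge0 ?mulr_ge0// ltW.
have ccl : continuous (clamp T).
  apply: unif_cont_continuous; apply: (@lipschitz_unif_cont _ _ 1) => x y.
  by rewrite mul1r clamp_lip.
pose f m (z : Omega * R) := B (clamp T ((k m z.2)%:R * T / m.+1%:R)) z.1 * \1_G z.1.
have mind : measurable_fun [set: Omega * R] (fun z => \1_G z.1 : R).
  by apply: (measurableT_comp (f := \1_G : Omega -> R)) measurable_fst.
have mf m : measurable_fun [set: Omega * R] (f m).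
  apply: measurable_funM => //.
  apply: (@measurable_fun_indexed (fun j => B (clamp T (j%:R * T / m.+1%:R))) (k m)).
    by move=> j; apply: mB; have [] := clamp_itv (j%:R * T / m.+1%:R) (ltW T0).
  move=> j; apply: measurable_truncn_preimage => // r.
  by apply: cvgM; [apply: cvgM; [exact: ccl|exact: cvg_cst]|exact: cvg_cst].
apply: (measurable_fun_cvg mf) => -[w r] _ /=; rewrite /f/=.
have [Gw|nGw] := pselect (G w); last first.
  rewrite indicE memNset// mulr0; under eq_cvg do rewrite mulr0; exact: cvg_cst.
rewrite indicE mem_set// mulr1; under eq_cvg do rewrite mulr1.
have cBc := clamp_continuous_within (ltW T0) (cB w Gw).
have -> : B (clamp T r) w = ((fun t => B t w) \o clamp T) (clamp T r).
  by rewrite /= (clamp_id (t := clamp T r))//; have [] := clamp_itv r (ltW T0).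
apply: (@continuous_cvg _ _ _ \oo _ (fun m => (k m r)%:R * T / m.+1%:R)
  ((fun t => B t w) \o clamp T) (clamp T r) (cBc _)).
by apply: grid_cvg => //; have [] := clamp_itv r (ltW T0).
Qed.

End joint_measurability.

(** * The lifts of Brownian motion *)

Lemma itv_partition_nodes {R : realType} (s t : R) (p : seq R) :
  itv_partition s t p ->
  [/\ forall i, (i < size p)%N -> (s :: p)`_i < (s :: p)`_i.+1,
      (s :: p)`_(size p) = t &
      forall i j, (i <= j)%N -> (j <= size p)%N -> (s :: p)`_i <= (s :: p)`_j].
Proof.
move=> [/(pathP 0) sp /eqP lt]; split.
- by move=> i ip; exact: sp.
- by rewrite -lt (last_nth 0).
- move=> i; elim=> [|j ih]; first by rewrite leqn0 => /eqP ->.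
  rewrite leq_eqVlt => /predU1P[-> //|ij jp].
  by rewrite (le_trans (ih ij (ltnW jp)))// ltW// sp.
Qed.

Section ito.
Context {R : realType} {d : measure_display} {Omega : measurableType d}.
Variables (P : probability Omega R) (T : R) (F : R -> set (set Omega))
  (B : R -> Omega -> R).
Hypotheses (T0 : 0 < T) (hF : complete_filtration P T F)
  (hB : brownian_motion P T F B).
Variables (s t : R).
Hypotheses (s0 : 0 <= s) (st : s <= t) (tT : t <= T).

(** The closed form, by the Itô formula, of the integral of [B - B s] from [s] to [r]. *)
Let M r w := ((B r w - B s w) ^+ 2 - (r - s)) / 2.

Lemma brownian_square_shift u r (a : Omega -> R) : 0 <= u -> u < r -> r <= T ->
  adapted_to (F u) a ->
  (\int[P]_w ((a w - (B r w - B u w)) ^+ 2)%:E =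
   \int[P]_w (a w ^+ 2)%:E + (r - u)%:E)%E.
Proof.
move=> u0 ur rT aa; have uT := ltW (lt_le_trans ur rT).
have ru : 0 < r - u by rewrite subr_gt0.
have sq0 : 0 < Num.sqrt (r - u) by rewrite sqrtr_gt0.
have [_ _ _ /(_ u r u0 ur rT)[ind law]] := hB.
have sF := filtration_sigma hF u0 uT.
have ma := adapted_to_measurable sF (filtration_measurable hF u0 uT) aa.
pose Phi (z : R * R) := ((z.1 - z.2) ^+ 2)%:E.
have mPhi : measurable_fun [set: R * R] Phi.
  apply/measurable_EFinP/measurable_funX; apply: measurable_funB.
    exact: measurable_fst.
  exact: measurable_snd.
have mi := brownian_increment_measurable hF hB u0 (ltW ur) rT.
have -> : (\int[P]_w ((a w - (B r w - B u w)) ^+ 2)%:E =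
  \int[P]_w Phi (a w, (B r w - B u w)%R))%E by [].
rewrite (freezing mi ma ind law _ mPhi)//; first last.
- by move=> z; rewrite lee_fin sqr_ge0.
- exact/(adapted_toP _ sF).
have [m4 _ mE] := normal_polynomial sq0.
have -> : (r - u)%:E = (\int[P]_w (cst (r - u)%:E) w)%E.
  by rewrite integral_cst//= (@probability_setT _ _ _ P) mule1.
rewrite -ge0_integralD//; first last.
- by move=> w _; rewrite lee_fin ltW.
- exact/measurable_EFinP/measurable_funX.
- by move=> w _; rewrite lee_fin sqr_ge0.
apply: eq_integral => w _.
have := mE (a w ^+ 2 + (r - u)) (- (2 * a w)) 1 0.
rewrite mul0r addr0 -EFinD => <-; apply: eq_integral => x _.
by rewrite /Phi/= sqr_sqrtr ?(ltW ru)//; congr EFin; ring.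
Qed.

Section one_integrand.
Variables (p : seq R) (xi : nat -> Omega -> R).
Hypothesis hxi : simple_integrand F s t p xi.

Local Notation u i := ((s :: p)`_i).

Let u_lt i : (i < size p)%N -> u i < u i.+1.
Proof. by move=> ip; have [/itv_partition_nodes[+ _ _] _] := hxi; exact. Qed.

Let u_size : u (size p) = t.
Proof. by have [/itv_partition_nodes[_ + _] _] := hxi. Qed.

Let u_le i j : (i <= j)%N -> (j <= size p)%N -> u i <= u j.
Proof. by have [/itv_partition_nodes[_ _ +] _] := hxi; apply. Qed.

Let u_ge i : (i <= size p)%N -> s <= u i.
Proof. by move=> ip; apply: (@u_le 0%N i). Qed.

Let u_leT i : (i <= size p)%N -> u i <= T.
Proof. by move=> ip; apply: le_trans tT; rewrite -u_size; exact: u_le. Qed.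

Let u_ge0 i : (i <= size p)%N -> 0 <= u i.
Proof. by move=> ip; rewrite (le_trans s0)// u_ge. Qed.

Let xi_adapted i : (i < size p)%N -> adapted_to (F (u i)) (xi i).
Proof.
move=> ip; have [_ /(_ i ip)[mxi _]] := hxi.
apply/(adapted_toP _ (filtration_sigma hF (u_ge0 (ltnW ip)) (u_leT (ltnW ip)))).
exact: mxi.
Qed.

(** The error of the simple integrand at the left end of cell [i]. *)
Let a i w := xi i w - (B (u i) w - B s w).
Let dt i := u i.+1 - u i.
Let S k w := \sum_(i < k) xi i w * (B (u i.+1) w - B (u i) w).

Let B_adapted r i : 0 <= r -> r <= u i -> (i <= size p)%N ->
  adapted_to (F (u i)) (B r).
Proof. by move=> r0 ri ip; apply: (brownian_adapted hF hB) => //; exact: u_leT. Qed.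

Let a_adapted i : (i < size p)%N -> adapted_to (F (u i)) (a i).
Proof.
move=> ip; apply: measurable_funB; first exact: xi_adapted.
by apply: measurable_funB; apply: B_adapted; rewrite ?u_ge0 ?u_ge// ltnW.
Qed.

Let S_adapted k : (k <= size p)%N -> adapted_to (F (u k)) (S k).
Proof.
move=> kp; apply: measurable_sum => i.
have ip : (i < size p)%N by exact: leq_trans (ltn_ord i) kp.
have ik : u i <= u k by rewrite u_le// ltnW.
have iSk : u i.+1 <= u k by rewrite u_le.
apply: measurable_funM.
  apply: (filtration_adapted hF (u_ge0 (ltnW ip)) ik (u_leT kp)).
  exact: xi_adapted.
by apply: measurable_funB; apply: B_adapted => //; rewrite u_ge0// ltnW.
Qed.

Let M_adapted k : (k <= size p)%N -> adapted_to (F (u k)) (M (u k)).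
Proof.
move=> kp; apply: measurable_funM => //; apply: measurable_funB => //.
apply: measurable_funX; apply: measurable_funB; apply: B_adapted => //.
- exact: u_ge0.
- exact: u_ge.
Qed.

(** Over a cell [S - M] grows by [a * dB - (dB ^ 2 - dt) / 2], which is [brownian_step] with
    [q = - 1 / 2]. *)
Let upper k : (k <= size p)%N ->
  (\int[P]_w ((S k w - M (u k) w) ^+ 2)%:E <=
   \sum_(i < k) ((2 * dt i)%:E * \int[P]_w (a i w ^+ 2)%:E
     + (130 * dt i ^+ 2 / 4)%:E))%E.
Proof.
elim: k => [|k ih] kp.
  rewrite big_ord0; under eq_integral do
    rewrite /S big_ord0 /M /= !subrr expr0n/= subr0 mul0r subr0 expr0n/=.
  by rewrite integral0.
have kp' := ltnW kp.
have aX : adapted_to (F (u k)) (fun w => S k w - M (u k) w).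
  by apply: measurable_funB; [exact: S_adapted|exact: M_adapted].
have := brownian_step hF hB (- 2^-1) (u_ge0 kp') (u_lt kp) (u_leT kp) aX
  (a_adapted kp).
rewrite (_ : (fun w => _) = fun w => ((S k.+1 w - M (u k.+1) w) ^+ 2)%:E); last first.
  by apply/funext => w; congr EFin; rewrite /S big_ord_recr /= /M /a; field.
move=> /le_trans; apply; rewrite big_ord_recr/= -addeA.
apply: leeD; first exact: ih.
by rewrite -/(dt k) sqrrN exprVn (_ : 130 / 2 ^+ 2 * _ = 130 * dt k ^+ 2 / 4)//; field.
Qed.

Let N_good : exists2 G : set Omega, measurable G /\ P.-negligible (~` G) &
  forall w, G w -> {within `[0, T], continuous (fun r => B r w)}.
Proof.
have [_ _ [N [mN N0 hN]] _] := hB.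
exists (~` N); first split; first exact: measurableC.
  by rewrite setCK; apply/negligibleP.
by move=> w Nw; apply: contrapT => nc; apply/Nw/hN.
Qed.

Let simple_cell i r w : (i < size p)%N -> u i < r -> r <= u i.+1 ->
  simple_process s p xi r w = xi i w.
Proof.
move=> ip ur ru; rewrite /simple_process (bigD1 (Ordinal ip))//=.
rewrite indicE mem_set ?mulr1; last by rewrite /= in_itv/= ur.
rewrite big1 ?addr0// => j /eqP ji; rewrite indicE memNset ?mulr0//=.
rewrite in_itv/= => /andP[h1 h2]; apply: ji; apply/val_inj => /=.
apply/eqP; rewrite eqn_leq; apply/andP; split; rewrite leqNgt; apply/negP => lt.
  have := lt_le_trans h1 ru; rewrite ltNge => /negP; apply.
  by apply: u_le => //; exact: ltnW.
have := lt_le_trans ur h2; rewrite ltNge => /negP; apply.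
by apply: (@u_le j.+1 i) => //; exact: ltnW.
Qed.

Let measurable_simple : measurable_fun [set: Omega * R]
  (fun z => simple_process s p xi z.2 z.1).
Proof.
apply: measurable_sum => i; apply: measurable_funM.
  have mxi : measurable_fun [set: Omega] (xi i).
    apply: (adapted_to_measurable _ _ (xi_adapted (ltn_ord i))).
    + by apply: (filtration_sigma hF); [exact: u_ge0 (ltnW _)|exact: u_leT (ltnW _)].
    + by apply: (filtration_measurable hF); [exact: u_ge0 (ltnW _)|exact: u_leT (ltnW _)].
  exact: (measurableT_comp mxi measurable_fst).
apply: (measurableT_comp (f := \1_`](s :: p)`_i, p`_i] : R -> R)) measurable_snd.
exact: measurable_indic.
Qed.

(** The integral of [r - x] is bounded below by its right half, where [r - x >= (y - x) / 2]; hence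
    the constant 1 / 4. *)
Let cell_integral (c : \bar R) (x y : R) : (0 <= c)%E -> x < y ->
  (c * (y - x)%:E + ((y - x) ^+ 2 / 4)%:E <=
   \int[lebesgue_measure]_(r in `]x, y]) (c + (r - x)%:E))%E.
Proof.
move=> c0 xy.
have mc : measurable_fun `]x, y] (fun r : R => (r - x)%:E).
  by apply/measurable_EFinP; exact: measurable_funB.
have r0 r : `]x, y]%classic r -> (0 <= (r - x)%:E)%E.
  by rewrite /= in_itv/= lee_fin subr_ge0 => /andP[/ltW].
rewrite ge0_integralD//.
rewrite integral_cst//= lebesgue_measure_itv/= lte_fin xy -EFinD leeD2l//.
pose m := (x + y) / 2.
apply: (@le_trans _ _ (\int[lebesgue_measure]_(r in `]x, y] `&` `]m, y])
   ((y - x) / 2)%:E)%E).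
  rewrite integral_cst//; last exact: measurableI.
  have -> : (`]x, y] `&` `]m, y] = `]m, y])%classic.
    apply/seteqP; split => r /=; first by case.
    rewrite !in_itv/= => /andP[mr ry]; rewrite mr ry; split => //.
    by rewrite andbT (lt_trans _ mr)// /m; lra.
  rewrite /= lebesgue_measure_itv/= lte_fin ifT; last by rewrite /m; lra.
  by rewrite -EFinD -EFinM lee_fin /m; lra.
apply: (@le_trans _ _ (\int[lebesgue_measure]_(r in `]x, y] `&` `]m, y])
   (r - x)%:E)%E).
  apply: ge0_le_integral => //.
  - exact: measurableI.
  - by move=> r _; rewrite lee_fin; lra.
  - by apply: measurable_funS mc => //; exact: subIsetl.
  - by move=> r [_]; rewrite /= in_itv/= lee_fin /m => /andP[? _]; lra.
by apply: ge0_subset_integral => //; exact: measurableI.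
Qed.

Let DI := (\int[P]_w \int[lebesgue_measure]_(r in `[s, t])
   ((simple_process s p xi r w - (B r w - B s w)) ^+ 2)%:E)%E.

(** At a time [r] of cell [i] the mean square error is that of [a i] plus [r - u i], and Tonelli
    sums this over time. To apply it, [B] is replaced by the jointly measurable [Bj], equal to it
    almost surely; completeness of [P] makes the original inner integral measurable. *)
Let lower :
  (\sum_(i < size p) (\int[P]_w (a i w ^+ 2)%:E * (dt i)%:E
     + ((dt i) ^+ 2 / 4)%:E) <= DI)%E.
Proof.
have [G [mG nG] cG] := N_good.
pose Bj (z : Omega * R) := B (clamp T z.2) z.1 * \1_G z.1.
have mBj : measurable_fun [set: Omega * R] Bj.
  apply: jointly_measurable_modification => // r r0 rT.
  exact: (brownian_measurable hF hB).
pose Psi (z : Omega * R) : \bar R := ((simple_process s p xi z.2 z.1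
   - (Bj z - Bj (z.1, s))) ^+ 2 * \1_`[s, t] z.2)%:E.
have mPsi : measurable_fun [set: Omega * R] Psi.
  apply/measurable_EFinP; apply: measurable_funM.
    apply: measurable_funX; apply: measurable_funB => //.
    apply: measurable_funB => //.
    apply: (measurableT_comp mBj (f := Bj)).
    by apply: measurable_fun_pair; [exact: measurable_fst|exact: measurable_cst].
  apply: (measurableT_comp (f := \1_`[s, t] : R -> R)) measurable_snd.
  exact: measurable_indic.
have Psi0 z : (0 <= Psi z)%E by rewrite lee_fin mulr_ge0 ?sqr_ge0.
have BjE r w : G w -> s <= r -> r <= t -> Bj (w, r) = B r w.
  move=> Gw sr rt; rewrite /Bj/= indicE mem_set// mulr1 clamp_id//.
  - exact: le_trans sr.
  - exact: le_trans tT.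
have PsiE r w : G w -> `[s, t]%classic r ->
    Psi (w, r) = ((simple_process s p xi r w - (B r w - B s w)) ^+ 2)%:E.
  move=> Gw; rewrite /= in_itv/= => rst; have /andP[sr rt] := rst.
  by rewrite /Psi/= indicE mem_set/= ?in_itv//= mulr1 !BjE.
have DIE : DI = (\int[P]_w \int[lebesgue_measure]_r Psi (w, r))%E.
  have ae : ae_eq P [set: Omega] (fun w => \int[lebesgue_measure]_r Psi (w, r))%E
     (fun w => \int[lebesgue_measure]_(r in `[s, t])
       ((simple_process s p xi r w - (B r w - B s w)) ^+ 2)%:E)%E.
    apply: (@negligibleS _ _ _ P (~` G)) nG => w /= nw Gw; apply: nw => _.
    rewrite [RHS]integral_mkcond; apply: eq_integral => r _.
    rewrite patchE; case: ifPn => [|nr]; first by rewrite inE => /PsiE ->.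
    by rewrite /Psi/= indicE (negbTE nr) mulr0.
  have mL : measurable_fun [set: Omega] (fun w => \int[lebesgue_measure]_r Psi (w, r))%E.
    exact: measurable_fun_fubini_tonelli_F.
  have [_ _ compl _] := hF.
  apply/esym/ae_eq_integral => //.
  exact: (ae_measurable_fun compl ae).
rewrite DIE fubini_tonelli//.
set Gr := fun r : R => (\int[P]_w Psi (w, r))%E.
have mGr : measurable_fun [set: R] Gr by exact: measurable_fun_fubini_tonelli_G.
have Gr0 r : (0 <= Gr r)%E by apply: integral_ge0 => w _; exact: Psi0.
have GrE i r : (i < size p)%N -> u i < r -> r <= u i.+1 ->
    Gr r = (\int[P]_w (a i w ^+ 2)%:E + (r - u i)%:E)%E.
  move=> ip ur ru; have rT := le_trans ru (u_leT ip).
  rewrite -(brownian_square_shift (u_ge0 (ltnW ip)) ur rT (a_adapted ip)).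
  have sr : s <= r := le_trans (u_ge (ltnW ip)) (ltW ur).
  have rt : r <= t by apply: (le_trans ru); rewrite -u_size u_le.
  apply: ae_eq_integral; first exact: measurableT.
  - by apply: (measurableT_comp mPsi); exact: measurable_fun_pair.
  - apply/measurable_EFinP/measurable_funX; apply: measurable_funB.
      apply: (adapted_to_measurable _ _ (a_adapted ip)).
      + by apply: (filtration_sigma hF); [exact: u_ge0 (ltnW _)|exact: u_leT (ltnW _)].
      + by apply: (filtration_measurable hF); [exact: u_ge0 (ltnW _)|exact: u_leT (ltnW _)].
    exact: (brownian_increment_measurable hF hB (u_ge0 (ltnW ip)) (ltW ur) rT).
  - apply: (@negligibleS _ _ _ P (~` G)) nG => w /= nw Gw; apply: nw => _.
    rewrite (PsiE _ _ Gw); last by rewrite /= in_itv/= sr.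
    by rewrite (simple_cell w ip ur ru) /a; congr EFin; ring.
have low k : (k <= size p)%N ->
  (\sum_(i < k) (\int[P]_w (a i w ^+ 2)%:E * (dt i)%:E + ((dt i) ^+ 2 / 4)%:E)
   <= \int[lebesgue_measure]_(r in `]s, u k]) Gr r)%E.
  elim: k => [|k ih] kp.
    by rewrite big_ord0 integral_ge0.
  rewrite big_ord_recr/=.
  have -> : (`]s, p`_k] = `]s, u k] `|` `]u k, p`_k])%classic.
    apply/seteqP; split => r /=; rewrite !in_itv/=.
      by move=> /andP[sr rk]; case: (leP r (u k)) => ?; [left|right]; rewrite ?sr ?rk.
    have h1 := u_ge (ltnW kp); have h2 : u k <= p`_k := ltW (u_lt kp).
    case=> /andP[h3 h4]; first by rewrite h3 (le_trans h4).
    by rewrite h4 (le_lt_trans h1).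
  rewrite ge0_integral_setU; first last.
  - apply/disj_setPS => r [/=]; rewrite !in_itv/= => /andP[_ h1] /andP[h2 _].
    by have := lt_le_trans h2 h1; rewrite ltxx.
  - by move=> r _; exact: Gr0.
  - exact: measurable_funTS.
  - exact: measurable_itv.
  - exact: measurable_itv.
  apply: leeD; first exact: ih (ltnW kp).
  have c0 : (0 <= \int[P]_w (a k w ^+ 2)%:E)%E.
    by apply: integral_ge0 => w _; rewrite lee_fin sqr_ge0.
  apply: (le_trans (cell_integral c0 (u_lt kp))).
  rewrite le_eqVlt; apply/orP; left; apply/eqP; apply: eq_integral => r.
  by rewrite inE/= in_itv/= => /andP[h1 h2]; rewrite (GrE k).
apply: (le_trans (low _ (leqnn _))).
by apply: ge0_subset_integral.
Qed.

(** This stands in for the Itô isometry: every term of [upper] is at most 130 times the matching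
    term of [lower]. *)
Lemma simple_ito_error :
  (\int[P]_w ((simple_ito_integral B s p xi w - M t w) ^+ 2)%:E <= 130%:E * DI)%E.
Proof.
have := upper (leqnn (size p)); rewrite u_size => /le_trans; apply.
apply: (@le_trans _ _ (130%:E * \sum_(i < size p) (\int[P]_w (a i w ^+ 2)%:E * (dt i)%:E
     + ((dt i) ^+ 2 / 4)%:E))%E); last first.
  by apply: lee_wpmul2l; [rewrite lee_fin ler0n|].
have dt0 (i : 'I_(size p)) : 0 <= dt i by rewrite subr_ge0 ltW// u_lt.
have c0 (i : 'I_(size p)) : (0 <= \int[P]_w (a i w ^+ 2)%:E)%E.
  by apply: integral_ge0 => w _; rewrite lee_fin sqr_ge0.
have h1 (i : 'I_(size p)) : (0 <= \int[P]_w (a i w ^+ 2)%:E * (dt i)%:E)%E.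
  by rewrite mule_ge0// lee_fin.
have h2 (i : 'I_(size p)) : (0 <= (dt i ^+ 2 / 4)%:E)%E.
  by rewrite lee_fin divr_ge0 ?sqr_ge0.
rewrite ge0_sume_distrr; last by move=> i _; rewrite adde_ge0.
apply: lee_sum => i _; rewrite (ge0_muleDr _ (h1 i) (h2 i)).
apply: leeD; last first.
  by rewrite -EFinM (_ : 130 * (dt i ^+ 2 / 4) = 130 * dt i ^+ 2 / 4)//; field.
rewrite [leRHS]muleCA muleC lee_wpmul2l// -EFinM lee_fin ler_wpM2r//; lra.
Qed.

Lemma simple_ito_measurable :
  measurable_fun [set: Omega] (simple_ito_integral B s p xi).
Proof.
have sp := leqnn (size p).
exact: (adapted_to_measurable (filtration_sigma hF (u_ge0 sp) (u_leT sp))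
  (filtration_measurable hF (u_ge0 sp) (u_leT sp)) (S_adapted sp)).
Qed.

End one_integrand.

Lemma cvg0e_lt (e : nat -> \bar R) (eta : R) : 0 < eta ->
  e @ \oo --> 0%E -> \forall n \near \oo, (e n < eta%:E)%E.
Proof.
move=> eta0 ce; apply: (ce [set x | (x < eta%:E)%E]).
apply: open_nbhs_nbhs; split; last by rewrite /= lte_fin.
exact: open_ereal_lt_ereal.
Qed.

Lemma ito_integral_brownian (J : Omega -> R) :
  is_ito_integral P F B s t (fun r w => B r w - B s w) J ->
  {ae P, forall w, J w = ((B t w - B s w) ^+ 2 - (t - s)) / 2}.
Proof.
move=> [mJ [p [xi [hxi cvgH cvgJ]]]].
have t0 := le_trans s0 st; have sT := le_trans st tT.
have mM : measurable_fun [set: Omega] (M t).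
  apply: measurable_funM => //; apply: measurable_funB => //.
  exact/measurable_funX/(brownian_increment_measurable hF hB).
suff : {ae P, forall w, J w - M t w = 0}.
  by apply: filterS => w /eqP; rewrite subr_eq0 => /eqP.
apply: ae_zero_of_square => [|eta eta0]; first exact: measurable_funB.
(* Here [520 = 4 * 130]: after [simple_ito_error] both squared errors are at most [eta / 4], and
   [(J - M) ^ 2] is at most twice their sum. *)
have e1 : 0 < eta / 520 by apply: divr_gt0 eta0 _; rewrite ltr0n.
have [n _ /(_ n (leqnn n)) [hn1 hn2]] : \forall n \near \oo,
    (\int[P]_w \int[lebesgue_measure]_(r in `[s, t])
       ((simple_process s (p n) (xi n) r w - (B r w - B s w)) ^+ 2)%:E
     < (eta / 520)%:E)%E /\
    (\int[P]_w ((simple_ito_integral B s (p n) (xi n) w - J w) ^+ 2)%:E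
     < (eta / 520)%:E)%E.
  by apply: filterI; apply: cvg0e_lt.
have mI := simple_ito_measurable (hxi n).
set I := simple_ito_integral _ _ _ _ in hn2 mI.
have hI := simple_ito_error (hxi n); rewrite -/I in hI.
have mIM : measurable_fun [set: Omega] (fun w => ((I w - M t w) ^+ 2)%:E).
  by apply/measurable_EFinP/measurable_funX; exact: measurable_funB.
have mIJ : measurable_fun [set: Omega] (fun w => ((I w - J w) ^+ 2)%:E).
  by apply/measurable_EFinP/measurable_funX; exact: measurable_funB.
have ge0 (g : Omega -> R) w : [set: Omega] w -> (0 <= (g w ^+ 2)%:E)%E.
  by rewrite lee_fin sqr_ge0.
apply: (@le_trans _ _ (2%:E * \int[P]_w ((I w - M t w) ^+ 2)%:E +
   2%:E * \int[P]_w ((I w - J w) ^+ 2)%:E)%E).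
  rewrite -!ge0_integralZl ?lee_fin//; try exact: ge0.
  rewrite -ge0_integralD//; first last.
  - exact: measurable_funeM.
  - by move=> w _; rewrite -EFinM lee_fin mulr_ge0// sqr_ge0.
  - exact: measurable_funeM.
  - by move=> w _; rewrite -EFinM lee_fin mulr_ge0// sqr_ge0.
  apply: ge0_le_integral => //.
  - by move=> w _; rewrite lee_fin sqr_ge0.
  - by apply/measurable_EFinP/measurable_funX; exact: measurable_funB.
  - by apply: emeasurable_funD; exact: measurable_funeM.
  - move=> w _; rewrite -!EFinM -EFinD lee_fin.
    have := sqr_ge0 (I w - M t w + (I w - J w)).
    have -> : (J w - M t w) ^+ 2 = (I w - M t w - (I w - J w)) ^+ 2 by ring.
    by lra.
have -> : eta%:E = (2%:E * (eta / 4)%:E + 2%:E * (eta / 4)%:E)%E.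
  by rewrite -!EFinM -EFinD; congr EFin; field.
apply: leeD; apply: lee_wpmul2l => //.
  apply: (le_trans hI); rewrite (_ : (eta / 4)%:E = (130%:E * (eta / 520)%:E)%E).
    by apply: lee_wpmul2l; [rewrite lee_fin ler0n|exact: ltW].
  by rewrite -EFinM; congr EFin; field.
by apply: (le_trans (ltW hn2)); rewrite lee_fin; lra.
Qed.

End ito.

Section lift.
Context {R : realType} {d : measure_display} {Omega : measurableType d}.
Variables (P : probability Omega R) (T : R) (F : R -> set (set Omega))
  (B : R -> Omega -> R) (BB : R -> R -> Omega -> R).
Hypotheses (T0 : 0 < T) (hF : complete_filtration P T F)
  (hB : brownian_motion P T F B).
Implicit Types (s t c : R).

(** The identity holds almost surely at the countably many pairs of grid points at once; both sides
    are continuous, so it extends to all [s <= t]. *)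
Lemma continuous_version_formula c : continuous_version P T BB ->
  (forall s t, 0 <= s -> s <= t -> t <= T ->
    {ae P, forall w, BB s t w = (B t w - B s w) ^+ 2 / 2 + c * (t - s)}) ->
  {ae P, forall w, forall s t, 0 <= s -> s <= t -> t <= T ->
    BB s t w = (B t w - B s w) ^+ 2 / 2 + c * (t - s)}.
Proof.
move=> cBB aeBB; pose gp (m i : nat) : R := i%:R * T / m.+1%:R.
have gp0 m i : 0 <= gp m i by rewrite /gp divr_ge0// mulr_ge0// ltW.
have gpT m i : (i <= m.+1)%N -> gp m i <= T.
  by move=> im; rewrite /gp ler_pdivrMr// mulrC ler_wpM2l ?ler_nat// ltW.
have gple m i j : (i <= j)%N -> gp m i <= gp m j.
  by move=> ij; rewrite /gp ler_wpM2r ?invr_ge0// ler_wpM2r ?ler_nat// ltW.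
have grid : {ae P, forall w, forall m i j, (i <= j)%N -> (j <= m.+1)%N ->
    BB (gp m i) (gp m j) w = (B (gp m j) w - B (gp m i) w) ^+ 2 / 2
      + c * (gp m j - gp m i)}.
  apply/ae_foralln => m; apply/ae_foralln => i; apply/ae_foralln => j.
  have [/andP[ij jm]|nij] := boolP ((i <= j)%N && (j <= m.+1)%N); last first.
    by apply: aeW => w ij jm; rewrite ij jm in nij.
  have := aeBB _ _ (gp0 m i) (gple m i j ij) (gpT m j jm).
  by apply: filterS => w + _ _; exact.
have [_ _ cB _] := hB.
move: cBB cB grid; apply: filterS3 => w cBB cB grid s t s0 st tT.
have t0 := le_trans s0 st.
pose i m := Num.truncn (s * m.+1%:R / T).
pose j m := Num.truncn (t * m.+1%:R / T).
have ij m : (i m <= j m)%N.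
  by apply: le_truncn; rewrite ler_wpM2r ?invr_ge0 ?(ltW T0)// ler_wpM2r.
have jm m : (j m <= m.+1)%N.
  rewrite /j truncn_le_nat ltr_pdivrMr//.
  rewrite (@le_lt_trans _ _ (T * m.+1%:R))//; first by rewrite ler_wpM2r.
  by rewrite mulrC ltr_pM2r// ltr_nat.
have cs : gp m (i m) @[m --> \oo] --> s by exact: grid_cvg.
have ct : gp m (j m) @[m --> \oo] --> t by exact: grid_cvg.
have lim1 : BB (gp m (i m)) (gp m (j m)) w @[m --> \oo] --> BB s t w.
  move/subspace_continuousP : cBB => /(_ (s, t)) /=.
  move=> /(_ (conj s0 (conj st tT))) cBB A /cBB nA.
  have cst : (gp m (i m), gp m (j m)) @[m --> \oo] --> (s, t) := cvg_pair cs ct.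
  have nA' : \forall m \near \oo, (0 <= gp m (i m) /\ gp m (i m) <= gp m (j m)
      /\ gp m (j m) <= T) -> A (BB (gp m (i m)) (gp m (j m)) w).
    exact: (cst _ _ _ _ nA).
  apply: filterS nA' => m h; apply: h; split; first exact: gp0.
  by split; [exact: gple|exact: gpT].
have cBc := clamp_continuous_within (ltW T0) cB.
have Blim (x : nat -> R) (r : R) : 0 <= r -> r <= T -> (forall m, 0 <= x m) ->
    (forall m, x m <= T) -> x m @[m --> \oo] --> r ->
    B (x m) w @[m --> \oo] --> B r w.
  move=> r0 rT x0 xT xr.
  have -> : B r w = ((fun t => B t w) \o clamp T) r by rewrite /= clamp_id.
  rewrite (_ : (fun m => B (x m) w) = fun m => ((fun t => B t w) \o clamp T) (x m)).
    exact: (@continuous_cvg _ _ _ \oo _ x ((fun t => B t w) \o clamp T) r (cBc _)).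
  by apply/funext => m; rewrite /= clamp_id.
have lim2 : BB (gp m (i m)) (gp m (j m)) w @[m --> \oo] -->
    (B t w - B s w) ^+ 2 / 2 + c * (t - s).
  rewrite (_ : (fun m => _) = fun m => (B (gp m (j m)) w - B (gp m (i m)) w) ^+ 2 / 2
      + c * (gp m (j m) - gp m (i m))); last by apply/funext => m; exact: grid.
  have cBt : B (gp m (j m)) w @[m --> \oo] --> B t w.
    by apply: Blim => // m; exact: gpT.
  have cBs : B (gp m (i m)) w @[m --> \oo] --> B s w.
    apply: Blim => //; first exact: le_trans tT.
    by move=> m; apply: gpT; exact: leq_trans (ij m) (jm m).
  have cD : B (gp m (j m)) w - B (gp m (i m)) w @[m --> \oo] --> B t w - B s w.
    exact: cvgB.
  apply: cvgD; last by apply: cvgM; [exact: cvg_cst|exact: cvgB].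
  by apply: cvgM; [exact: cvgM|exact: cvg_cst].
exact: (cvg_unique (@Rhausdorff R) lim1 lim2).
Qed.

Lemma lift_formula : ito_lift P T F B BB \/ stratonovich_lift P T F B BB ->
  exists c, {ae P, forall w, forall s t, 0 <= s -> s <= t -> t <= T ->
    BB s t w = (B t w - B s w) ^+ 2 / 2 + c * (t - s)}.
Proof.
case=> -[cBB hBB].
- exists (- 2^-1); apply: continuous_version_formula => // s t s0 st tT.
  have := ito_integral_brownian T0 hF hB s0 st tT (hBB s t s0 st tT).
  by apply: filterS => w ->; field.
- exists 0; apply: continuous_version_formula => // s t s0 st tT.
  have [I [Q [hI hQ JE]]] := hBB s t s0 st tT.
  have hI' := ito_integral_brownian T0 hF hB s0 st tT hI.
  have hQ' := quadratic_covariation_brownian hF hB s0 st tT hQ.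
  by move: hI' hQ'; apply: filterS2 => w eI eQ; rewrite JE eI eQ; field.
Qed.

End lift.

(** * Hölder continuity of Brownian paths *)

Section dyadic_holder.
Context {R : realType}.
Variables (T alpha K : R) (W : R -> R).
Implicit Types (s t : R) (n m k : nat).
Hypotheses (T0 : 0 < T) (alpha0 : 0 < alpha) (K0 : 0 <= K).
Hypothesis cW : {within `[0, T], continuous W}.

Let q : R := 2^-1 `^ alpha.
Let pt n k : R := k%:R * T / (2 ^ n)%:R.
Let kk n t := Num.truncn (t * (2 ^ n)%:R / T).

Hypothesis dyadic_increments : forall n k, (k < 2 ^ n)%N ->
  `|W (pt n k.+1) - W (pt n k)| <= K * q ^+ n.

Let q0 : 0 < q. Proof. by rewrite powR_gt0// invr_gt0. Qed.

Let q1 : q < 1.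
Proof.
have -> : 1 = 1 `^ alpha :> R by rewrite powR1.
by rewrite /q gt0_ltr_powR// ?nnegrE ?invr_ge0//; lra.
Qed.

Let qn n : 0 <= q ^+ n. Proof. exact/exprn_ge0/ltW. Qed.

Let pow2 n : 0 < (2 ^ n)%:R :> R. Proof. by rewrite ltr0n expn_gt0. Qed.

Let kk_itv n t : 0 <= t -> (kk n t)%:R <= t * (2 ^ n)%:R / T < (kk n t).+1%:R.
Proof.
by move=> t0; apply: truncn_itv; rewrite divr_ge0 ?(ltW T0)// mulr_ge0.
Qed.

Let kk_le n t : t <= T -> (kk n t <= 2 ^ n)%N.
Proof.
move=> tT; rewrite truncn_le_nat ltr_pdivrMr//.
rewrite (@le_lt_trans _ _ (T * (2 ^ n)%:R))//; first by rewrite ler_wpM2r.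
by rewrite mulrC ltr_pM2r// ltr_nat.
Qed.

(** When the grid is halved, the last grid point below [t] either stays or moves to its right
    neighbour. *)
Let step n t : 0 <= t -> t <= T ->
  `|W (pt n.+1 (kk n.+1 t)) - W (pt n (kk n t))| <= K * q ^+ n.+1.
Proof.
move=> t0 tT; have /andP[h1 h2] := kk_itv n t0; have /andP[h3 h4] := kk_itv n.+1 t0.
have e2 : t * (2 ^ n.+1)%:R / T = 2 * (t * (2 ^ n)%:R / T).
  by rewrite expnS natrM; field; rewrite gt_eqF.
rewrite e2 in h3 h4.
have l1 : (2 * kk n t <= kk n.+1 t)%N.
  by rewrite truncn_ge_nat e2 ?natrM ?ler_pM2l// mulr_ge0// (le_trans _ h1).
have l2 : (kk n.+1 t < 2 * (kk n t).+1)%N.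
  by rewrite -(ltr_nat R) (le_lt_trans h3)// natrM ltr_pM2l.
have -> : pt n (kk n t) = pt n.+1 (2 * kk n t).
  by rewrite /pt expnS !natrM; field; rewrite gt_eqF.
have [eq|ne] := eqVneq (kk n.+1 t) (2 * kk n t)%N.
  by rewrite eq subrr normr0 (mulr_ge0 K0 (qn _)).
have eS : kk n.+1 t = (2 * kk n t).+1.
  apply/eqP; rewrite eqn_leq -ltnS; move: l2; rewrite mulnS => ->.
  by rewrite ltn_neqAle eq_sym ne.
rewrite eS; apply: dyadic_increments; rewrite -eS.
exact: kk_le.
Qed.

(** The sum of the steps from level [n] on is a geometric series with first term [K * q ^+ n.+1]. *)
Let chain n m t : 0 <= t -> t <= T ->
  `|W (pt (n + m) (kk (n + m) t)) - W (pt n (kk n t))| <= q / (1 - q) * K * q ^+ n.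
Proof.
have C0 : 0 <= q / (1 - q) by rewrite divr_ge0 ?(ltW q0)// subr_ge0 ltW.
move=> t0 tT; elim: m n => [|m ih] n.
  by rewrite addn0 subrr normr0 (mulr_ge0 _ (qn n))// mulr_ge0.
rewrite -addSnnS.
have := ih n.+1; have := step n t0 tT.
set x := W _; set y := W _; set z := W _ => h1 h2.
have -> : z - y = (z - x) + (x - y) by ring.
rewrite (le_trans (ler_normD _ _))//.
rewrite (le_trans (lerD h2 h1))// le_eqVlt; apply/orP; left; apply/eqP.
by rewrite exprS; field; rewrite subr_eq0 gt_eqF.
Qed.

Let approx n t : 0 <= t -> t <= T ->
  `|W t - W (pt n (kk n t))| <= q / (1 - q) * K * q ^+ n.
Proof.
move=> t0 tT.
have cc := clamp_continuous_within (ltW T0) cW.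
have pt0 j k : 0 <= pt j k by rewrite /pt divr_ge0// mulr_ge0// ltW.
have ptT j : pt j (kk j t) <= T.
  by rewrite /pt ler_pdivrMr// mulrC ler_pM2l// ler_nat kk_le.
(* [grid_cvg] uses [m.+1] cells, so the grid with [2 ^ m] cells has index [(2 ^ m).-1]. *)
have oo : (2 ^ m).-1 @[m --> \oo] --> \oo.
  move=> A [N _ hN]; exists N => // m /= Nm; apply: hN => /=.
  by rewrite (leq_trans Nm)// -ltnS prednK ?expn_gt0// ltn_expl.
have lim1 : pt (n + m) (kk (n + m) t) @[m --> \oo] --> t.
  have h : pt m (kk m t) @[m --> \oo] --> t.
    have := cvg_comp _ _ oo (grid_cvg T0 t0).
    apply: cvg_trans; apply: near_eq_cvg; apply: nearW => m.
    by rewrite /= /pt /kk prednK ?expn_gt0.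
  rewrite -(cvg_shiftn n (fun m => pt m (kk m t)) (nbhs t)) in h.
  by under eq_cvg do rewrite addnC.
have lim2 : W (pt (n + m) (kk (n + m) t)) @[m --> \oo] --> W t.
  have -> : W t = (W \o clamp T) t by rewrite /= clamp_id.
  rewrite (_ : (fun m => _) = fun m => (W \o clamp T) (pt (n + m) (kk (n + m) t))).
    by apply: (@continuous_cvg _ _ _ \oo _ (fun m => pt (n + m) (kk (n + m) t))
      (W \o clamp T) t (cc _)).
  by apply/funext => m; rewrite /= clamp_id.
have lim3 : `|W (pt (n + m) (kk (n + m) t)) - W (pt n (kk n t))| @[m --> \oo] -->
    `|W t - W (pt n (kk n t))|.
  by apply: cvg_norm; apply: cvgB => //; exact: cvg_cst.
by apply: (cvgr_to_le lim3); apply: nearW => m; exact: chain.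
Qed.

(** At the level [n] with [2 ^ n <= T / (t - s) < 2 ^ (n + 1)] the grid points below [s] and [t]
    coincide or are neighbours. The two approximation errors and the increment between these points
    are of order [q ^ n], and [q ^ n] is at most [(2 (t - s) / T) ^ alpha]. *)
Lemma holder_of_dyadic : holder_on `[0, T] alpha W.
Proof.
have C0 : 0 <= q / (1 - q) by rewrite divr_ge0 ?(ltW q0)// subr_ge0 ltW.
pose A := (2 * (q / (1 - q)) + 1) * K.
have A0 : 0 <= A by rewrite mulr_ge0// addr_ge0// mulr_ge0.
exists (A * (2 / T) `^ alpha) => s t.
rewrite /= !in_itv/= => /andP[s0 sT] /andP[t0 tT].
wlog st : s t s0 sT t0 tT / s <= t.
  move=> hw; have [st|/ltW ts] := leP s t; first exact: hw.
  by rewrite distrC (distrC t s); exact: hw.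
move: st; rewrite le_eqVlt => /predU1P[<-|st].
  by rewrite subrr normr0 mulr_ge0 ?powR_ge0// mulr_ge0// powR_ge0.
have ts : 0 < t - s by rewrite subr_gt0.
pose x := T / (t - s).
have x1 : 1 <= x by rewrite ler_pdivlMr// mul1r; lra.
have x0 : 0 <= x by exact: le_trans x1.
have N0 : (0 < Num.truncn x)%N by rewrite truncn_ge_nat.
have /andP[n1 n2] := trunc_log_bounds (ltnSn 1) N0.
set n := trunc_log 2 _ in n1 n2.
have l1 : (2 ^ n)%:R <= x by rewrite -truncn_ge_nat.
have l2 : x < (2 ^ n.+1)%:R.
  by rewrite (lt_le_trans (truncnS_gt x))// ler_nat.
have hs := approx n s0 sT; have ht := approx n t0 tT.
have mid : `|W (pt n (kk n t)) - W (pt n (kk n s))| <= K * q ^+ n.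
  have /andP[a1 a2] := kk_itv n s0; have /andP[b1 b2] := kk_itv n t0.
  have kle : (kk n s <= kk n t)%N.
    apply: le_truncn; rewrite ler_wpM2r ?invr_ge0 ?(ltW T0)// ler_wpM2r//.
    exact: ltW.
  have kle2 : (kk n t <= (kk n s).+1)%N.
    rewrite truncn_le_nat -natr1.
    have -> : t * (2 ^ n)%:R / T = s * (2 ^ n)%:R / T + (t - s) * (2 ^ n)%:R / T.
      by field; rewrite gt_eqF.
    apply: ltr_leD => //.
    rewrite ler_pdivrMr// mul1r mulrC -ler_pdivlMr//.
  have [e|ne] := eqVneq (kk n t) (kk n s).
    by rewrite e subrr normr0 (mulr_ge0 K0 (qn _)).
  have eS : kk n t = (kk n s).+1 
    by apply/eqP; rewrite eqn_leq kle2/= ltn_neqAle eq_sym ne.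
  by rewrite eS; apply: dyadic_increments; rewrite -eS kk_le.
have -> : W t - W s = (W t - W (pt n (kk n t))) +
  (W (pt n (kk n t)) - W (pt n (kk n s))) - (W s - W (pt n (kk n s))) by ring.
apply: (@le_trans _ _ (A * q ^+ n)).
  rewrite (le_trans (ler_normB _ _))// (le_trans (lerD (ler_normD _ _) (lexx _)))//.
  rewrite (le_trans (lerD (lerD ht mid) hs))// le_eqVlt; apply/orP; left; apply/eqP.
  by rewrite /A; ring.
rewrite -mulrA ler_wpM2l// ger0_norm ?(ltW ts)//.
rewrite -powRM ?(ltW ts)//; last by rewrite divr_ge0// ltW.
rewrite /q -powR_mulrn ?powR_ge0// -powRrM mulrC powRrM powR_mulrn ?invr_ge0//.
rewrite ge0_ler_powR ?nnegrE ?exprn_ge0 ?invr_ge0 ?(ltW alpha0)//.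
  by rewrite mulr_ge0 ?(ltW ts)// divr_ge0// ltW.
rewrite -[leRHS]invrK.
have -> : (2 / T * (t - s))^-1 = x / 2 by rewrite /x; field; rewrite !gt_eqF.
have p2 : 0 < 2 ^+ n :> R by rewrite exprn_gt0.
have x20 : 0 < x / 2 by rewrite divr_gt0// (lt_le_trans _ x1).
rewrite exprVn lef_pV2 ?posrE// ltW// ltr_pdivrMr//.
by rewrite -exprSr -natrX.
Qed.

End dyadic_holder.

Lemma eseries_le_geometric {R : realType} (a : nat -> \bar R) (C : R) :
  0 <= C -> (forall n, 0 <= a n)%E -> (forall n, a n <= (C * 2^-1 ^+ n)%:E)%E ->
  (\sum_(n <oo) a n <= (C * 2)%:E)%E.
Proof.
move=> C0 a0 aC; apply: lime_le; first by apply: is_cvg_nneseries => n *; exact: a0.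
apply: nearW => k; apply: (@le_trans _ _ (C * 2 * (1 - 2^-1 ^+ k))%:E).
  rewrite big_mkord; elim: k => [|k ih]; first by rewrite big_ord0 expr0 subrr mulr0.
  rewrite big_ord_recr/= (le_trans (leeD ih (aC k)))// -EFinD lee_fin exprS.
  by rewrite le_eqVlt; apply/orP; left; apply/eqP; field.
by rewrite lee_fin -[leRHS]mulr1 ler_wpM2l ?mulr_ge0// gerBl.
Qed.

Lemma ae_fin_of_integral {R : realType} {d : measure_display} {Omega : measurableType d}
    (P : probability Omega R) (X : Omega -> \bar R) :
  measurable_fun [set: Omega] X -> (forall w, 0 <= X w)%E ->
  (\int[P]_w X w < +oo)%E -> {ae P, forall w, X w \is a fin_num}.
Proof.
move=> mX X0 fX; have iX : P.-integrable [set: Omega] X.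
  apply/integrableP; split=> //.
  by under eq_integral do rewrite gee0_abs//.
have := integrable_ae measurableT iX; apply: filterS => w; exact.
Qed.

Section kolmogorov.
Context {R : realType} {d : measure_display} {Omega : measurableType d}.
Variables (P : probability Omega R) (T : R) (F : R -> set (set Omega))
  (B : R -> Omega -> R).
Hypotheses (T0 : 0 < T) (hF : complete_filtration P T F)
  (hB : brownian_motion P T F B).

Lemma brownian_even_moment s t m : 0 <= s -> s < t -> t <= T ->
  (\int[P]_w (((B t w - B s w) ^+ 2) ^+ m.+1)%:E
    <= ((m.+1)`!%:R * (4 * (t - s)) ^+ m.+1 * 2)%:E)%E.
Proof.
move=> s0 st tT; have ts : 0 < t - s by rewrite subr_gt0.
have [_ _ _ /(_ s t s0 st tT)[ind law]] := hB.
have mxi := brownian_increment_measurable hF hB s0 (ltW st) tT.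
have := @normal_even_moment _ (Num.sqrt (t - s)) m.
rewrite sqrtr_gt0 sqr_sqrtr ?(ltW ts)// => /(_ ts); apply: le_trans.
have cI (c : \bar R) : (\int[P]__ c = c)%E.
  by rewrite integral_cst//= (@probability_setT _ _ _ P) mule1.
(* With a constant first component, [freezing] merely transfers the law of the increment. *)
pose Phi (z : unit * R) := ((z.2 ^+ 2) ^+ m.+1)%:E.
have := freezing mxi (measurable_cst tt) ind law (Phi := Phi) _ _ _.
move=> /(_ _ _ _)/= -> //.
- by rewrite cI.
- have sT := ltW (lt_le_trans st tT).
  apply/(adapted_toP _ (filtration_sigma hF s0 sT)); exact: measurable_cst.
- apply/measurable_EFinP; apply: measurable_funX; apply: measurable_funX.
  exact: measurable_snd.
by move=> z; rewrite lee_fin; apply: exprn_ge0; exact: sqr_ge0.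
Qed.

(* Kolmogorov's argument: for [2 ^ m] large the [2m]-th moments of the dyadic
   increments, normalised by [2 ^ (- alpha n)], have a finite sum. *)
Lemma brownian_holder alpha : 0 < alpha -> alpha < 1 / 2 ->
  {ae P, forall w, holder_on `[0, T] alpha (fun t => B t w)}.
Proof.
move=> a0 a2.
pose q : R := 2^-1 `^ alpha.
have q0 : 0 < q by rewrite powR_gt0.
pose r := (2 * q ^+ 2)^-1.
have r0 : 0 <= r by rewrite invr_ge0 mulr_ge0// sqr_ge0.
have r1 : r < 1.
  have -> : 1 = 1 `^ (1 - alpha * 2) :> R by rewrite powR1.
  have -> : r = 2^-1 `^ (1 - alpha * 2).
    rewrite powRB ?invr_eq0 ?pnatr_eq0 ?implybT// powRr1 ?invr_ge0// powRrM powR_mulrn ?powR_ge0//.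
    by rewrite /r invfM.
  by apply: gt0_ltr_powR; rewrite ?nnegrE ?invr_ge0//; lra.
(* The normalised moments decay like [r ^ (n (m + 1))], with [r < 1] because [alpha < 1 / 2]. Level
   [n] has [2 ^ n] increments, so a decay of 1 / 4 per level leaves the summable [2 ^ (- n)]. *)
have [m hm] : exists m, r ^+ m.+1 <= 2^-1 ^+ 2.
  have r1' : `|r| < 1 by rewrite ger0_norm.
  have /cvgrPdist_lt/(_ _ (_ : 0 < 2^-1 ^+ 2))[|N _ hN] := cvg_geometric 1 r1'.
    by rewrite exprn_gt0// invr_gt0.
  exists N; have := hN N.+1 (leqnSn _); rewrite /= mul1r sub0r normrN ger0_norm.
    exact: ltW.
  exact: exprn_ge0.
pose pt n k : R := k%:R * T / (2 ^ n)%:R.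
pose D n k w := ((B (pt n k.+1) w - B (pt n k) w) / q ^+ n) ^+ 2.
pose X w := (\sum_(n <oo) \sum_(k < 2 ^ n) ((D n k w) ^+ m.+1)%:E)%E.
have ptS n k : pt n k.+1 - pt n k = T / 2 ^+ n.
  by rewrite /pt -natr1 natrX; field; rewrite expf_neq0.
have pt0 n k : 0 <= pt n k.
  by rewrite /pt divr_ge0// mulr_ge0// ltW.
have ptlt n k : pt n k < pt n k.+1.
  by rewrite -subr_gt0 ptS divr_gt0// exprn_gt0.
have ptT n (k : 'I_(2 ^ n)) : pt n k.+1 <= T.
  by rewrite /pt ler_pdivrMr ?ltr0n ?expn_gt0// mulrC ler_pM2l// ler_nat.
have D0 n k w : 0 <= D n k w ^+ m.+1 by apply: exprn_ge0; exact: sqr_ge0.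
have mD n (k : 'I_(2 ^ n)) : measurable_fun [set: Omega] (fun w => (D n k w ^+ m.+1)%:E).
  apply/measurable_EFinP; apply: measurable_funX; apply: measurable_funX.
  apply: measurable_funM => //; apply: (brownian_increment_measurable hF hB) => //.
  exact: ltW.
have mDs n : measurable_fun [set: Omega]
    (fun w => (\sum_(k < 2 ^ n) ((D n k w) ^+ m.+1)%:E)%E).
  exact: emeasurable_sum.
have mX : measurable_fun [set: Omega] X.
  by apply: ge0_emeasurable_sum => // n w _ _; apply: sume_ge0 => k _; rewrite lee_fin.
pose C := (m.+1)`!%:R * (4 * T) ^+ m.+1 * 2.
have C0 : 0 <= C.
  by rewrite /C mulr_ge0//; apply: mulr_ge0 => //; apply: exprn_ge0; rewrite mulr_ge0// ltW.
have iX : (\int[P]_w X w < +oo)%E.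
  rewrite /X integral_nneseries//; last first.
    by move=> n w _; apply: sume_ge0 => k _; rewrite lee_fin.
  apply: (@le_lt_trans _ _ (C * 2)%:E); last exact: ltry.
  apply: eseries_le_geometric => // n.
    by apply: integral_ge0 => w _; apply: sume_ge0 => k _; rewrite lee_fin.
  rewrite ge0_integral_sum//; last by move=> k w _; rewrite lee_fin.
  apply: (@le_trans _ _ (\sum_(k < 2 ^ n) (C * (r ^+ m.+1) ^+ n)%:E)%E).
    apply: lee_sum => k _.
    have qn : 0 < (q ^+ n) ^+ 2 by rewrite !exprn_gt0.
    rewrite (_ : (fun w => _) = fun w => ((((q ^+ n) ^+ 2)^-1 ^+ m.+1)%:E *
        (((B (pt n k.+1) w - B (pt n k) w) ^+ 2) ^+ m.+1)%:E)%E); last first.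
      apply/funext => w; rewrite -EFinM /D -exprMn; congr ((_ ^+ _)%:E).
      by rewrite expr_div_n mulrC.
    rewrite ge0_integralZl//; last 3 first.
    - apply/measurable_EFinP; apply: measurable_funX; apply: measurable_funX.
      by apply: (brownian_increment_measurable hF hB) => //; exact: ltW.
    - by move=> w _; rewrite lee_fin; apply: exprn_ge0; exact: sqr_ge0.
    - by rewrite lee_fin; apply: exprn_ge0; rewrite invr_ge0 ltW.
    have h := brownian_even_moment m (pt0 n k) (ptlt n k) (ptT n k).
    apply: le_trans (lee_wpmul2l _ h) _.
      by rewrite lee_fin; apply: exprn_ge0; rewrite invr_ge0 ltW.
    rewrite -EFinM lee_fin ptS le_eqVlt; apply/orP; left; apply/eqP.
    rewrite /C -(exprM r) (mulnC m.+1) (exprM r).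
    have -> : r ^+ n = (2 ^+ n)^-1 * ((q ^+ n) ^+ 2)^-1.
      by rewrite /r exprVn exprMn invfM -!exprM (mulnC 2).
    rewrite (mulrA 4) (exprMn _ (4 * T)) (exprMn _ (2 ^+ n)^-1).
    by ring.
  rewrite sumEFin lee_fin sumr_const card_ord -[leLHS]mulr_natr natrX -mulrA ler_wpM2l//.
  apply: (@le_trans _ _ ((2^-1 ^+ 2) ^+ n * 2 ^+ n)).
    apply: ler_wpM2r; first exact: exprn_ge0.
    by apply: lerXn2r => //; rewrite nnegrE; apply: exprn_ge0.
  by rewrite -exprMn expr2 -mulrA mulVf// mulr1.
have [_ _ cB _] := hB.
have XX : {ae P, forall w, X w \is a fin_num}.
  apply: ae_fin_of_integral => // w; apply: nneseries_ge0 => n _ _.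
  by apply: sume_ge0 => k _; rewrite lee_fin.
move: cB XX; apply: filterS2 => w cw Xw.
have X0 n : (\sum_(k < 2 ^ n) ((D n k w) ^+ m.+1)%:E <= X w)%E.
  apply: le_trans (nneseries_lim_ge n.+1 _) => [|i _ _].
    rewrite big_mkord big_ord_recr/= leeDr// sume_ge0// => i _.
    by apply: sume_ge0 => k _; rewrite lee_fin.
  by apply: sume_ge0 => k _; rewrite lee_fin.
have X00 : 0 <= fine (X w).
  rewrite -lee_fin fineK//; apply: le_trans (X0 0%N).
  by apply: sume_ge0 => k _; rewrite lee_fin.
apply: (@holder_of_dyadic _ T alpha (fine (X w) + 1)) => //.
  by rewrite addr_ge0.
move=> n k kn; rewrite -/(pt _ _) -/(pt _ _) -/q.
have DX : D n k w ^+ m.+1 <= fine (X w).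
  rewrite -lee_fin fineK//; apply: le_trans (X0 n).
  rewrite (bigD1 (Ordinal kn))//= leeDl// sume_ge0// => i _.
  by rewrite lee_fin.
rewrite -ler_pdivrMr ?exprn_gt0//.
have -> : `|B (pt n k.+1) w - B (pt n k) w| / q ^+ n =
    `|(B (pt n k.+1) w - B (pt n k) w) / q ^+ n|.
  by rewrite normrM (gtr0_norm (_ : 0 < q ^- n))// invr_gt0 exprn_gt0.
(* A number is bounded by its high power only if it is at least 1; this is why the Hölder constant
   is [fine (X w) + 1]. *)
have [y1|/ltW y1] := leP `|(B (pt n k.+1) w - B (pt n k) w) / q ^+ n| 1.
  by apply: le_trans y1 _; rewrite lerDr.
apply: (@le_trans _ _ (D n k w ^+ m.+1)); last by rewrite (le_trans DX)// lerDl.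
have DE : D n k w = `|(B (pt n k.+1) w - B (pt n k) w) / q ^+ n| ^+ 2.
  by rewrite real_normK ?num_real.
by rewrite DE -exprM; apply: ler_eXnr.
Qed.

End kolmogorov.

(** * The scale function *)

Section scale.
Context {R : realType}.
Implicit Types (b : R -> R) (x y z h eps : R).

(** The infimum of [b y + L * |x - y|] is [L]-Lipschitz. With [L = 2 * M / delta] the penalty at
    distance [delta] outweighs the oscillation of [b], so only near points matter and they cost at
    most [eps]. *)
Lemma inf_convolution b (M eps : R) : (forall x, `|b x| <= M) -> unif_cont b ->
  0 < eps -> exists L bL, (forall x y, `|bL x - bL y| <= L * `|x - y|) /\
    forall x, b x - eps <= bL x /\ bL x <= b x.
Proof.
move=> bM ub e0; have [delta d0 hd] := ub _ e0.
have M0 : 0 <= M by exact: le_trans (bM 0).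
pose L := 2 * M / delta; have L0 : 0 <= L by rewrite divr_ge0 ?mulr_ge0// ltW.
pose V x := [set b y + L * `|x - y| | y in [set: R]].
have Vx x : V x (b x) by exists x => //; rewrite subrr normr0 mulr0 addr0.
have lbV x : lbound (V x) (b x - eps).
  move=> _ [y _ <-]; have [xy|yx] := ltP `|x - y| delta.
    have := hd _ _ xy; rewrite ler_norml => /andP[_ h].
    have : 0 <= L * `|x - y| by rewrite mulr_ge0.
    by lra.
  have : L * delta <= L * `|x - y| by rewrite ler_wpM2l.
  rewrite /L mulfVK ?gt_eqF//.
  have := bM x; have := bM y; rewrite !ler_norml => /andP[? ?] /andP[? ?].
  by lra.
have iV x : has_inf (V x) by split; [exists (b x); exact: Vx|exists (b x - eps); exact: lbV].
have lip x y : inf (V x) <= inf (V y) + L * `|x - y|.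
  rewrite -lerBlDr; apply: lb_le_inf; first by exists (b y); exact: Vx.
  move=> _ [z _ <-]; rewrite lerBlDr.
  apply: (@le_trans _ _ (b z + L * `|x - z|)).
    by apply: ge_inf; [exact: (iV x).2|exists z].
  rewrite -addrA lerD2l -mulrDr ler_wpM2l// [leRHS]addrC.
  exact: ler_distD.
exists L, (fun x => inf (V x)); split=> [x y|x].
  by rewrite ler_norml; have := lip x y; have := lip y x; rewrite (distrC y); lra.
split; first by apply: lb_le_inf; [exists (b x); exact: Vx|exact: lbV].
by apply: ge_inf; [exact: (iV x).2|exact: Vx].
Qed.

(* [s] is harmonic for the diffusion with drift [b]. *)
Definition scale_function b (m : R) (s s1 s2 : R -> R) :=
  [/\ (forall x, is_derive x 1 s (s1 x)) /\ (forall x, is_derive x 1 s1 (s2 x)),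
      (forall x, m^-1 <= s1 x) /\ (forall x, s1 x <= m),
      (forall x, `|s2 x| <= m) /\ (forall x, `|b x| <= m),
      unif_cont s2 & forall x, s1 x * b x + s2 x / 2 = 0].

(** Take [s1 = exp (- 2 Phi)] with [Phi] a primitive of [b]. As [b] vanishes outside [[-K, K]],
    [Phi] is bounded, which keeps [s1] between two positive constants. *)
Lemma scale_function_exists b M K : (forall x, `|b x| <= M) -> 0 <= K ->
  (forall x, K <= `|x| -> b x = 0) -> unif_cont b ->
  exists m s s1 s2, 1 <= m /\ scale_function b m s s1 s2.
Proof.
move=> bM K0 bK ub.
have M0 : 0 <= M by exact: le_trans (bM 0).
have cb := unif_cont_continuous ub.
have [Phi Phi0 dPhi] := primitive_exists cb.
have Phi_const x y : x <= y -> (forall z, x <= z <= y -> b z = 0) -> Phi y = Phi x.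
  move=> xy b0; have [|z zxy e] := MVT_segment xy (fun z _ => dPhi z).
    by apply: continuous_subspaceT; exact: derivable_continuous dPhi.
  by apply/eqP; rewrite -subr_eq0 e b0 ?mul0r// -in_itv/=.
have PhiK0 x : `|x| <= K -> `|Phi x| <= M * K.
  move=> xK; rewrite -[Phi x]subr0 -[X in _ - X]Phi0.
  apply: (le_trans (@lipschitz_from _ Phi b 0 x M dPhi (fun z _ => bM z))).
  by rewrite subr0 ler_wpM2l.
have PhiK x : `|Phi x| <= M * K.
  have [xK|Kx] := leP `|x| K; first exact: PhiK0.
  have [x0|x0] := leP 0 x.
    rewrite (ger0_norm x0) in Kx; rewrite (@Phi_const K x (ltW Kx)).
      by rewrite PhiK0// ger0_norm.
    by move=> z /andP[Kz _]; rewrite bK// (le_trans Kz)// ler_norm.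
  rewrite (ltr0_norm x0) in Kx; rewrite -(@Phi_const x (- K)); last 2 first.
  - by rewrite lerNr ltW.
  - by move=> z /andP[_ zK]; rewrite bK// -normrN (le_trans _ (ler_norm _))// lerNr.
  by rewrite PhiK0// normrN ger0_norm.
pose s1 x := expR (-2 * Phi x).
have ds1 x : is_derive x 1 s1 (-2 * b x * s1 x).
  have ? := dPhi x.
  apply: (@is_derive_eq _ _ _ _ _ _ _ _
    (is_derive1_comp (f := @expR R) (g := fun x => -2 * Phi x) _ _)).
  by rewrite /GRing.scale/= mulrC.
have cs1 : continuous s1 by exact: derivable_continuous ds1.
have [s _ ds] := primitive_exists cs1.
pose m := expR (2 * (M * K)) * (2 * M + 1) + 1.
have e1 : 1 <= expR (2 * (M * K)).
  by rewrite -expR0 ler_expR !mulr_ge0.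
have s1m x : s1 x <= expR (2 * (M * K)).
  by rewrite ler_expR; have := PhiK x; rewrite ler_norml; lra.
have s1p x : 0 <= s1 x by exact: expR_ge0.
have em : expR (2 * (M * K)) <= m.
  rewrite /m ler_wpDr// -[leLHS]mulr1 ler_wpM2l ?expR_ge0//; lra.
have m1 : 1 <= m by exact: le_trans em.
have s2m x : `|-2 * b x * s1 x| <= m.
  rewrite normrM (ger0_norm (s1p x)) normrM normrN (ger0_norm (_ : 0 <= 2))//.
  apply: (@le_trans _ _ (2 * M * expR (2 * (M * K)))).
    by apply: ler_pM => //; rewrite ler_wpM2l.
  rewrite /m mulrC -[leLHS]addr0 lerD// ler_wpM2l ?expR_ge0//; lra.
exists m, s, s1, (fun x => -2 * b x * s1 x); split=> //; split=> //.
- split=> x; last exact: le_trans em.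
  apply: (@le_trans _ _ (expR (- (2 * (M * K))))).
    rewrite expRN lef_pV2 ?posrE ?expR_gt0//.
    exact: lt_le_trans m1.
  by rewrite ler_expR; have := PhiK x; rewrite ler_norml; lra.
- split=> // x; apply: le_trans (bM x) _.
  rewrite /m; apply: (@le_trans _ _ (1 * (2 * M + 1) + 1)); first lra.
  by rewrite lerD2r ler_wpM2r//; lra.
- have us1 : unif_cont s1.
    apply: (@lipschitz_unif_cont _ _ m) => x y; rewrite distrC (distrC x).
    by apply: lipschitz_from => // z _; exact: s2m.
  have ub2 : unif_cont (fun x => -2 * b x).
    apply: (@unif_contM _ _ _ (2 + M)) => //.
    + by move=> _; rewrite normrN ger0_norm// lerDl.
    + by move=> x; rewrite (le_trans (bM x))// lerDr.
    + by apply: (@lipschitz_unif_cont _ _ 0) => x y; rewrite subrr normr0 mul0r.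
  apply: (@unif_contM _ _ _ (2 * M + m)) => //.
  + by move=> x; rewrite normrM normrN (ger0_norm (_ : 0 <= 2))//; have := bM x; lra.
  + move=> x; rewrite ger0_norm// (le_trans (s1m x))// (le_trans em)//.
    by rewrite lerDr mulr_ge0.
- by move=> x; field.
Qed.

Section step.
Variables (b s s1 s2 : R -> R) (m : R).
Hypotheses (m1 : 1 <= m) (hs : scale_function b m s s1 s2).

Let m0 : 0 < m. Proof. exact: lt_le_trans m1. Qed.

Lemma drift_square h beta : 0 < h -> `|beta| <= 2 * m ->
  (h * beta) ^+ 2 <= 4 * m ^+ 2 * h ^+ 2.
Proof.
move=> h0 hbeta.
have -> : 4 * m ^+ 2 * h ^+ 2 = (h * (2 * m)) ^+ 2 by ring.
rewrite -(real_normK (num_real (h * beta))) lerXn2r ?nnegrE ?normr_ge0//.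
  by rewrite mulr_ge0 ?(ltW h0)// mulr_ge0// ltW.
by rewrite normrM (gtr0_norm h0) ler_pM2l.
Qed.

Lemma step_square h beta xi : 0 < h -> `|beta| <= 2 * m ->
  (h * beta + xi) ^+ 2 <= 8 * m ^+ 2 * h ^+ 2 + 2 * xi ^+ 2.
Proof.
move=> h0 /(drift_square h0) hb2.
have : 0 <= (h * beta - xi) ^+ 2 by exact: sqr_ge0.
by move: hb2; rewrite !sqrrD !sqrrN !mulr2n; lra.
Qed.

(** For the remainders that get squared, where order [h + xi ^ 2] suffices. *)
Lemma scale_expansion_crude x h beta xi : 0 < h -> h <= 1 -> `|beta| <= 2 * m ->
  `|s (x + (h * beta + xi)) - s x - s1 x * xi| <= 10 * m ^+ 3 * (h + xi ^+ 2).
Proof.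
move=> h0 h1 hbeta; have [[ds ds1] [s1l s1m] [s2m _] _ _] := hs.
set de := h * beta + xi.
have := @taylor1 R s s1 s2 x (x + de) m ds ds1 (fun z _ => s2m z).
have -> : x + de - x = de by ring.
move=> ht.
have -> : s (x + de) - s x - s1 x * xi =
  (s (x + de) - s x - s1 x * de) + s1 x * (h * beta) by rewrite /de; ring.
have de2 := step_square xi h0 hbeta; rewrite -/de in de2.
rewrite (le_trans (ler_normD _ _))//.
have t1 : `|s1 x * (h * beta)| <= m * (h * (2 * m)).
  rewrite normrM (ger0_norm (le_trans _ (s1l x))) ?invr_ge0 ?(ltW m0)//.
  apply: ler_pM => //; first by rewrite (le_trans _ (s1l x))// invr_ge0 ltW.
  by rewrite normrM (gtr0_norm h0) ler_pM2l.
have t2 : m * de ^+ 2 <= m * (8 * m ^+ 2 * h ^+ 2 + 2 * xi ^+ 2) by rewrite ler_pM2l.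
have hh : h ^+ 2 <= h by rewrite expr2 ler_piMr// ltW.
have m3 : 0 < m ^+ 3 by rewrite exprn_gt0.
have k1 : m ^+ 3 * h ^+ 2 <= m ^+ 3 * h by rewrite ler_pM2l.
have k2 : m ^+ 2 * h <= m ^+ 3 * h.
  by rewrite ler_pM2r// [leRHS]exprS ler_peMl// exprn_ge0 ?(ltW m0).
have k3 : m * xi ^+ 2 <= m ^+ 3 * xi ^+ 2.
  by rewrite ler_wpM2r ?sqr_ge0// [leRHS]exprS ler_peMr ?(ltW m0)// exprn_ege1.
apply: le_trans (lerD ht t1) _.
have k4 : 0 <= m ^+ 3 * xi ^+ 2 by apply: mulr_ge0; [exact: ltW|exact: sqr_ge0].
by move: t2 k1 k2 k3 k4; lra.
Qed.

(** For the remainders that enter linearly. Harmonicity cancels the drift, leaving the centred term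
    [xi ^ 2 - h]. Since [s2] is only uniformly continuous, its oscillation is bounded by
    [eta + C0 * (z - x) ^ 2], which trades the modulus of continuity for a fourth moment. *)
Lemma scale_expansion eta : 0 < eta -> exists2 C : R, 0 <= C &
  forall x h beta xi eps, 0 < h -> h <= 1 -> eps <= 1 -> `|beta - b x| <= eps ->
   `|s (x + (h * beta + xi)) - s x - s1 x * xi - s2 x / 2 * (xi ^+ 2 - h)| <=
   m * eps * h + C * h ^+ 2 + (m ^+ 2 + 2) * eta * xi ^+ 2 + C * xi ^+ 4.
Proof.
move=> eta0; have [[ds ds1] [s1l s1m] [s2m bm] us2 harm] := hs.
have [delta d0 hd] := us2 _ eta0.
pose C0 := 2 * m / delta ^+ 2.
have d20 : 0 < delta ^+ 2 by rewrite exprn_gt0.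
have C00 : 0 <= C0 by rewrite divr_ge0 ?(ltW d20)// mulr_ge0// ltW.
have modulus x z : `|s2 z - s2 x| <= eta + C0 * (z - x) ^+ 2.
  have [zx|xz] := ltP `|z - x| delta.
    by rewrite (le_trans (hd _ _ zx))// lerDl; apply: mulr_ge0 => //; exact: sqr_ge0.
  have h1 : 2 * m <= C0 * (z - x) ^+ 2.
    rewrite /C0 mulrAC ler_pdivlMr// ler_wpM2l ?mulr_ge0 ?(ltW m0)//.
    by rewrite -[leRHS](real_normK (num_real _)) lerXn2r ?nnegrE// ltW.
  rewrite (le_trans (ler_normB _ _))//.
  have := s2m x; have := s2m z; lra.
pose C := m ^+ 2 / eta + 2 * m ^+ 3 + 8 * m ^+ 2 * eta + 128 * m ^+ 4 * C0 + 8 * C0.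
have m20 : 0 <= m ^+ 2 by exact: sqr_ge0.
have m30 : 0 <= m ^+ 3 by apply: exprn_ge0; exact: ltW.
have m40 : 0 <= m ^+ 4 by apply: exprn_ge0; exact: ltW.
have eta00 := ltW eta0.
have q1 : 0 <= m ^+ 2 / eta by apply: mulr_ge0 => //; rewrite invr_ge0.
have q2 : 0 <= m ^+ 2 * eta by apply: mulr_ge0.
have q3 : 0 <= m ^+ 4 * C0 by apply: mulr_ge0.
exists C; first by rewrite /C; lra.
move=> x h beta xi eps h0 h1 eps1 hbeta.
have beta2 : `|beta| <= 2 * m.
  have -> : beta = (beta - b x) + b x by ring.
  apply: (le_trans (ler_normD _ _)).
  by rewrite mulr_natl mulr2n lerD// (le_trans hbeta)// (le_trans eps1).
set de := h * beta + xi.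
have ht := @taylor2 R s s1 s2 x (x + de) (eta + C0 * de ^+ 2) ds ds1.
have ex : x + de - x = de by ring.
rewrite ex in ht.
have {}ht : `|s (x + de) - s x - s1 x * de - s2 x * de ^+ 2 / 2|
    <= (eta + C0 * de ^+ 2) * de ^+ 2.
  apply: ht => z zx; apply: le_trans (modulus x z) _; rewrite lerD2l ler_wpM2l//.
  by rewrite -(real_normK (num_real (z - x))) -(real_normK (num_real de)) lerXn2r ?nnegrE.
have hb2 := drift_square h0 beta2; have de2 := step_square xi h0 beta2.
rewrite -/de in de2.
have -> : s (x + de) - s x - s1 x * xi - s2 x / 2 * (xi ^+ 2 - h) =
  (s (x + de) - s x - s1 x * de - s2 x * de ^+ 2 / 2)
  + s1 x * (beta - b x) * h + s2 x * (h * beta * xi) + s2 x / 2 * (h * beta) ^+ 2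
  + (s1 x * b x + s2 x / 2) * h by rewrite /de; field.
rewrite harm mul0r addr0.
have t1 : `|s1 x * (beta - b x) * h| <= m * eps * h.
  rewrite normrM (gtr0_norm h0) ler_pM2r// normrM.
  by rewrite (ger0_norm (le_trans _ (s1l x))) ?invr_ge0 ?(ltW m0)// ler_pM// (le_trans _ (s1l x))// invr_ge0 ltW.
have t2 : `|s2 x * (h * beta * xi)| <= m ^+ 2 / eta * h ^+ 2 + m ^+ 2 * eta * xi ^+ 2.
  (* AM-GM: [2 h |xi| <= h^2 / eta + eta xi^2] *)
  have amgm : 2 * (h * `|xi|) <= h ^+ 2 / eta + eta * xi ^+ 2.
    rewrite -(real_normK (num_real xi)) -subr_ge0.
    have -> : h ^+ 2 / eta + eta * `|xi| ^+ 2 - 2 * (h * `|xi|) =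
      (h - eta * `|xi|) ^+ 2 / eta by field; rewrite gt_eqF.
    by apply: mulr_ge0; [exact: sqr_ge0|rewrite invr_ge0].
  apply: (@le_trans _ _ (m * (h * (2 * m) * `|xi|))).
    rewrite normrM normrM normrM (gtr0_norm h0).
    rewrite ler_pM//; first by rewrite !mulr_ge0// ltW.
    by rewrite ler_wpM2r// ler_pM2l.
  have -> : m * (h * (2 * m) * `|xi|) = m ^+ 2 * (2 * (h * `|xi|)) by ring.
  apply: le_trans (ler_wpM2l m20 amgm) _.
  by rewrite le_eqVlt; apply/orP; left; apply/eqP; ring.
have t3 : `|s2 x / 2 * (h * beta) ^+ 2| <= 2 * m ^+ 3 * h ^+ 2.
  rewrite normrM (ger0_norm (sqr_ge0 _)).
  apply: (@le_trans _ _ (m / 2 * (4 * m ^+ 2 * h ^+ 2))).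
    apply: ler_pM => //; first exact: sqr_ge0.
    by rewrite normrM (ger0_norm (_ : 0 <= 2^-1)) ?invr_ge0// ler_wpM2r// invr_ge0.
  by rewrite le_eqVlt; apply/orP; left; apply/eqP; field.
have de20 : 0 <= de ^+ 2 by exact: sqr_ge0.
have h20 : 0 <= h ^+ 2 by exact: sqr_ge0.
have x20 : 0 <= xi ^+ 2 by exact: sqr_ge0.
have de4 : de ^+ 2 * de ^+ 2 <= 128 * m ^+ 4 * h ^+ 2 + 8 * xi ^+ 4.
  apply: (@le_trans _ _ ((8 * m ^+ 2 * h ^+ 2 + 2 * xi ^+ 2) *
     (8 * m ^+ 2 * h ^+ 2 + 2 * xi ^+ 2))); first by apply: ler_pM.
  have hh : m ^+ 4 * h ^+ 2 * h ^+ 2 <= m ^+ 4 * h ^+ 2.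
    by apply: ler_piMr; [apply: mulr_ge0|apply: exprn_ile1 => //; exact: ltW].
  have := sqr_ge0 (8 * m ^+ 2 * h ^+ 2 - 2 * xi ^+ 2).
  by move: hh; lra.
have t4 : (eta + C0 * de ^+ 2) * de ^+ 2 <=
    eta * (8 * m ^+ 2 * h ^+ 2 + 2 * xi ^+ 2) + C0 * (128 * m ^+ 4 * h ^+ 2 + 8 * xi ^+ 4).
  rewrite mulrDl; apply: lerD; first by rewrite ler_wpM2l.
  by rewrite -[leLHS]mulrA ler_wpM2l.
apply: le_trans (le_trans (ler_normD _ _) (lerD (le_trans (ler_normD _ _)
  (lerD (le_trans (ler_normD _ _) (lerD (le_trans ht t4) t1)) t2)) t3)) _.
have x40 : 0 <= xi ^+ 4 by exact: exprn_even_ge0.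
rewrite -subr_ge0.
have CC : 0 <= C - 8 * C0 by rewrite /C; lra.
have : 0 <= 8 * C0 * h ^+ 2 + (C - 8 * C0) * xi ^+ 4.
  by apply: addr_ge0; apply: mulr_ge0 => //; exact: mulr_ge0.
by move/le_trans; apply; rewrite le_eqVlt; apply/orP; left; apply/eqP; rewrite /C; ring.
Qed.

Lemma scale_injective x y : `|x - y| <= m * `|s x - s y|.
Proof.
have [[ds ds1] [s1l s1m] _ _ _] := hs.
wlog xy : x y / x <= y.
  move=> hw; have [xy|/ltW yx] := leP x y; first exact: hw.
  by rewrite distrC (distrC (s x)); exact: hw.
have [|z _ e] := MVT_segment xy (fun z _ => ds z).
  by apply: continuous_subspaceT; exact: derivable_continuous ds.
rewrite distrC (distrC (s x)) e normrM mulrA ler_peMl//.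
have z0 : 0 <= s1 z by rewrite (le_trans _ (s1l z))// invr_ge0 ltW.
by rewrite (ger0_norm z0) -ler_pdivrMl// mulr1.
Qed.

(* With [xi] of law [N 0 (sqrt h)] the bound integrates to at most
   [a0 + 64 a4 h ^ 2]; this only involves moments up to order four. *)
Lemma scale_step gamma : 0 < gamma -> exists eps h0 : R,
  [/\ 0 < eps, 0 < h0 & forall x y h beta beta', 0 < h -> h < h0 ->
    `|beta - b x| <= eps -> `|beta' - b y| <= eps ->
    exists a0 a1 a2 a4, [/\ 0 <= a4,
      a0 + 64 * a4 * h ^+ 2 <=
        (s x - s y) ^+ 2 * (1 + (1 + 2 * m ^+ 4) * h) + h * gamma &
      forall xi, (s (x + (h * beta + xi)) - s (y + (h * beta' + xi))) ^+ 2 <=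
        a0 + a1 * xi + a2 * (xi ^+ 2 - h) + a4 * xi ^+ 4]].
Proof.
move=> gamma0; have [[ds ds1] [s1l s1m] [s2m bm] us2 harm] := hs.
(* [k0] will bound the coefficient [kap] of [2 * |D| * h]: as [k0 <= 1],
   [kap ^ 2 <= k0 <= gamma / 2]. The choices of [eps], [eta] and [h1] each use up one third of
   [k0]. *)
pose k0 := Num.min 1 (gamma / 2).
have k00 : 0 < k0 by rewrite lt_min ltr01 divr_gt0.
have k01 : k0 <= 1 by rewrite ge_min lexx.
have k0g : k0 <= gamma / 2 by rewrite ge_min lexx orbT.
have c20 : 0 < m ^+ 2 + 2 by rewrite ltr_wpDl// sqr_ge0.
pose eta := k0 / (6 * (m ^+ 2 + 2)).
have eta0 : 0 < eta by rewrite divr_gt0// mulr_gt0.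
have [C C0 hC] := scale_expansion eta0.
pose eps := k0 / (6 * m).
have eps0 : 0 < eps by rewrite divr_gt0// mulr_gt0.
have eps1 : eps <= 1.
  rewrite ler_pdivrMr ?mulr_gt0// mul1r; apply: (le_trans k01).
  by rewrite -[leLHS]mulr1 ler_pM// ler1n.
pose A := 10 * m ^+ 3.
have A0 : 0 < A by rewrite mulr_gt0// exprn_gt0.
have A20 : 0 < A ^+ 2 by rewrite exprn_gt0.
(* In [a0 + 64 * a4 * h ^ 2], the constant part of an error counts once and its quartic part 64
   times. *)
have [c [cE c0]] : exists c : R, c = 1 + 64 /\ 0 < c by exists (1 + 64).
pose h1 := k0 / (3 * (2 * c * C + 1)).
pose h2 := gamma / (2 * (16 * c * A ^+ 2)).
have cC0 : 0 < 2 * c * C + 1.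
  by apply: ltr_wpDl => //; apply: mulr_ge0 => //; apply: mulr_ge0 => //; exact: ltW.
have cA0 : 0 < 16 * c * A ^+ 2 by apply: mulr_gt0 => //; exact: mulr_gt0.
have h10 : 0 < h1 by apply: divr_gt0 => //; exact: mulr_gt0.
have h20 : 0 < h2 by apply: divr_gt0 => //; exact: mulr_gt0.
exists eps, (Num.min 1 (Num.min h1 h2)); split=> //.
  by rewrite !lt_min ltr01 h10.
move=> x y h beta beta' hp; rewrite !lt_min => /and3P[/ltW hle1 hh1 hh2] hb hb'.
pose D := s x - s y; pose G := s1 x - s1 y; pose Q := (s2 x - s2 y) / 2.
pose p0 := 2 * (m * eps * h + C * h ^+ 2).
pose p2 := 2 * ((m ^+ 2 + 2) * eta).
pose p4 := 2 * C.
pose a0 := D ^+ 2 + 2 * `|D| * (p0 + p2 * h) + 2 * G ^+ 2 * h + 16 * A ^+ 2 * h ^+ 2.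
pose a4 := 2 * `|D| * p4 + 16 * A ^+ 2.
exists a0, (2 * D * G), (2 * D * Q + 2 * `|D| * p2 + 2 * G ^+ 2), a4.
have a40 : 0 <= a4.
  by apply: addr_ge0; apply: mulr_ge0 => //; [apply: mulr_ge0 => //; exact: mulr_ge0|exact: ltW].
split=> // [|xi].
- pose kap := p0 / h + p2 + 64 * p4 * h.
  have kapE : h * kap = p0 + p2 * h + 64 * p4 * h ^+ 2.
    by rewrite /kap; field; rewrite gt_eqF.
  have kap_le : kap <= k0.
    have -> : kap = 2 * m * eps + 2 * ((m ^+ 2 + 2) * eta) + (2 * c * C) * h.
      by rewrite /kap /p0 /p2 /p4 cE; field; rewrite gt_eqF.
    have -> : 2 * m * eps = k0 / 3 by rewrite /eps; field; rewrite gt_eqF.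
    have -> : 2 * ((m ^+ 2 + 2) * eta) = k0 / 3 by rewrite /eta; field; rewrite gt_eqF.
    have ch : (2 * c * C + 1) * h <= k0 / 3.
      rewrite mulrC -ler_pdivlMr//.
      apply: (le_trans (ltW hh1)); rewrite le_eqVlt; apply/orP; left; apply/eqP.
      by rewrite /h1; field; rewrite gt_eqF.
    have {}ch : 2 * c * C * h <= k0 / 3.
      by apply: le_trans ch; rewrite ler_pM2r// lerDl.
    apply: (le_trans (lerD (lexx _) ch)).
    by rewrite le_eqVlt; apply/orP; left; apply/eqP; field.
  have kap0 : 0 <= kap.
    apply: addr_ge0; [apply: addr_ge0|].
    - apply: mulr_ge0; last by rewrite invr_ge0 ltW.
      apply: mulr_ge0 => //; apply: addr_ge0.
        by apply: mulr_ge0; [apply: mulr_ge0|]; exact: ltW.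
      by apply: mulr_ge0 => //; exact: sqr_ge0.
    - by apply: mulr_ge0 => //; apply: mulr_ge0; exact: ltW.
    - by apply: mulr_ge0; [apply: mulr_ge0 => //; exact: mulr_ge0|exact: ltW].
  have kap2 : kap ^+ 2 <= gamma / 2.
    apply: le_trans k0g; rewrite expr2.
    by apply: (le_trans (ler_pM kap0 kap0 kap_le (le_trans kap_le k01))); rewrite mulr1.
  (* The diffusion coefficient [s1] is Lipschitz as a function of the scale; this yields the
     Gronwall factor. *)
  have G2 : G ^+ 2 <= m ^+ 4 * D ^+ 2.
    have -> : m ^+ 4 * D ^+ 2 = (m * (m * D)) ^+ 2 by ring.
    rewrite -(real_normK (num_real G)) -(real_normK (num_real (m * (m * D)))).
    rewrite lerXn2r ?nnegrE//.
    apply: (le_trans (lipschitz_from ds1 (fun z _ => s2m z))).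
    by rewrite !normrM (gtr0_norm m0) ler_pM2l// scale_injective.
  have h2b : 16 * c * A ^+ 2 * h <= gamma / 2.
    rewrite mulrC -ler_pdivlMr//; apply: (le_trans (ltW hh2)).
    by rewrite le_eqVlt; apply/orP; left; apply/eqP; rewrite /h2; field; rewrite !gt_eqF.
  have -> : a0 + 64 * a4 * h ^+ 2 = D ^+ 2 + h * (2 * `|D| * kap) + 2 * h * G ^+ 2
      + h * (16 * c * A ^+ 2 * h).
    have -> : h * (2 * `|D| * kap) = 2 * `|D| * (h * kap) by ring.
    by rewrite kapE /a0 /a4 cE; ring.
  have amgm : 2 * `|D| * kap <= D ^+ 2 + gamma / 2.
    apply: (@le_trans _ _ (D ^+ 2 + kap ^+ 2)); last by rewrite lerD2l.
    rewrite -(real_normK (num_real D)) -subr_ge0.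
    have -> : `|D| ^+ 2 + kap ^+ 2 - 2 * `|D| * kap = (`|D| - kap) ^+ 2 by ring.
    exact: sqr_ge0.
  have h20' : 0 <= 2 * h by rewrite mulr_ge0// ltW.
  have hw := ltW hp.
  apply: (le_trans (lerD (lerD (lerD (lexx _) (ler_wpM2l hw amgm))
    (ler_wpM2l h20' G2)) (ler_wpM2l hw h2b))).
  by rewrite le_eqVlt; apply/orP; left; apply/eqP; rewrite -/D; field.
pose N x0 beta0 := s (x0 + (h * beta0 + xi)) - s x0 - s1 x0 * xi.
have beta2 z beta0 : `|beta0 - b z| <= eps -> `|beta0| <= 2 * m.
  move=> hz; rewrite -[beta0](subrK (b z)); apply: (le_trans (ler_normD _ _)).
  by rewrite mulr_natl mulr2n lerD// (le_trans hz)// (le_trans eps1).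
have N1 : `|N x beta| <= A * (h + xi ^+ 2).
  exact: scale_expansion_crude (beta2 _ _ hb).
have N1' : `|N y beta'| <= A * (h + xi ^+ 2).
  exact: scale_expansion_crude (beta2 _ _ hb').
have E1 := hC x h beta xi eps hp hle1 eps1 hb.
have E2 := hC y h beta' xi eps hp hle1 eps1 hb'.
rewrite -/(N x beta) in E1; rewrite -/(N y beta') in E2.
(* In the product with [D] the centred part of [NN] goes into [a2], so only [E] has to be small; in
   the square of [NN] the crude bound is enough. *)
pose NN := N x beta - N y beta'; pose E := NN - Q * (xi ^+ 2 - h).
have -> : s (x + (h * beta + xi)) - s (y + (h * beta' + xi)) = D + G * xi + NN.
  by rewrite /NN /N /D /G; ring.
have hE : `|E| <= p0 + p2 * xi ^+ 2 + p4 * xi ^+ 4.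
  have -> : E = (N x beta - s2 x / 2 * (xi ^+ 2 - h)) - (N y beta' - s2 y / 2 * (xi ^+ 2 - h)).
    by rewrite /E /NN /Q; field.
  apply: (le_trans (ler_normB _ _)); apply: (le_trans (lerD E1 E2)).
  by rewrite le_eqVlt; apply/orP; left; apply/eqP; rewrite /p0 /p2 /p4; ring.
have hN : NN ^+ 2 <= 8 * A ^+ 2 * (h ^+ 2 + xi ^+ 4).
  apply: (@le_trans _ _ ((2 * (A * (h + xi ^+ 2))) ^+ 2)).
    rewrite -(real_normK (num_real NN)) lerXn2r ?nnegrE//.
      apply: mulr_ge0 => //; apply: mulr_ge0; first exact: ltW.
      by apply: addr_ge0; [exact: ltW|exact: sqr_ge0].
    by apply: (le_trans (ler_normB _ _)); rewrite mulr_natl mulr2n lerD.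
  rewrite -subr_ge0.
  have -> : 8 * A ^+ 2 * (h ^+ 2 + xi ^+ 4) - (2 * (A * (h + xi ^+ 2))) ^+ 2 =
    (2 * (A * (h - xi ^+ 2))) ^+ 2 by ring.
  exact: sqr_ge0.
have DE : 2 * D * E <= 2 * `|D| * (p0 + p2 * xi ^+ 2 + p4 * xi ^+ 4).
  apply: (le_trans (ler_norm _)); rewrite normrM normrM (ger0_norm (_ : 0 <= 2))//.
  by apply: ler_wpM2l hE; exact: mulr_ge0.
have sq : (G * xi + NN) ^+ 2 <= 2 * G ^+ 2 * xi ^+ 2 + 2 * NN ^+ 2.
  by rewrite -subr_ge0; have := sqr_ge0 (G * xi - NN); congr (0 <= _); ring.
have -> : (D + G * xi + NN) ^+ 2 =
  D ^+ 2 + 2 * D * G * xi + 2 * D * Q * (xi ^+ 2 - h) + 2 * D * E + (G * xi + NN) ^+ 2.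
  by rewrite /E; ring.
have two : 0 <= 2 :> R by [].
apply: (le_trans (lerD (lerD (lexx _) DE) (le_trans sq (lerD (lexx _) (ler_wpM2l two hN))))).
by rewrite le_eqVlt; apply/orP; left; apply/eqP; rewrite /a0 /a4; ring.
Qed.

End step.

End scale.

(** * Pathwise uniqueness for additive noise *)

Section euler_moments.
Context {R : realType} {d : measure_display} {Omega : measurableType d}.
Variables (P : probability Omega R) (T : R) (F : R -> set (set Omega))
  (B : R -> Omega -> R).
Hypotheses (T0 : 0 < T) (hF : complete_filtration P T F)
  (hB : brownian_motion P T F B).

Lemma euler_adapted (b : R -> R) h y k : measurable_fun [set: R] b -> 0 < h ->
  k%:R * h <= T ->
  adapted_to (F (k%:R * h)) (fun w => euler b (fun t => B t w) h y k).
Proof.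
move=> mb h0; have kh k' : 0 <= k'%:R * h by rewrite mulr_ge0// ltW.
elim: k => [|k ih] kT; first exact: measurable_cst.
have kk : k%:R * h <= k.+1%:R * h by rewrite ler_wpM2r ?ler_nat// ltW.
have {}ih := filtration_adapted hF (kh _) kk kT (ih (le_trans kk kT)).
apply: measurable_funD; first apply: measurable_funD => //.
  by apply: measurable_funM => //; exact: (measurableT_comp mb ih).
by apply: measurable_funB; apply: (brownian_adapted hF hB).
Qed.

Lemma euler_measurable (b : R -> R) h y k : measurable_fun [set: R] b -> 0 < h ->
  k%:R * h <= T ->
  measurable_fun [set: Omega] (fun w => euler b (fun t => B t w) h y k).
Proof.
move=> mb h0 kT; have kh : 0 <= k%:R * h by rewrite mulr_ge0// ltW.
exact: (adapted_to_measurable (filtration_sigma hF kh kT)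
  (filtration_measurable hF kh kT) (euler_adapted y mb h0 kT)).
Qed.

(** After freezing, the estimate is made for each pair of positions separately. The coefficients may
    be chosen in any way for each pair, since only the resulting bound is integrated. *)
Lemma conditional_moment u v (X Y : Omega -> R) (s bp bm : R -> R) (C gamma : R) :
  0 <= u -> u < v -> v <= T -> adapted_to (F u) X -> adapted_to (F u) Y ->
  measurable_fun [set: R] s -> measurable_fun [set: R] bp ->
  measurable_fun [set: R] bm -> 0 <= C -> 0 <= gamma ->
  (forall x y, exists a0 a1 a2 a4, [/\ 0 <= a4,
     a0 + 64 * a4 * (v - u) ^+ 2 <= (s x - s y) ^+ 2 * C + gamma &
     forall xi, (s (x + ((v - u) * bp x + xi)) - s (y + ((v - u) * bm y + xi))) ^+ 2 <=
        a0 + a1 * xi + a2 * (xi ^+ 2 - (v - u)) + a4 * xi ^+ 4]) ->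
  (\int[P]_w ((s (X w + ((v - u) * bp (X w) + (B v w - B u w))) -
               s (Y w + ((v - u) * bm (Y w) + (B v w - B u w)))) ^+ 2)%:E <=
   C%:E * \int[P]_w ((s (X w) - s (Y w)) ^+ 2)%:E + gamma%:E)%E.
Proof.
move=> u0 uv vT aX aY ms mbp mbm C0 gamma0 hstep.
have uT := ltW (lt_le_trans uv vT).
have sG := filtration_sigma hF u0 uT; have Gm := filtration_measurable hF u0 uT.
have mX := adapted_to_measurable sG Gm aX.
have mY := adapted_to_measurable sG Gm aY.
have h0 : 0 < v - u by rewrite subr_gt0.
have [_ _ _ /(_ u v u0 uv vT)[ind law]] := hB.
have mxi := brownian_increment_measurable hF hB u0 (ltW uv) vT.
pose g (z : (R * R) * R) := s (z.1.1 + ((v - u) * bp z.1.1 + z.2)) -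
  s (z.1.2 + ((v - u) * bm z.1.2 + z.2)).
pose Phi (z : (R * R) * R) := (g z ^+ 2)%:E.
have mPhi : measurable_fun [set: (R * R) * R] Phi.
  apply/measurable_EFinP/measurable_funX.
  have m11 : measurable_fun [set: (R * R) * R] (fun z => z.1.1).
    exact: (measurableT_comp measurable_fst measurable_fst).
  have m12 : measurable_fun [set: (R * R) * R] (fun z => z.1.2).
    exact: (measurableT_comp measurable_snd measurable_fst).
  have m2 : measurable_fun [set: (R * R) * R] (fun z => z.2) by exact: measurable_snd.
  apply: measurable_funB; apply: (measurableT_comp ms); apply: measurable_funD => //;
    apply: measurable_funD => //; apply: measurable_funM => //.
    exact: (measurableT_comp mbp m11).
  exact: (measurableT_comp mbm m12).
have aXY : adapted_to (F u) (fun w => (X w, Y w)) by exact: measurable_fun_pair.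
rewrite [leLHS](_ : _ = \int[P]_w Phi ((X w, Y w), (B v w - B u w)%R))%E//.
rewrite (freezing mxi _ ind law _ mPhi)//; first last.
- by move=> z; rewrite lee_fin sqr_ge0.
- exact/(adapted_toP _ sG).
- exact: measurable_fun_pair.
have mD : measurable_fun [set: Omega] (fun w => ((s (X w) - s (Y w)) ^+ 2)%:E).
  apply/measurable_EFinP/measurable_funX.
  by apply: measurable_funB; exact: measurableT_comp.
rewrite -ge0_integralZl//; last by move=> w _; rewrite lee_fin sqr_ge0.
have -> : gamma%:E = (\int[P]_w (cst gamma%:E) w)%E.
  by rewrite integral_cst//= (@probability_setT _ _ _ P) mule1.
rewrite -ge0_integralD//; last 2 first.
- by move=> w _; rewrite -EFinM lee_fin; apply: mulr_ge0 => //; exact: sqr_ge0.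
- exact: measurable_funeM.
apply: ge0_le_integral => //.
- by move=> w _; apply: integral_ge0 => x _; rewrite lee_fin sqr_ge0.
- have mF : measurable_fun [set: R * R]
      (fun z => \int[normal_prob 0 (Num.sqrt (v - u))]_x Phi (z, x))%E.
    apply: measurable_fun_fubini_tonelli_F => //.
    by move=> z; rewrite lee_fin sqr_ge0.
  exact: (measurableT_comp mF (measurable_fun_pair mX mY)).
- by apply: emeasurable_funD => //; exact: measurable_funeM.
move=> w _; rewrite -EFinM -EFinD.
have [a0 [a1 [a2 [a4 [a40 ha hPhi]]]]] := hstep (X w) (Y w).
have sq4 : Num.sqrt (v - u) ^+ 4 = (v - u) ^+ 2.
  by rewrite -[4%N]/(2 * 2)%N exprM sqr_sqrtr// ltW.
apply: (@le_trans _ _ (a0 + 64 * a4 * Num.sqrt (v - u) ^+ 4)%:E); last first.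
  by rewrite sq4 lee_fin (mulrC C).
apply: (@normal_integral_le _ _ (fun x => g ((X w, Y w), x) ^+ 2) _ a1 a2) => //.
- by rewrite sqrtr_gt0.
- have := measurableT_comp mPhi (measurable_pair1 (X w, Y w)).
  by move/measurable_EFinP.
- by move=> x; exact: sqr_ge0.
by move=> x; rewrite sqr_sqrtr ?(ltW h0)//; exact: hPhi.
Qed.

(** [K] comes before [gamma], and only [eps] and [h0] depend on it; this allows [gamma] to be the
    squared grid width later. The bound is a discrete Gronwall estimate in the scale. *)
Lemma euler_moment (b s s1 s2 : R -> R) (m : R) : 1 <= m ->
  scale_function b m s s1 s2 ->
  exists2 K : R, 0 <= K & forall gamma : R, 0 < gamma -> exists eps h0 : R,
  [/\ 0 < eps, 0 < h0 & forall (bp bm : R -> R) (h : R) N (x y : R),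
    measurable_fun [set: R] bp -> measurable_fun [set: R] bm ->
    (forall z, `|bp z - b z| <= eps) -> (forall z, `|bm z - b z| <= eps) ->
    0 < h -> h < h0 -> N%:R * h <= T ->
    (\int[P]_w ((euler bp (fun t => B t w) h x N -
                 euler bm (fun t => B t w) h y N) ^+ 2)%:E
      <= (K * ((x - y) ^+ 2 + gamma))%:E)%E].
Proof.
move=> m1 hs; have [[ds ds1] [s1l s1m] [s2m bm] us2 harm] := hs.
have m0 : 0 < m by exact: lt_le_trans m1.
have m40 : 0 <= m ^+ 4 by apply: exprn_ge0; exact: ltW.
pose C := 1 + 2 * m ^+ 4; have C0 : 0 < C by rewrite ltr_wpDr// mulr_ge0.
have ms : measurable_fun [set: R] s.
  by apply: continuous_measurable_fun; exact: derivable_continuous ds.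
(* The outer [m ^+ 2] is the cost of leaving the scale and the inner one that of entering it; the
   exponential is the Gronwall factor, and [T] accumulates [gamma]. *)
exists (m ^+ 2 * (expR (C * T) * (m ^+ 2 + T))).
  apply: mulr_ge0; first exact: sqr_ge0.
  apply: mulr_ge0; first exact: expR_ge0.
  by apply: addr_ge0; [exact: sqr_ge0|exact: ltW].
move=> gamma gamma0; have [eps [h0 [e0 h00 hstep]]] := scale_step m1 hs gamma0.
exists eps, h0; split=> // bp bm' h N x y mbp mbm hbp hbm hp hh0 NT.
pose V k w := euler bp (fun t => B t w) h x k.
pose U k w := euler bm' (fun t => B t w) h y k.
have Ch : 0 <= 1 + C * h by rewrite addr_ge0// mulr_ge0// ltW.
have induction k : (k <= N)%N ->
  (\int[P]_w ((s (V k w) - s (U k w)) ^+ 2)%:E <=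
    ((1 + C * h) ^+ k * ((s x - s y) ^+ 2 + k%:R * h * gamma))%:E)%E.
  elim: k => [|k ih] kN.
    rewrite /V /U/= expr0 mul1r mul0r mul0r addr0 integral_cst//=.
    by rewrite (@probability_setT _ _ _ P) mule1.
  have kT : k.+1%:R * h <= T by rewrite (le_trans _ NT)// ler_pM2r// ler_nat.
  have kh : 0 <= k%:R * h by rewrite mulr_ge0// ltW.
  have kk : k%:R * h < k.+1%:R * h by rewrite ltr_pM2r// ltr_nat.
  have kT' := le_trans (ltW kk) kT.
  have hE : k.+1%:R * h - k%:R * h = h by rewrite -natr1; ring.
  have step x' y' : exists a0 a1 a2 a4, [/\ 0 <= a4,
     a0 + 64 * a4 * (k.+1%:R * h - k%:R * h) ^+ 2 <=
       (s x' - s y') ^+ 2 * (1 + C * h) + h * gamma &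
     forall xi, (s (x' + ((k.+1%:R * h - k%:R * h) * bp x' + xi)) -
         s (y' + ((k.+1%:R * h - k%:R * h) * bm' y' + xi))) ^+ 2 <=
        a0 + a1 * xi + a2 * (xi ^+ 2 - (k.+1%:R * h - k%:R * h)) + a4 * xi ^+ 4].
    by rewrite hE; exact: hstep.
  have hg : 0 <= h * gamma by rewrite mulr_ge0// ltW.
  have := conditional_moment kh kk kT (euler_adapted x mbp hp kT')
    (euler_adapted y mbm hp kT') ms mbp mbm Ch hg step.
  rewrite hE => H.
  rewrite [leLHS](_ : _ = \int[P]_w ((s (V k w + (h * bp (V k w) +
       (B (k.+1%:R * h) w - B (k%:R * h) w))) - s (U k w + (h * bm' (U k w) +
       (B (k.+1%:R * h) w - B (k%:R * h) w)))) ^+ 2)%:E)%E; last first.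
    by congr integral; apply/funext => w; rewrite /V /U/= -!addrA.
  apply: (le_trans H).
  apply: le_trans (leeD (lee_wpmul2l _ (ih (ltnW kN))) (lexx _)) _; first by rewrite lee_fin.
  rewrite -EFinM -EFinD lee_fin.
  have p1 : 1 <= (1 + C * h) ^+ k.+1.
    by apply: exprn_ege1; rewrite lerDl mulr_ge0// ltW.
  rewrite exprS in p1.
  have h1 : 0 <= (1 + C * h) * (1 + C * h) ^+ k * (h * gamma) - h * gamma.
    by rewrite subr_ge0 ler_peMl.
  rewrite -subr_ge0 (exprS _ k) -natr1; apply: (le_trans h1).
  by rewrite le_eqVlt; apply/orP; left; apply/eqP; ring.
have k1 : (1 + C * h) ^+ N <= expR (C * T).
  apply: (@le_trans _ _ (expR (C * h) ^+ N)).
    by apply: lerXn2r; rewrite ?nnegrE ?expR_ge0// expR_ge1Dx.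
  rewrite -expRM_natl ler_expR mulrCA ler_pM2l//.
have D0 : (s x - s y) ^+ 2 <= m ^+ 2 * (x - y) ^+ 2.
  have -> : m ^+ 2 * (x - y) ^+ 2 = (m * (x - y)) ^+ 2 by ring.
  rewrite -(real_normK (num_real (s x - s y))) -(real_normK (num_real (m * (x - y)))).
  rewrite lerXn2r ?nnegrE// normrM (gtr0_norm m0).
  apply: lipschitz_from => // z _; rewrite ger0_norm//.
  by rewrite (le_trans _ (s1l z))// invr_ge0 ltW.
apply: (@le_trans _ _ (\int[P]_w ((m ^+ 2)%:E * ((s (V N w) - s (U N w)) ^+ 2)%:E))%E).
  have mV := euler_measurable x mbp hp NT; have mU := euler_measurable y mbm hp NT.
  have msV : measurable_fun [set: Omega] (fun w => s (V N w)) by exact: measurableT_comp.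
  have msU : measurable_fun [set: Omega] (fun w => s (U N w)) by exact: measurableT_comp.
  apply: ge0_le_integral => //.
  - by move=> w _; rewrite lee_fin sqr_ge0.
  - by apply/measurable_EFinP/measurable_funX; exact: measurable_funB.
  - by apply: measurable_funeM; apply/measurable_EFinP/measurable_funX; exact: measurable_funB.
  move=> w _; rewrite -EFinM lee_fin -exprMn.
  rewrite -(real_normK (num_real (_ - euler _ _ _ _ _))).
  rewrite -(real_normK (num_real (m * _))) lerXn2r ?nnegrE// normrM (gtr0_norm m0).
  exact: scale_injective hs _ _.
rewrite ge0_integralZl//; last 3 first.
- by apply/measurable_EFinP/measurable_funX; apply: measurable_funB;
    apply: (measurableT_comp ms); exact: euler_measurable.
- by move=> w _; rewrite lee_fin sqr_ge0.
- by rewrite lee_fin sqr_ge0.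
apply: le_trans (lee_wpmul2l _ (induction N (leqnn N))) _; first by rewrite lee_fin sqr_ge0.
rewrite -EFinM lee_fin -[leRHS]mulrA; apply: ler_wpM2l; first exact: sqr_ge0.
rewrite -[leRHS]mulrA.
apply: ler_pM => //; first exact: exprn_ge0.
  apply: addr_ge0; first exact: sqr_ge0.
  by apply: mulr_ge0; [apply: mulr_ge0 => //|]; exact: ltW.
have g1 : N%:R * h * gamma <= T * gamma by rewrite ler_pM2r.
have g2 : 0 <= m ^+ 2 * gamma by apply: mulr_ge0; [exact: sqr_ge0|exact: ltW].
have g3 : 0 <= T * (x - y) ^+ 2 by apply: mulr_ge0; [exact: ltW|exact: sqr_ge0].
apply: (le_trans (lerD D0 g1)); rewrite mulrDl !mulrDr; lra.
Qed.

End euler_moments.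

Section small_sets.
Context {R : realType} {d : measure_display} {Omega : measurableType d}.
Variable P : probability Omega R.

(** Lower limits of events are needed because the step size below which the schemes enclose two
    given solutions depends on the outcome and on the solutions. *)
Lemma eventually_measure_le (E : nat -> set Omega) (c : R) N1 :
  (forall n, measurable (E n)) -> (forall n, (N1 <= n)%N -> (P (E n) <= c%:E)%E) ->
  (P (\bigcup_n \bigcap_(k in [set k | (n <= k)%N]) E k) <= c%:E)%E.
Proof.
move=> mE Ec; pose G n := \bigcap_(k in [set k | (n <= k)%N]) E k.
have mG n : measurable (G n) by apply: bigcap_measurableType => k _; exact: mE.
have ndG : {homo G : n k / (n <= k)%N >-> (n <= k)%O}.
  move=> n k nk; apply/subsetPset => w Gw j /= kj; apply: Gw => /=.
  exact: leq_trans kj.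
have := nondecreasing_cvg_mu (mu := P) mG (bigcupT_measurable _ mG) ndG.
move=> /cvge_to_le; apply; apply: nearW => n /=.
apply: (@le_trans _ _ (P (E (maxn n N1)))); last by apply: Ec; exact: leq_maxr.
apply: le_measure; rewrite ?inE// => w; apply => /=; exact: leq_maxl.
Qed.

Lemma negligible_of_small (A : set Omega) :
  (forall e : R, 0 < e -> exists2 U, measurable U & A `<=` U /\ (P U <= e%:E)%E) ->
  P.-negligible A.
Proof.
move=> small.
have pos n : 0 < n.+1%:R^-1 :> R by rewrite invr_gt0.
have /choice[U hU] : forall n, exists U, [/\ measurable U, A `<=` U &
    (P U <= (n.+1%:R^-1)%:E)%E].
  by move=> n; have [U mU [AU PU]] := small _ (pos n); exists U.
have mU : measurable (\bigcap_n U n).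
  by apply: bigcap_measurableType => n _; have [] := hU n.
exists (\bigcap_n U n); split => //; last first.
  by move=> w Aw n _; have [_ AU _] := hU n; exact: AU.
apply/eqP; rewrite eq_le measure_ge0 andbT; apply/lee_addgt0Pr => e e0.
rewrite add0e; pose n := Num.truncn e^-1; have [mUn _ PU] := hU n.
apply: (@le_trans _ _ (P (U n))); first by apply: le_measure; rewrite ?inE// => w; apply.
apply: (le_trans PU); rewrite lee_fin -[leRHS]invrK lef_pV2 ?posrE ?invr_gt0//.
by rewrite ltW// truncnS_gt.
Qed.

End small_sets.

Section separation.
Context {R : realType} {d : measure_display} {Omega : measurableType d}.
Variables (P : probability Omega R) (T : R) (F : R -> set (set Omega))
  (B : R -> Omega -> R).
Hypotheses (T0 : 0 < T) (hF : complete_filtration P T F)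
  (hB : brownian_motion P T F B).

(** Time, gap and range of starting points are fixed here, so that one grid and one application of
    Chebyshev per cell suffice; countable unions follow later. *)
Lemma additive_solutions_agree_at (b : R -> R) (M K t Kr rho : R) :
  (forall x, `|b x| <= M) -> 0 <= K -> (forall x, K <= `|x| -> b x = 0) ->
  unif_cont b -> 0 < t -> t <= T -> 0 <= Kr -> 0 < rho ->
  P.-negligible [set w | exists Z1 Z2, [/\
    additive_solution T b (fun t => B t w) Z1,
    additive_solution T b (fun t => B t w) Z2, Z1 0 = Z2 0, `|Z1 0| <= Kr &
    rho <= Z1 t - Z2 t]].
Proof.
move=> bM K0 bK ub t0 tT Kr0 rho0; apply: negligible_of_small => e e0.
have [m [s [s1 [s2 [m1 hs]]]]] := scale_function_exists bM K0 bK ub.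
have [C C0 hC] := euler_moment T0 hF hB m1 hs.
have rho2 : 0 < rho ^+ 2 by rewrite exprn_gt0.
(* The extra 1 keeps [L] positive and puts the starting point [Kr] strictly inside the grid. *)
pose L := 2 * Kr + 1; have L0 : 0 < L by rewrite ltr_wpDl// mulr_ge0.
(* The [n] cells contribute [C * 2 * wd ^ 2 / rho ^ 2] each, in total
   [2 * C * L ^ 2 / (rho ^ 2 * n)], which is then at most [e]. *)
pose n := (Num.truncn (2 * C * L ^+ 2 / (rho ^+ 2 * e))).+1.
have n0 : 0 < n%:R :> R by rewrite ltr0n.
pose wd := L / n%:R; have wd0 : 0 < wd by rewrite divr_gt0.
have wd2 : 0 < wd ^+ 2 by rewrite exprn_gt0.
have [eps [h0 [eps0 h00 hE]]] := hC _ wd2.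
have eps2 : 0 < eps / 3 by rewrite divr_gt0.
have [Lb [bL [lipL bLb]]] := inf_convolution bM ub eps2.
(* Since [bL] lies between [b - eps / 3] and [b], both shifts leave a margin [eps / 3] to [b] and
   stay within [eps] of it. *)
pose bp x := bL x + 2 * (eps / 3); pose bm x := bL x - eps / 3.
have lipp x y : `|bp x - bp y| <= Lb * `|x - y|.
  by have -> : bp x - bp y = bL x - bL y by rewrite /bp; ring.
have lipm x y : `|bm x - bm y| <= Lb * `|x - y|.
  by have -> : bm x - bm y = bL x - bL y by rewrite /bm; ring.
have mp : measurable_fun [set: R] bp.
  apply: continuous_measurable_fun; apply: unif_cont_continuous.
  exact: lipschitz_unif_cont lipp.
have mm : measurable_fun [set: R] bm.
  apply: continuous_measurable_fun; apply: unif_cont_continuous.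
  exact: lipschitz_unif_cont lipm.
have bbp x : b x + eps / 3 <= bp x by have := bLb x; rewrite /bp; lra.
have bbm x : bm x + eps / 3 <= b x by have := bLb x; rewrite /bm; lra.
have dp z : `|bp z - b z| <= eps by rewrite ler_norml; have := bLb z; rewrite /bp; lra.
have dm z : `|bm z - b z| <= eps by rewrite ler_norml; have := bLb z; rewrite /bm; lra.
pose x i : R := - Kr + i%:R * wd.
pose h N := t / N.+1%:R.
have hp N : 0 < h N by rewrite divr_gt0.
have hN N : N.+1%:R * h N = t by rewrite /h mulrC divfK// gt_eqF.
have h_small del : 0 < del -> exists N1, forall N, (N1 <= N)%N -> h N < del.
  move=> d0; exists (Num.truncn (t / del)) => N N1.
  rewrite ltr_pdivrMr// mulrC -ltr_pdivrMr// (lt_le_trans (truncnS_gt _))//.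
  by rewrite ler_nat.
pose D i N w := euler bp (fun t => B t w) (h N) (x i.+1) N.+1 -
   euler bm (fun t => B t w) (h N) (x i) N.+1.
have mD i N : measurable_fun [set: Omega] (D i N).
  by apply: measurable_funB; apply: (euler_measurable hF hB) => //; rewrite hN.
pose E N := \bigcup_(i < n) [set w | rho <= `|D i N w|].
have mA i N : measurable [set w | rho <= `|D i N w|].
  by apply: measurable_superlevel; exact: measurableT_comp.
have mE N : measurable (E N) by apply: bigcup_measurable => i _; exact: mA.
have [N1 hN1] := h_small _ h00.
have PE N : (N1 <= N)%N -> (P (E N) <= e%:E)%E.
  move=> N1N; rewrite /E bigcup_mkord.
  apply: (le_trans (Boole_inequality P (fun i _ => mA i N))).
  apply: (@le_trans _ _ (\sum_(i < n) (C * (2 * wd ^+ 2) / rho ^+ 2)%:E)%E).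
    apply: lee_sum => i _; apply: markov_square => //.
    have := hE bp bm (h N) N.+1 (x i.+1) (x i) mp mm dp dm (hp N) (hN1 _ N1N).
    rewrite hN => /(_ tT) /le_trans; apply; rewrite lee_fin.
    have -> : x i.+1 - x i = wd by rewrite /x -natr1; ring.
    by rewrite mulr_natl mulr2n.
  rewrite sumEFin lee_fin sumr_const card_ord -[leLHS]mulr_natl.
  have -> : n%:R * (C * (2 * wd ^+ 2) / rho ^+ 2) =
     (2 * C * L ^+ 2 / (rho ^+ 2 * e)) / n%:R * e.
    by rewrite /wd; field; rewrite !gt_eqF.
  rewrite ler_piMl ?(ltW e0)// ler_pdivrMr// mul1r ltW// truncnS_gt//.
have mU : measurable (\bigcup_j \bigcap_(k in [set k | (j <= k)%N]) E k).
  apply: bigcupT_measurable => j; apply: bigcap_measurableType => k _; exact: mE.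
exists (\bigcup_j \bigcap_(k in [set k | (j <= k)%N]) E k) => //; split; last first.
  exact: eventually_measure_le PE.
move=> w /= [Z1 [Z2 [sol1 sol2 Z12 ZK rhoZ]]].
have [d1 d10 hd1] := euler_dominates sol1 eps2 bbp lipp.
have [d2 d20 hd2] := euler_dominated sol2 eps2 bbm lipm.
have [j1 hj1] := h_small _ d10; have [j2 hj2] := h_small _ d20.
pose i := Num.truncn ((Z1 0 + Kr) / wd).
have ZK' : 0 <= Z1 0 + Kr by move: ZK; rewrite ler_norml => /andP[]; lra.
have /andP[i1 i2] : i%:R <= (Z1 0 + Kr) / wd < i.+1%:R.
  by apply: truncn_itv; rewrite divr_ge0// ltW.
have lt_in : (i < n)%N.
  rewrite -(ltr_nat R); apply: (le_lt_trans i1); rewrite ltr_pdivrMr// /wd.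
  rewrite mulrC divfK ?gt_eqF// /L.
  by move: ZK; rewrite ler_norml => /andP[]; lra.
exists (maxn j1 j2) => // k /= jk; exists i => //=.
apply: (le_trans rhoZ); apply: le_trans (ler_norm _).
rewrite lerB//.
  rewrite -{1}(hN k); apply: hd1 => //; rewrite ?hN//.
    by apply: hj1; rewrite (leq_trans _ jk)// leq_maxl.
  by rewrite /x; move: i2; rewrite ltr_pdivrMr//; lra.
rewrite -(hN k); apply: hd2 => //; rewrite ?hN//.
  by apply: hj2; rewrite (leq_trans _ jk)// leq_maxr.
by rewrite /x -Z12; move: i1; rewrite ler_pdivlMr//; lra.
Qed.

End separation.

(** * Cutting off the drift *)

Section additive_paths.
Context {R : realType}.
Implicit Types (b W Z : R -> R).

(** The factor is the piecewise linear plateau, 1 on [[-K, K]] and 0 outside [[-K-1, K+1]]. *)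
Definition cutoff (K : R) b x := b x * clamp 1 (K + 1 - `|x|).

Lemma cutoff_id K b x : `|x| <= K -> cutoff K b x = b x.
Proof.
move=> xK; rewrite /cutoff /clamp min_r ?max_r ?mulr1//.
by rewrite lerBrDr addrC lerD2r.
Qed.

Lemma cutoff_eq0 K b x : K + 1 <= `|x| -> cutoff K b x = 0.
Proof.
move=> xK; rewrite /cutoff /clamp min_l ?max_l ?mulr0// ?subr_le0//.
by rewrite (le_trans (_ : _ <= 0))// subr_le0.
Qed.

Lemma cutoff_bounded K b M x : (forall y, `|b y| <= M) -> `|cutoff K b x| <= M.
Proof.
move=> bM; rewrite normrM -[leRHS]mulr1 ler_pM//.
by have [c0 c1] := clamp_itv (K + 1 - `|x|) (@ler01 R); rewrite ger0_norm.
Qed.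

Lemma cutoff_unif_cont K b M : (forall y, `|b y| <= M) -> unif_cont b ->
  unif_cont (cutoff K b).
Proof.
move=> bM ub; apply: (@unif_contM _ _ _ (M + 1)) => //.
- by move=> x; rewrite (le_trans (bM x))// lerDl.
- move=> x; have [c0 c1] := clamp_itv (K + 1 - `|x|) (@ler01 R); rewrite ger0_norm//.
  by rewrite (le_trans c1)// lerDr (le_trans _ (bM 0)).
apply: (@lipschitz_unif_cont _ _ 1) => x y; rewrite mul1r.
apply: (le_trans (clamp_lip _ _ _)).
have -> : K + 1 - `|x| - (K + 1 - `|y|) = `|y| - `|x| by ring.
by rewrite (distrC x) ler_dist_dist.
Qed.

Lemma additive_solution_cutoff T K b W Z :
  (forall t, 0 <= t -> t <= T -> `|Z t| <= K) ->
  additive_solution T b W Z -> additive_solution T (cutoff K b) W Z.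
Proof.
move=> ZK sol eps e0; have [del d0 hd] := sol _ e0; exists del => // u v u0 uv vT vu.
by rewrite cutoff_id ?ZK ?hd// (le_trans uv).
Qed.

Lemma additive_solution_continuous T b W Z M : 0 <= T -> (forall x, `|b x| <= M) ->
  continuous (W \o clamp T) -> additive_solution T b W Z ->
  continuous (Z \o clamp T).
Proof.
move=> T0 bM cW sol x.
have M0 : 0 <= M by exact: le_trans (bM 0).
have [del d0 hd] := sol 1 ltr01.
have close u v : `|u - v| < del ->
    `|Z (clamp T v) - Z (clamp T u)| <=
    `|W (clamp T v) - W (clamp T u)| + (1 + M) * `|v - u|.
  wlog uv : u v / clamp T u <= clamp T v.
    move=> hw uvd; have [uv|/ltW vu] := leP (clamp T u) (clamp T v); first exact: hw.
    by rewrite distrC (distrC (W _)) (distrC v); apply: hw => //; rewrite distrC.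
  rewrite distrC => uvd.
  have [u0 _] := clamp_itv u T0; have [_ vT] := clamp_itv v T0.
  have le1 : clamp T v - clamp T u <= `|v - u|.
    by apply: le_trans (ler_norm _) (clamp_lip _ _ _).
  have := hd _ _ u0 uv vT (le_lt_trans le1 uvd).
  set z := Z _ - Z _; set w := W _ - W _; set r := clamp T v - clamp T u => h.
  have -> : z = (z - w - b (Z (clamp T u)) * r) + w + b (Z (clamp T u)) * r by ring.
  have r0 : 0 <= r by rewrite subr_ge0.
  apply: le_trans (le_trans (ler_normD _ _) (lerD (le_trans (ler_normD _ _)
    (lerD h (lexx _))) (lexx _))) _.
  rewrite normrM (ger0_norm r0) mul1r addrAC addrC lerD2l.
  rewrite mulrDl mul1r lerD// ler_pM//.
apply/cvgrPdist_le => eps e0.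
have e2 : 0 < eps / 2 by rewrite divr_gt0.
have /cvgrPdist_le/(_ _ e2) nW := cW x.
have M1 : 0 < 1 + M by rewrite ltr_wpDr.
near=> y.
have yx : `|x - y| < Num.min del (eps / 2 / (1 + M)).
  near: y; apply: (@cvgr_dist_lt R R R (nbhs x) _ id) => //.
  by rewrite lt_min d0 divr_gt0.
move: yx; rewrite lt_min => /andP[yd ye].
rewrite /= distrC; apply: (le_trans (close _ _ yd)).
rewrite (splitr eps); apply: lerD.
  by rewrite distrC; near: y.
by rewrite mulrC -ler_pdivlMr// distrC ltW.
Unshelve. all: by end_near. Qed.

(** The bound is an integer, so that countably many cutoff levels reach every solution. *)
Lemma additive_solution_bounded T b W Z M : 0 <= T -> (forall x, `|b x| <= M) ->
  continuous (W \o clamp T) -> additive_solution T b W Z ->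
  exists n : nat, forall t, 0 <= t -> t <= T -> `|Z t| <= n%:R.
Proof.
move=> T0 bM cW sol; have cZ := additive_solution_continuous T0 bM cW sol.
have cn : continuous (fun t => `|(Z \o clamp T) t|).
  by move=> x; apply: (cvg_comp _ _ (cZ x)); exact: norm_continuous.
have [c _ hc] := EVT_max T0 (continuous_subspaceT (A := `[0, T]) cn).
exists (Num.truncn `|(Z \o clamp T) c|).+1 => t t0 tT.
have := hc t; rewrite in_itv/= t0 tT => /(_ isT); rewrite clamp_id// => /le_trans; apply.
exact: ltW (truncnS_gt _).
Qed.

End additive_paths.

Section pathwise_uniqueness.
Context {R : realType} {d : measure_display} {Omega : measurableType d}.
Variables (P : probability Omega R) (T : R) (F : R -> set (set Omega))
  (B : R -> Omega -> R).
Hypotheses (T0 : 0 < T) (hF : complete_filtration P T F)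
  (hB : brownian_motion P T F B).

(** The null set is a countable union over grid times, cutoff levels and gaps [1 / (l + 1)]. Two
    solutions bounded by [n] also solve the equation cut off at [n], and by continuity agreement at
    the grid times is enough. *)
Lemma additive_solutions_unique (b : R -> R) (M : R) :
  (forall x, `|b x| <= M) -> unif_cont b ->
  {ae P, forall w, forall Z1 Z2 : R -> R,
    additive_solution T b (fun t => B t w) Z1 ->
    additive_solution T b (fun t => B t w) Z2 -> Z1 0 = Z2 0 ->
    forall t, 0 <= t -> t <= T -> Z1 t = Z2 t}.
Proof.
move=> bM ub.
pose tt j k : R := k%:R * T / j.+1%:R.
pose S j k n l := [set w | [/\ 0 < tt j k, tt j k <= T & exists Z1 Z2, [/\
    additive_solution T (cutoff n%:R b) (fun t => B t w) Z1,
    additive_solution T (cutoff n%:R b) (fun t => B t w) Z2, Z1 0 = Z2 0,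
    `|Z1 0| <= n%:R & l.+1%:R^-1 <= Z1 (tt j k) - Z2 (tt j k)]]].
have nS : P.-negligible (\bigcup_j \bigcup_k \bigcup_n \bigcup_l S j k n l).
  apply: negligible_bigcup => j; apply: negligible_bigcup => k.
  apply: negligible_bigcup => n; apply: negligible_bigcup => l.
  have [/andP[t0 tT]|nt] := boolP (0 < tt j k <= T); last first.
    by apply: negligibleS (negligible_set0 _) => w [t0 tT]; rewrite t0 tT in nt.
  have l0 : 0 < l.+1%:R^-1 :> R by rewrite invr_gt0.
  have n1 : 0 <= n%:R + 1 :> R by rewrite addr_ge0.
  have := additive_solutions_agree_at T0 hF hB (fun x => cutoff_bounded n%:R x bM) n1
    (@cutoff_eq0 _ n%:R b) (cutoff_unif_cont n%:R bM ub) t0 tT (ler0n _ n) l0.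
  by apply: negligibleS => w [].
have [_ _ cB _] := hB.
apply: filterS2 cB (_ : {ae P, forall w,
    ~ (\bigcup_j \bigcup_k \bigcup_n \bigcup_l S j k n l) w}); last first.
  by apply: negligibleS nS => w /= /contrapT.
move=> w cw nw.
have cW := clamp_continuous_within (ltW T0) cw.
have le_at j k (Z1 Z2 : R -> R) : 0 < tt j k -> tt j k <= T ->
    additive_solution T b (fun t => B t w) Z1 ->
    additive_solution T b (fun t => B t w) Z2 -> Z1 0 = Z2 0 ->
    Z1 (tt j k) <= Z2 (tt j k).
  move=> t0 tT sol1 sol2 Z12; rewrite leNgt; apply/negP; rewrite -subr_gt0 => gt0.
  have [n1 hn1] := additive_solution_bounded (ltW T0) bM cW sol1.
  have [n2 hn2] := additive_solution_bounded (ltW T0) bM cW sol2.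
  have bd1 t : 0 <= t -> t <= T -> `|Z1 t| <= (maxn n1 n2)%:R.
    by move=> ? ?; rewrite (le_trans (hn1 _ _ _))// ler_nat leq_maxl.
  have bd2 t : 0 <= t -> t <= T -> `|Z2 t| <= (maxn n1 n2)%:R.
    by move=> ? ?; rewrite (le_trans (hn2 _ _ _))// ler_nat leq_maxr.
  apply: nw; exists j => //; exists k => //; exists (maxn n1 n2) => //.
  exists (Num.truncn (Z1 (tt j k) - Z2 (tt j k))^-1) => //; split=> //.
  exists Z1, Z2; split=> //.
  - exact: additive_solution_cutoff bd1 sol1.
  - exact: additive_solution_cutoff bd2 sol2.
  - by apply: bd1 => //; exact: ltW.
  rewrite -[leRHS]invrK lef_pV2 ?posrE ?invr_gt0//.
  by rewrite ltW// truncnS_gt.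
move=> Z1 Z2 sol1 sol2 Z12 t t0 tT.
have c1 := additive_solution_continuous (ltW T0) bM cW sol1.
have c2 := additive_solution_continuous (ltW T0) bM cW sol2.
have /cvg_comp h := grid_cvg T0 t0.
have l1 := h _ _ _ (c1 t); have l2 := h _ _ _ (c2 t).
rewrite /= clamp_id// in l1; rewrite /= clamp_id// in l2.
apply: (cvg_unique (@Rhausdorff R) l1); apply: cvg_trans l2; apply: near_eq_cvg; apply: nearW => j /=.
set k := Num.truncn _; rewrite -/(tt j k).
have tt0 : 0 <= tt j k by rewrite divr_ge0// mulr_ge0// ltW.
have ttT : tt j k <= T.
  rewrite ler_pdivrMr// mulrC ler_pM2l// ler_nat truncn_le_nat.
  rewrite ltr_pdivrMr// mulrC (le_lt_trans (y := T * j.+1%:R))//.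
    by rewrite mulrC ler_wpM2r.
  by rewrite mulrC ltr_pM2r// ltr_nat.
rewrite clamp_id//; move: tt0; rewrite le_eqVlt => /predU1P[<-//|tt0].
by apply/eqP; rewrite eq_le !le_at.
Qed.

End pathwise_uniqueness.

Section drift.
Context {R : realType}.
Variables (c lam M : R) (f sigma sigma1 sigma2 h : R -> R).
Hypotheses (dsigma : forall x : R, is_derive x 1 sigma (sigma1 x))
  (dsigma1 : forall x : R, is_derive x 1 sigma1 (sigma2 x))
  (sigmaM : forall x, `|sigma x| <= M) (sigma1M : forall x, `|sigma1 x| <= M)
  (sigma2M : forall x, `|sigma2 x| <= M) (lam0 : 0 < lam)
  (lamsigma : forall x, lam <= `|sigma x|) (fM : forall x, `|f x| <= M).

Let inv_sigma x : `|(sigma x)^-1| <= lam^-1.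
Proof.
by rewrite normfV lef_pV2 ?posrE// (lt_le_trans lam0).
Qed.

Lemma lamperti_drift_bounded z :
  `|lamperti_drift c f sigma sigma1 h z| <= M / lam + `|c| * M.
Proof.
apply: (le_trans (ler_normD _ _)); rewrite !normrM; apply: lerD.
  by apply: ler_pM.
by rewrite ler_wpM2l.
Qed.

Lemma lamperti_drift_unif_cont : unif_cont f ->
  (forall z : R, is_derive z 1 h (sigma (h z))) ->
  unif_cont (lamperti_drift c f sigma sigma1 h).
Proof.
move=> uf dh; have M0 : 0 <= M by exact: le_trans (sigmaM 0).
have uh : unif_cont h.
  apply: (@lipschitz_unif_cont _ _ M) => x y; rewrite distrC (distrC x).
  exact: lipschitz_from.
have us : unif_cont (fun x => (sigma x)^-1).
  apply: (@lipschitz_unif_cont _ _ (lam^-1 * (lam^-1 * M))) => x y.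
  have s0 z : sigma z != 0 by rewrite -normr_gt0 (lt_le_trans lam0).
  have -> : (sigma x)^-1 - (sigma y)^-1 = (sigma x)^-1 * ((sigma y)^-1 * (sigma y - sigma x)).
    by field; rewrite !s0.
  rewrite !normrM -!mulrA; apply: ler_pM => //; apply: ler_pM => //.
  by rewrite (distrC x); exact: lipschitz_from.
have us1 : unif_cont sigma1.
  apply: (@lipschitz_unif_cont _ _ M) => x y; rewrite distrC (distrC x).
  exact: lipschitz_from.
apply: unif_contD.
  apply: (@unif_contM _ _ _ (M + lam^-1)).
  - by move=> z; rewrite (le_trans (fM _))// lerDl invr_ge0 ltW.
  - by move=> z; rewrite (le_trans (inv_sigma _))// lerDr.
  - exact: unif_cont_comp.
  - exact: (unif_cont_comp us).
apply: (@unif_contM _ _ _ (M + `|c|)).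
- by move=> _; rewrite lerDr.
- by move=> z; rewrite (le_trans (sigma1M _))// lerDl.
- by apply: (@lipschitz_unif_cont _ _ 0) => x y; rewrite subrr normr0 mul0r.
- exact: unif_cont_comp.
Qed.

End drift.

Theorem theorem1p8 (R : realType) (d : measure_display)
    (Omega : measurableType d) (P : probability Omega R)
    (T : R) (F : R -> set (set Omega)) (B : R -> Omega -> R)
    (BB : R -> R -> Omega -> R) (alpha theta : R) (f sigma : R -> R)
    (hT : 0 < T)
    (hF : complete_filtration P T F)
    (hB : brownian_motion P T F B)
    (hBB : ito_lift P T F B BB \/ stratonovich_lift P T F B BB)
    (halpha : 1 / 3 < alpha /\ alpha < 1 / 2)
    (hF1 : (exists M : R, forall x, `|f x| <= M) /\ continuous f)
    (hS1 : [/\ forall x, derivable sigma x 1,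
               forall x, derivable (derive1 sigma) x 1,
               continuous (derive1n 2 sigma) &
               exists M : R, forall x,
                 [/\ `|sigma x| <= M, `|derive1 sigma x| <= M
                   & `|derive1n 2 sigma x| <= M]])
    (hS2 : exists2 lambda : R, 0 < lambda & forall x, lambda <= `|sigma x|)
    (htheta : 0 < theta /\ theta < 1)
    (hf : holder_on [set: R] theta f) :
  exists N : set Omega,
    [/\ measurable N, P N = 0%E &
        forall w, ~ N w -> forall x0 : R,
          has_unique_rde_solution T alpha f sigma
            (fun t => B t w) (fun s t => BB s t w) x0].
Proof.
have [alpha3 alpha2] := halpha; have [theta0 _] := htheta.
have [[Mf fMf] _] := hF1; have [ds ds1 _ [Ms sMs]] := hS1.
have [lam lam0 lams] := hS2.
pose M := Num.max Mf Ms.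
have fM x : `|f x| <= M by rewrite le_max fMf.
have sM x : `|sigma x| <= M by rewrite le_max; have [-> _ _] := sMs x; rewrite orbT.
have s1M x : `|derive1 sigma x| <= M.
  by rewrite le_max; have [_ -> _] := sMs x; rewrite orbT.
have s2M x : `|derive1n 2 sigma x| <= M.
  by rewrite le_max; have [_ _ ->] := sMs x; rewrite orbT.
have dsigma (x : R) : is_derive x 1 sigma (derive1 sigma x).
  by rewrite derive1E; apply: derivableP.
have dsigma1 (x : R) : is_derive x 1 (derive1 sigma) (derive1n 2 sigma x).
  by rewrite /derive1n/= derive1E; apply: derivableP.
have uf : unif_cont f := holder_unif_cont theta0 hf.
have csigma : continuous sigma by exact: derivable_continuous dsigma.
have [g [h [dg dh gK hK]]] := lamperti lam0 csigma lams sM.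
have alpha0 : 0 < alpha by apply: lt_trans alpha3; rewrite divr_gt0.
have [c aeBB] := lift_formula hT hF hB hBB.
have bM := lamperti_drift_bounded c h s1M lam0 lams fM.
have ub := lamperti_drift_unif_cont c dsigma dsigma1 sM s1M s2M lam0 lams fM uf dh.
have aeuniq := additive_solutions_unique hT hF hB bM ub.
have aeholder := brownian_holder hT hF hB alpha0 alpha2.
(* None of the three almost sure properties mentions [x0]: [c], [g], [h] and the drift depend on
   [f], [sigma] and the lift alone. Outside [N] the rest of the argument is deterministic. *)
have [N [mN PN hN]] := filterS3 _ (fun w h1 h2 h3 => conj (conj h1 h2) h3)
  aeBB aeholder aeuniq.
exists N; split=> // w /(contra_notP (@hN w)) [[WWE holderW] uniq] x0.
have [Z Z0 solZ] := additive_exists (g x0) hT bM ub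
  (holder_clamp (ltW hT) alpha0 holderW).
exists (h \o Z), (fun t => sigma (h (Z t))); split.
  exact: additive_rde dsigma dsigma1 sM s1M s2M lam0 lams fM uf WWE dh gK _ _ solZ Z0 holderW.
move=> Y Y' solY t t0 tT.
have solgY := rde_additive hT alpha3 alpha2 dsigma dsigma1 sM s1M s2M lam0 lams uf WWE
  dg gK solY.
(* Both [g \o Y] and [Z] solve the additive equation from [g x0]; applying [h] then determines
   [Y]. *)
have gY : g (Y t) = Z t.
  by apply: (uniq (g \o Y) Z) => //=; rewrite Z0 (rde_init hT solY).
by rewrite (rde_derivative solY)//= -gY gK.
Qed.
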